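(* A function $I(\omega, Q, \boldsymbol{\lambda}, \boldsymbol{\mu})$ of the data is an invariant if and only if it has a rational extension which is stable under the multiplication and factorial formulae.
   Context: Every element $F$ of the extended Selberg class $\mathcal{S}^{\sharp}$ satisfies a functional equation $\gamma(s)F(s)=\omega\overline{\gamma}(1-s)\overline{F}(1-s)$, where $\omega\in\mathbb{C}$, $|\omega|=1$, $\overline{f}(s)=\overline{f(\overline{s})}$, and $\gamma(s)=Q^s\prod_{j=1}^r\Gamma(\lambda_j s+\mu_j)$ (a ''$\gamma$-factor'') with $Q>0$, $\lambda_j>0$, $\Re(\mu_j)\ge 0$. The data of the functional equation are $\omega, Q, \boldsymbol{\lambda}=(\lambda_1,\dots,\lambda_r), \boldsymbol{\mu}=(\mu_1,\dots,\mu_r)$. A function $I(\omega,Q,\boldsymbol{\lambda},\boldsymbol{\mu})$ of the data is an invariant if its value depends only on $F$, independently of the particular form of the $\gamma$-factor chosen in the functional equation. The factorial formula is $s\Gamma(s)=\Gamma(s+1)$ and the (Legendre–Gauss) multiplication formula is $\Gamma(s)=m^{s-1/2}(2\pi)^{(1-m)/2}\prod_{k=0}^{m-1}\Gamma\left(\frac{s+k}{m}\right)$; any $\gamma$-factor of $F$ can be transformed to a nonzero complex multiple of any other $\gamma$-factor of $F$ by repeated application of these two formulae. Let $R(s)$ denote a generic not identically vanishing rational function. A complex-valued function $I^*(R,\omega,Q,\boldsymbol{\lambda},\boldsymbol{\mu})$ of the parameters of $R$ and of the data of $\gamma$ (i.e. a function of the data of a product $R(s)\gamma(s)$) is a rational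 extension of $I$ if $I^*(R,\omega,Q,\boldsymbol{\lambda},\boldsymbol{\mu})=I(\omega,Q,\boldsymbol{\lambda},\boldsymbol{\mu})$ for every constant rational function $R$. Applying the multiplication formula transforms $R(s)\gamma(s)$ into $R(s)c\gamma'(s)$ with $c\in\mathbb{C}\setminus\{0\}$ and $\gamma'$ a $\gamma$-factor with data $Q',\boldsymbol{\lambda}',\boldsymbol{\mu}'$; applying the factorial formula transforms it into $R'(s)\gamma'(s)$ with $R'\not\equiv 0$ rational and $\gamma'$ a $\gamma$-factor with data $Q',\boldsymbol{\lambda}',\boldsymbol{\mu}'$. $I^*$ is stable under the multiplication and factorial formulae if, respectively, $I^*(R,\omega,Q,\boldsymbol{\lambda},\boldsymbol{\mu})=I^*(R,\omega\overline{c}/c,Q',\boldsymbol{\lambda}',\boldsymbol{\mu}')$ and $I^*(R,\omega,Q,\boldsymbol{\lambda},\boldsymbol{\mu})=I^*(R',\omega,Q',\boldsymbol{\lambda}',\boldsymbol{\mu}')$. *)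

(* Defs.v *)
From HB Require Import structures.
From mathcomp Require Import all_boot all_order all_algebra.
From mathcomp Require Import all_classical all_reals all_analysis.
From mathcomp Require Import complex fraction.

Set Implicit Arguments.
Unset Strict Implicit.
Unset Printing Implicit Defensive.

Import numFieldNormedType.Exports.
Import Order.TTheory GRing.Theory Num.Theory.
Local Open Scope ring_scope.
Local Open Scope classical_set_scope.

(* R : realType is the real line
   and R[i] the complex plane.  R[i]^o is R[i] viewed as a normed space over
   itself; this is where its topology lives, and [derivable f s 1] for
   f : R[i]^o -> R[i]^o is complex differentiability at s. *)

(* The library's norm on R[i] is R[i]-valued. *)
Definition cabs (R : realType) (z : R[i]) : R := complex.Re `|z|.

(* x ^ s = exp (s log x) for real x > 0, with the real logarithm. *)
Definition cpow (R : realType) (x : R) (s : R[i]) : R[i] :=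
  (x `^ complex.Re s)%:C%C *
    (cos (complex.Im s * ln x) +i* sin (complex.Im s * ln x))%C.

(* Gauss's formula
     Gamma(s) = lim_n n! n^s / (s (s + 1) ... (s + n)),
   valid for every s outside the poles 0, -1, -2, ...; at a pole the value is
   irrelevant and is never used below. *)
Definition Gamma (R : realType) (s : R[i]) : R[i] :=
  limn (fun n : nat =>
    (n`!%:R * cpow n%:R s / \prod_(k < n.+1) (s + k%:R)) : R[i]^o).

(* Data of a gamma-factor Q^s \prod_j Gamma(lambda_j s + mu_j): the number Q and
   the list of the pairs (lambda_j, mu_j).  The list may be empty (r = 0). *)
Record gamma_data (R : realType) := GammaData {
  gamma_Q : R;
  factors : seq (R * R[i])
}.

(* (omega, Q, lambda, mu) *)
Record fe_data (R : realType) := FeData {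
  root_number : R[i];
  gfactor : gamma_data R
}.

Definition gamma_data_ok (R : realType) (g : gamma_data R) : Prop :=
  0 < gamma_Q g /\
  forall p, p \in factors g -> 0 < p.1 /\ 0 <= complex.Re p.2.

Definition fe_data_ok (R : realType) (d : fe_data R) : Prop :=
  cabs (root_number d) = 1 /\ gamma_data_ok (gfactor d).

Definition gamma_fun (R : realType) (g : gamma_data R) (s : R[i]) : R[i] :=
  cpow (gamma_Q g) s *
    \prod_(p <- factors g) Gamma (p.1%:C%C * s + p.2).

Definition gamma_pole (R : realType) (g : gamma_data R) (s : R[i]) : Prop :=
  exists2 p, p \in factors g & exists k : nat, p.1%:C%C * s + p.2 = - k%:R.

Definition fbar (R : realType) (f : R[i] -> R[i]) (s : R[i]) : R[i] :=
  (f s^*)^*.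

(* gamma(s) F(s) = omega gammabar(1-s) Fbar(1-s).  This is an identity between
   meromorphic functions; it is imposed off the discrete set consisting of 0, 1
   (where Fbar(1-s), F(s) may have a pole) and of the poles of gamma(s) and of
   gammabar(1-s). *)
Definition satisfies_fe (R : realType) (F : R[i] -> R[i]) (d : fe_data R)
    : Prop :=
  fe_data_ok d /\
  forall s : R[i], s != 0 -> s != 1 ->
    ~ gamma_pole (gfactor d) s -> ~ gamma_pole (gfactor d) (1 - s)^* ->
    gamma_fun (gfactor d) s * F s =
      root_number d * fbar (gamma_fun (gfactor d)) (1 - s) * fbar F (1 - s).

(* F(s) = \sum_(n >= 1) a(n) n^-s, absolutely convergent for Re s > 1; [a n] is
   the coefficient a(n + 1). *)
Definition dirichlet_series (R : realType) (F : R[i] -> R[i]) : Prop :=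
  exists a : nat -> R[i], forall s : R[i], 1 < complex.Re s ->
    let u := fun n : nat => (a n * cpow n.+1%:R (- s)) : R[i]^o in
    cvgn (series (fun n => cabs (u n) : R)) /\ (series u @ \oo --> (F s : R[i]^o)).

Definition entire (R : realType) (G : R[i] -> R[i]) : Prop :=
  forall s : R[i], derivable (G : R[i]^o -> R[i]^o) s 1.

Definition finite_order (R : realType) (G : R[i] -> R[i]) : Prop :=
  exists rho r0 : R, forall s : R[i], r0 <= cabs s ->
    cabs (G s) <= expR (cabs s `^ rho).

(* (s - 1)^m F(s) is entire of finite order for some m.  F is a function on all
   of R[i], but its value at the possible pole 1 is unconstrained and unused. *)
Definition continuation (R : realType) (F : R[i] -> R[i]) : Prop :=
  exists (m : nat) (G : R[i] -> R[i]),
    [/\ entire G, finite_order G &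
        forall s : R[i], s != 1 -> (s - 1) ^+ m * F s = G s].

(* The extended Selberg class: not identically vanishing functions given by an
   absolutely convergent Dirichlet series in Re s > 1, with a continuation and a
   functional equation as above. *)
Definition extended_selberg (R : realType) (F : R[i] -> R[i]) : Prop :=
  [/\ exists2 s, s != 1 & F s != 0,
      dirichlet_series F,
      continuation F &
      exists d, satisfies_fe F d].

(* Data of the functional equations of the elements of the class: the domain of
   the functions I(omega, Q, lambda, mu). *)
Definition selberg_data (R : realType) : Type :=
  {d : fe_data R | exists2 F, extended_selberg F & satisfies_fe F d}.

Definition is_invariant (R : realType) (I : selberg_data R -> R[i]) : Prop :=
  forall (F : R[i] -> R[i]) (d1 d2 : selberg_data R),
    extended_selberg F ->
    satisfies_fe F (sval d1) -> satisfies_fe F (sval d2) -> I d1 = I d2.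

Definition ratfun (R : realType) := {fraction {poly R[i]}}.

Definition rational_extension (R : realType) (I : selberg_data R -> R[i])
    (Istar : ratfun R -> fe_data R -> R[i]) : Prop :=
  forall (a : R[i]) (d : selberg_data R),
    a != 0 -> Istar (tofrac a%:P) (sval d) = I d.

(* [mult_formula g c g'] : one application of the multiplication formula, to one
   factor of g, rewrites gamma_g as c gamma_g'.  With z = lambda s + mu,
     Gamma(z) = m^(lambda s) m^(mu - 1/2) (2 pi)^((1 - m)/2)
                  \prod_(k < m) Gamma((lambda/m) s + (mu + k)/m).
   The factors of a product being unordered, the lists of pairs are considered
   up to permutation. *)
Definition mult_formula (R : realType) (g : gamma_data R) (c : R[i])
    (g' : gamma_data R) : Prop :=
  exists (m : nat) (lam : R) (mu : R[i]) (rest : seq (R * R[i])),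
    [/\ (0 < m)%N,
        perm_eq (factors g) ((lam, mu) :: rest),
        perm_eq (factors g')
          ([seq (lam / m%:R, (mu + k%:R) / m%:R) | k <- iota 0 m] ++ rest),
        gamma_Q g' = gamma_Q g * m%:R `^ lam &
        c = cpow m%:R (mu - 2^-1) *
              ((2 * pi) `^ ((1 - m%:R) / 2))%:C%C].

(* [fact_formula Rf g Rf' g'] : one application of the factorial formula
     Gamma(lambda s + mu) = (lambda s + mu)^-1 Gamma(lambda s + mu + 1)
   to one factor of g rewrites Rf gamma_g as Rf' gamma_g'. *)
Definition fact_formula (R : realType) (Rf : ratfun R) (g : gamma_data R)
    (Rf' : ratfun R) (g' : gamma_data R) : Prop :=
  exists (lam : R) (mu : R[i]) (rest : seq (R * R[i])),
    [/\ perm_eq (factors g) ((lam, mu) :: rest),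
        perm_eq (factors g') ((lam, mu + 1) :: rest),
        gamma_Q g' = gamma_Q g &
        Rf' = Rf / tofrac (lam%:C%C *: 'X + mu%:P)].

(* Stability is an equality between values of Istar, so it covers the formulae
   read from right to left as well. *)
Definition mult_stable (R : realType)
    (Istar : ratfun R -> fe_data R -> R[i]) : Prop :=
  forall (Rf : ratfun R) (omega c : R[i]) (g g' : gamma_data R),
    Rf != 0 -> fe_data_ok (FeData omega g) -> mult_formula g c g' ->
    Istar Rf (FeData omega g) = Istar Rf (FeData (omega * c^* / c) g').

Definition fact_stable (R : realType)
    (Istar : ratfun R -> fe_data R -> R[i]) : Prop :=
  forall (Rf Rf' : ratfun R) (omega : R[i]) (g g' : gamma_data R),
    Rf != 0 -> fe_data_ok (FeData omega g) -> fact_formula Rf g Rf' g' ->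
    Istar Rf (FeData omega g) = Istar Rf' (FeData omega g').

(* Main.v *)
(* Write E = 1/gamma, which is defined everywhere and vanishes exactly at the poles of
   gamma.

   If I is an invariant, give I*(R, d) the value I(d0) whenever (R, d) is obtained from
   some (a, d0), a a nonzero constant, by the two formulae read in both directions.  Along
   such a chain R gamma changes by a constant factor c and the root number by conj c / c,
   while the leading coefficient of R is only multiplied or divided by real numbers
   lambda; hence two data d0, d1 connected in this way are satisfied by the same functions
   F.  The constant of the multiplication formula matters only up to a positive factor.

   Conversely let d1, d2 be data of functional equations of F.  The first nonzero
   coefficient of its Dirichlet series shows that F has no zeros far to the right (some
   coefficient is nonzero by unique continuation), so comparing the two equations gives
   E2(s) / E1(s) = (w1 / w2) conj (E2(1 - conj s) / E1(1 - conj s)) there.  Thus E1 and E2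
   have the same zeros, with multiplicities, far to the left.  By the multiplication
   formula one may assume that any two lambdas are equal or incommensurable; then the
   progressions of poles can be paired off, and the factorial formula, used to increase
   the mu's, makes the paired factors equal.  What is left is an identity
   const q^(2s) P1*(s) P2(s) = const P2*(s) P1(s), with Pj the products of the linear
   forms lambda s + mu that were used, and P*(s) = conj (P(1 - conj s)).  It forces
   q = 1; since the zeros of Pj and of Pj* are separated, P1 = C P2, with C > 0 because the
   leading coefficients are positive.  Hence the root numbers agree after the
   transformations, and stability of I* yields I(d1) = I*(C, d1) = I*(1, d2) = I(d2). *)

Require Import Defs.
From HB Require Import structures.
From mathcomp Require Import all_boot all_order all_algebra.
From mathcomp Require Import all_classical all_reals all_analysis.
From mathcomp Require Import complex fraction.
From mathcomp Require Import ring lra.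

Set Implicit Arguments.
Unset Strict Implicit.
Unset Printing Implicit Defensive.

Import numFieldNormedType.Exports.
Import Order.TTheory GRing.Theory Num.Theory.
Local Open Scope ring_scope.
Local Open Scope classical_set_scope.

(** Of the Gamma function only algebra and continuity are used. The order of a zero of E is read off
    the recurrence, which splits off the linear factor explicitly; and as the reflection s -> 1 -
    conj s is antiholomorphic, orders are compared through moduli near a point. Complex
    differentiability enters only in unique continuation: by Goursat's theorem on rectangles, with
    the kernel (1 + z^2)^N, a half-plane of zeros of an entire function can be pushed to the left by
    1/4, again and again.

    No growth estimate is needed for q^(2s). On a vertical line it is constant along an arithmetic
    progression with infinitely many usable points, which turns the identity into one between
    polynomials; two such lines force q = 1.

    The value of I* is chosen from a set that depends only on what (R, d) is linked to, so stability
    reduces to equality of sets, and the choice has to be shown harmless for constant R only. *)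

Notation cRe := complex.Re.
Notation cIm := complex.Im.

(** * Complex numbers, limits and the exponential *)

Section ComplexBasics.
Variable R : realType.
Local Notation C := R[i].
Implicit Types (z w s : C) (x y r : R).

Lemma cabsE z : `|z| = (cabs z)%:C%C.
Proof. by []. Qed.

Lemma cabs0 : cabs (0 : C) = 0. Proof. exact: ComplexField.Normc.normc0. Qed.
Lemma cabs1 : cabs (1 : C) = 1. Proof. exact: ComplexField.Normc.normc1. Qed.
Lemma cabsM z w : cabs (z * w) = cabs z * cabs w.
Proof. exact: ComplexField.Normc.normcM. Qed.
Lemma cabsV z : cabs z^-1 = (cabs z)^-1.
Proof. exact: ComplexField.Normc.normcV. Qed.
Lemma cabsN z : cabs (- z) = cabs z.
Proof. by rewrite /cabs normrN. Qed.
Lemma cabsBC z w : cabs (z - w) = cabs (w - z).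
Proof. by rewrite -cabsN opprB. Qed.
Lemma cabsD z w : cabs (z + w) <= cabs z + cabs w.
Proof. exact: le_normcD. Qed.
Lemma cabsB z w : cabs (z - w) <= cabs z + cabs w.
Proof. by rewrite -(cabsN w) cabsD. Qed.
Lemma cabs_ge0 z : 0 <= cabs z.
Proof. by case: z => a b; rewrite /cabs /= sqrtr_ge0. Qed.
Lemma cabs_eq0 z : (cabs z == 0) = (z == 0).
Proof.
by apply/eqP/eqP => [|->]; [exact: ComplexField.Normc.eq0_normc|exact: cabs0].
Qed.
Lemma cabs_gt0 z : (0 < cabs z) = (z != 0).
Proof. by rewrite lt0r cabs_ge0 andbT cabs_eq0. Qed.
Lemma cabsX z n : cabs (z ^+ n) = cabs z ^+ n.
Proof. by elim: n => [|n IH]; rewrite ?cabs1 // !exprS cabsM IH. Qed.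
Lemma cabs_real r : cabs (r%:C%C : C) = `|r|.
Proof. by rewrite /cabs /= expr0n /= addr0 sqrtr_sqr. Qed.
Lemma cabs_nat n : cabs (n%:R : C) = n%:R.
Proof. by rewrite -(rmorph_nat (real_complex R)) cabs_real normr_nat. Qed.
Lemma cabs_conj z : cabs z^* = cabs z.
Proof. by rewrite /cabs norm_conjC. Qed.

Lemma cReD z w : cRe (z + w) = cRe z + cRe w. Proof. by case: z; case: w. Qed.
Lemma cImD z w : cIm (z + w) = cIm z + cIm w. Proof. by case: z; case: w. Qed.
Lemma cReN z : cRe (- z) = - cRe z. Proof. by case: z. Qed.
Lemma cImN z : cIm (- z) = - cIm z. Proof. by case: z. Qed.
Lemma cReB z w : cRe (z - w) = cRe z - cRe w. Proof. by rewrite cReD cReN. Qed.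
Lemma cImB z w : cIm (z - w) = cIm z - cIm w. Proof. by rewrite cImD cImN. Qed.
Lemma cReM z w : cRe (z * w) = cRe z * cRe w - cIm z * cIm w.
Proof. by case: z; case: w. Qed.
Lemma cImM z w : cIm (z * w) = cRe z * cIm w + cIm z * cRe w.
Proof. by case: z; case: w. Qed.
Lemma cRe_conj z : cRe z^* = cRe z. Proof. by case: z. Qed.
Lemma cIm_conj z : cIm z^* = - cIm z. Proof. by case: z. Qed.
Lemma cRe_nat n : cRe (n%:R : C) = n%:R.
Proof. by rewrite -(rmorph_nat (real_complex R)). Qed.
Lemma cIm_nat n : cIm (n%:R : C) = 0.
Proof. by rewrite -(rmorph_nat (real_complex R)). Qed.
Lemma cReMr r z : cRe (r%:C%C * z) = r * cRe z.
Proof. by case: z => a b /=; rewrite mul0r subr0. Qed.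
Lemma cImMr r z : cIm (r%:C%C * z) = r * cIm z.
Proof. by case: z => a b /=; rewrite mul0r addr0. Qed.
Lemma cplx_ext z w : cRe z = cRe w -> cIm z = cIm w -> z = w.
Proof. by case: z; case: w => a b c d /= -> ->. Qed.
Lemma conj_real r : (r%:C%C : C)^* = r%:C%C.
Proof. exact: conjc_real. Qed.

Lemma Re_le_cabs z : `|cRe z| <= cabs z.
Proof.
case: z => a b; rewrite /cabs /= -sqrtr_sqr ler_wsqrtr //.
by rewrite lerDl sqr_ge0.
Qed.
Lemma Im_le_cabs z : `|cIm z| <= cabs z.
Proof.
case: z => a b; rewrite /cabs /= -sqrtr_sqr ler_wsqrtr //.
by rewrite lerDr sqr_ge0.
Qed.
Lemma cabs_le_ReIm z : cabs z <= `|cRe z| + `|cIm z|.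
Proof.
have -> : z = (cRe z)%:C%C + 'i%C * (cIm z)%:C%C by rewrite -complexE.
apply: le_trans (cabsD _ _) _; rewrite cabsM !cabs_real.
have -> : cabs ('i%C : C) = 1 by rewrite /cabs /= expr0n expr1n add0r sqrtr1.
by rewrite mul1r !(cReD, cImD, cReM, cImM) /= !(mul0r, mul1r, mulr0, addr0, add0r, subr0).
Qed.

Local Notation Co := (R[i]^o).

(** Radii of balls are positive elements of [R[i]], hence real, so real epsilons suffice. *)
Lemma cvgcP (u : nat -> C) (l : C) :
  ((u : nat -> Co) @ \oo --> (l : Co)) <->
  forall e, 0 < e -> exists N, forall n, (N <= n)%N -> cabs (u n - l) < e.
Proof.
split=> [/cvgrPdist_lt h e e0|h].
  have /h [N _ hN] : 0 < (e%:C%C : C) by rewrite ltcR.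
  by exists N => n /hN; rewrite /= cabsE ltcR cabsBC.
apply/cvgrPdist_lt => e; rewrite ltcE /= => /andP [/eqP e1 e0].
have [N hN] := h _ e0.
exists N => // n /= Nn; rewrite cabsE ltcE /= e1 eqxx /= cabsBC; exact: hN.
Qed.

Lemma cvgc_unique (u : nat -> C) l l' :
  ((u : nat -> Co) @ \oo --> (l : Co)) -> ((u : nat -> Co) @ \oo --> (l' : Co)) ->
  l = l'.
Proof. by move=> h1 h2; rewrite -(cvg_lim _ h1) // -(cvg_lim _ h2). Qed.

Definition contc (f : C -> C) s := {for s, continuous (f : Co -> Co)}.

Lemma contcP (f : C -> C) s : contc f s <->
  forall e, 0 < e -> exists2 d, 0 < d & forall w, cabs (w - s) < d ->
    cabs (f w - f s) < e.
Proof.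
split=> [h e e0|h].
  have {}h := (@cvgrPdist_lt _ _ _ (nbhs (s : Co)) _ (f : Co -> Co) (f s : Co)).1 h.
  have /h /nbhs_ballP [d] : 0 < (e%:C%C : C) by rewrite ltcR.
  rewrite /= ltcE /= => /andP [/eqP d1 d0] hN.
  exists (cRe d) => // w wd; have := hN w; rewrite /= cabsE ltcR cabsBC; apply.
  by rewrite /ball /= cabsE ltcE /= d1 eqxx cabsBC.
apply: (@cvgrPdist_lt _ _ _ (nbhs (s : Co)) _ (f : Co -> Co) (f s : Co)).2 => e.
rewrite ltcE /= => /andP [/eqP e1 e0].
have [d d0 hd] := h _ e0.
apply/(@nbhs_ballP _ Co (s : Co)); exists (d%:C%C) => /=; first by rewrite ltcR.
move=> w; rewrite /ball /= cabsE ltcR cabsBC => /hd.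
by rewrite cabsE ltcE /= e1 eqxx /= cabsBC.
Qed.

Lemma contc_cst c s : contc (fun=> c) s.
Proof. exact: (@cst_continuous Co Co c s). Qed.
Lemma contc_id s : contc id s.
Proof. by apply/contcP => e e0; exists e. Qed.
Lemma contcD f g s : contc f s -> contc g s -> contc (fun z => f z + g z) s.
Proof. by move=> hf hg; exact: (@continuousD Co Co Co f g s hf hg). Qed.
Lemma contcN f s : contc f s -> contc (fun z => - f z) s.
Proof. by move=> hf; exact: (@continuousN Co Co Co f s hf). Qed.
Lemma contcM f g s : contc f s -> contc g s -> contc (fun z => f z * g z) s.
Proof. by move=> hf hg; exact: (@continuousM Co Co f g s hf hg). Qed.
Lemma contcV f s : f s != 0 -> contc f s -> contc (fun z => (f z)^-1) s.
Proof. by move=> f0 hf; exact: (@continuousV Co Co f s f0 hf). Qed.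
Lemma contc_comp f g s : contc g s -> contc f (g s) -> contc (fun z => f (g z)) s.
Proof. by move=> hf hg; apply: (@continuous_comp Co Co Co g f s hf hg). Qed.
Lemma contc_prod (I : Type) (l : seq I) (F : I -> C -> C) s :
  (forall i, contc (F i) s) -> contc (fun z => \prod_(i <- l) F i z) s.
Proof.
move=> h; elim: l => [|i l IH].
  rewrite (_ : (fun z => _) = fun=> 1); first exact: contc_cst.
  by apply/funext => z; rewrite big_nil.
rewrite (_ : (fun z => _) = fun z => F i z * \prod_(i <- l) F i z).
  exact: (contcM (h i) IH).
by apply/funext => z; rewrite big_cons.
Qed.
Lemma contc_poly (p : {poly C}) s : contc (fun z => p.[z]) s.
Proof.
elim/poly_ind: p => [|p c IH].
  rewrite (_ : (fun z => _) = fun=> 0); first exact: contc_cst.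
  by apply/funext => z; rewrite horner0.
rewrite (_ : (fun z => _) = fun z => p.[z] * z + c); last first.
  by apply/funext => z; rewrite hornerMXaddC.
exact: (contcD (contcM IH (@contc_id s)) (@contc_cst c s)).
Qed.

Lemma contc_eq0 f s : contc f s ->
  (forall d, 0 < d -> exists2 w, cabs (w - s) < d & f w = 0) -> f s = 0.
Proof.
move=> /contcP hf h; apply/eqP; rewrite -cabs_eq0; apply/contraT => f0.
have fp : 0 < cabs (f s) by rewrite lt0r f0 cabs_ge0.
have [d d0 hd] := hf _ fp; have [w /hd + fw] := h _ d0.
by rewrite fw sub0r cabsN ltxx.
Qed.

Lemma contc_nz f s : contc f s -> f s != 0 ->
  exists2 d, 0 < d & forall w, cabs (w - s) < d -> f w != 0.
Proof.
move=> /contcP hf f0; have fp : 0 < cabs (f s) by rewrite cabs_gt0.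
have [d d0 hd] := hf _ fp; exists d => // w /hd h.
by apply: contraTN h => /eqP ->; rewrite sub0r cabsN ltxx.
Qed.

Definition cexp z : C := (expR (cRe z))%:C%C * (cos (cIm z) +i* sin (cIm z))%C.

Lemma cexp0 : cexp 0 = 1.
Proof. by rewrite /cexp /= expR0 cos0 sin0 mul1r. Qed.

Lemma cexpD z w : cexp (z + w) = cexp z * cexp w.
Proof.
rewrite /cexp cReD cImD expRD cosD sinD; apply: cplx_ext;
  rewrite !(cReM, cImM) /=; ring.
Qed.

Lemma cabs_cexp z : cabs (cexp z) = expR (cRe z).
Proof.
rewrite /cexp cabsM cabs_real ger0_norm ?expR_ge0 // /cabs /=.
by rewrite cos2Dsin2 sqrtr1 mulr1.
Qed.

Lemma cexp_neq0 z : cexp z != 0.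
Proof. by rewrite -cabs_gt0 cabs_cexp expR_gt0. Qed.

Lemma cexpN z : cexp (- z) = (cexp z)^-1.
Proof.
by apply: (mulfI (cexp_neq0 z)); rewrite mulfV ?cexp_neq0 // -cexpD subrr cexp0.
Qed.

Lemma conj_cexp z : (cexp z)^* = cexp z^*.
Proof.
rewrite /cexp rmorphM /= conj_real cRe_conj cIm_conj cosN sinN; congr (_ * _).
Qed.

Lemma cexp_real r : cexp r%:C%C = (expR r)%:C%C.
Proof. by rewrite /cexp /= cos0 sin0 mulr1. Qed.

Lemma cpowE x s : 0 < x -> cpow x s = cexp (s * (ln x)%:C%C).
Proof.
move=> x0; rewrite /cpow /cexp /powR gt_eqF // cReM cImM /=.
by rewrite !mulr0 subr0 add0r mulrC [cIm s * _]mulrC.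
Qed.

Lemma cpow_neq0 x s : 0 < x -> cpow x s != 0.
Proof. by move=> x0; rewrite cpowE // cexp_neq0. Qed.
Lemma cpowD x s w : 0 < x -> cpow x (s + w) = cpow x s * cpow x w.
Proof. by move=> x0; rewrite !cpowE // mulrDl cexpD. Qed.
Lemma cpowN x s : 0 < x -> cpow x (- s) = (cpow x s)^-1.
Proof. by move=> x0; rewrite !cpowE // mulNr cexpN. Qed.
Lemma cpowM x y s : 0 < x -> 0 < y -> cpow (x * y) s = cpow x s * cpow y s.
Proof. by move=> x0 y0; rewrite !cpowE ?mulr_gt0 // lnM // rmorphD mulrDr cexpD. Qed.
Lemma cpow_powR x r s : 0 < x -> cpow (x `^ r) s = cpow x (r%:C%C * s).
Proof.
move=> x0; rewrite !cpowE ?powR_gt0 // ln_powR rmorphM /= mulrCA mulrA.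
by [].
Qed.
Lemma cpow1 s : cpow 1 s = 1.
Proof. by rewrite cpowE // ln1 mulr0 cexp0. Qed.
Lemma cpow_real x r : 0 < x -> cpow x r%:C%C = (x `^ r)%:C%C.
Proof. by move=> x0; rewrite cpowE // -rmorphM cexp_real /powR gt_eqF. Qed.
Lemma cpow0 x : 0 < x -> cpow x 0 = 1.
Proof. by move=> x0; rewrite cpowE // mul0r cexp0. Qed.
Lemma conj_cpow x s : 0 < x -> (cpow x s)^* = cpow x s^*.
Proof. by move=> x0; rewrite !cpowE // conj_cexp rmorphM /= conj_real. Qed.
Lemma cabs_cpow x s : 0 < x -> cabs (cpow x s) = x `^ cRe s.
Proof.
by move=> x0; rewrite cpowE // cabs_cexp cReM /= mulr0 subr0 /powR gt_eqF.
Qed.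

End ComplexBasics.

(** * Limits of complex sequences and of infinite products *)

Section ComplexSequences.
Variable R : realType.
Local Notation C := R[i].
Local Notation Co := (R[i]^o).

Definition clim (u : nat -> C) (l : C) := (u : nat -> Co) @ \oo --> (l : Co).

Lemma climP (u : nat -> C) (l : C) : clim u l <->
  forall e, 0 < e -> exists N, forall n, (N <= n)%N -> cabs (u n - l) < e.
Proof. exact: cvgcP. Qed.
Lemma clim_unique u l l' : clim u l -> clim u l' -> l = l'.
Proof. exact: cvgc_unique. Qed.
Lemma clim_lim u l : clim u l -> limn (u : nat -> Co) = l.
Proof. by move=> h; exact: (cvg_lim (@norm_hausdorff Co Co) h). Qed.
Lemma climM u v a b : clim u a -> clim v b -> clim (fun n => u n * v n) (a * b).
Proof. exact: (@cvgM Co _ _ _ u v). Qed.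
Lemma climD u v a b : clim u a -> clim v b -> clim (fun n => u n + v n) (a + b).
Proof. exact: (@cvgD Co Co _ _ _ u v). Qed.
Lemma climV u a : a != 0 -> clim u a -> clim (fun n => (u n)^-1) a^-1.
Proof. exact: (@cvgV Co _ _ _ u). Qed.
Lemma clim_cst a : clim (fun=> a) a.
Proof. exact: (@cvg_cst Co). Qed.
Lemma clim_near u v l : (exists N, forall n, (N <= n)%N -> u n = v n) ->
  clim u l -> clim v l.
Proof.
move=> [N uv] /climP h; apply/climP => e /h [M hM]; exists (maxn N M) => n.
by rewrite geq_max => /andP [/uv <- /hM].
Qed.
Lemma clim_prod (I : Type) (l : seq I) (u : I -> nat -> C) (a : I -> C) :
  (forall i, clim (u i) (a i)) ->
  clim (fun n => \prod_(i <- l) u i n) (\prod_(i <- l) a i).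
Proof.
move=> h; elim: l => [|i l IH].
  rewrite big_nil (_ : (fun n => _) = fun=> 1); first exact: clim_cst.
  by apply/funext => n; rewrite big_nil.
rewrite big_cons (_ : (fun n => _) = fun n => u i n * \prod_(i <- l) u i n).
  exact: (climM (h i) IH).
by apply/funext => n; rewrite big_cons.
Qed.
Lemma clim_subseq u l (k : nat -> nat) : (forall n, (n <= k n)%N) ->
  clim u l -> clim (fun n => u (k n)) l.
Proof.
move=> kn /climP h; apply/climP => e /h [N hN]; exists N => n Nn; apply: hN.
exact: leq_trans Nn (kn n).
Qed.
Lemma clim_le u l N (b : R) :
  (forall n, (N <= n)%N -> cabs (u n) <= b) -> clim u l -> cabs l <= b.
Proof.
move=> ub /climP h; apply/ler_addgt0Pl => e /h [M hM].
have /hM h1 := leq_maxr N M; have /ub h2 := leq_maxl N M.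
have -> : l = u (maxn N M) - (u (maxn N M) - l) by ring.
by apply: le_trans (cabsB _ _) _; rewrite addrC lerD // ltW.
Qed.

Lemma real_cauchy (u : nat -> R) :
  (forall e, 0 < e -> exists N, forall n, (N <= n)%N -> `|u n - u N| < e) ->
  exists l, forall e, 0 < e -> exists N, forall n, (N <= n)%N -> `|u n - l| < e.
Proof.
move=> h; have : cauchy_ex (u @ \oo).
  move=> e /h [N hN]; exists (u N); exists N => // n /= /hN.
  by rewrite /ball /= distrC.
move=> /cauchy_exP /R_complete h1; exists (lim (u @ \oo)) => e e0.
move/cvgrPdist_lt: h1 => /(_ _ e0) [N _ hN]; exists N => n /hN /=.
by rewrite distrC.
Qed.

Lemma ccauchy_cvg (u : nat -> C) :
  (forall e, 0 < e -> exists N, forall n, (N <= n)%N -> cabs (u n - u N) < e) ->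
  exists l, clim u l.
Proof.
move=> h; have [|x hx] := @real_cauchy (fun n => cRe (u n)).
  move=> e /h [N hN]; exists N => n /hN; rewrite -cReB.
  exact: le_lt_trans (Re_le_cabs _).
have [|y hy] := @real_cauchy (fun n => cIm (u n)).
  move=> e /h [N hN]; exists N => n /hN; rewrite -cImB.
  exact: le_lt_trans (Im_le_cabs _).
exists (x +i* y)%C; apply/climP => e e0.
have e2 : 0 < e / 2 by rewrite divr_gt0.
have [N hN] := hx _ e2; have [M hM] := hy _ e2.
exists (maxn N M) => n; rewrite geq_max => /andP [/hN h1 /hM h2].
by apply: le_lt_trans (cabs_le_ReIm _) _; rewrite cReB cImB /= (splitr e) ltrD.
Qed.

(* [u n] stands for the partial products of an infinite product whose factors are
   [1 + O(1/n^2)]. *)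
Lemma quadratic_product_close (u : nat -> C) (K : R) N : (0 < N)%N -> 0 <= K ->
  4 * K <= N%:R ->
  (forall n, (N <= n)%N -> cabs (u n.+1 - u n) <= cabs (u n) * (K / n%:R ^+ 2)) ->
  forall n, (N <= n)%N -> cabs (u n - u N) <= cabs (u N) * (4 * K / N%:R).
Proof.
move=> N0 K0 KN hu.
have NR : 0 < N%:R :> R by rewrite ltr0n.
(* The bound telescopes because 1/n^2 <= 2 (1/n - 1/(n+1)). The condition 4K <= N keeps [u n] below
   twice [u N] in modulus, which closes the induction. *)
suff h n : (N <= n)%N ->
    cabs (u n - u N) <= cabs (u N) * (4 * K * (N%:R^-1 - n%:R^-1)).
  move=> n /h /le_trans; apply; apply: ler_wpM2l; first exact: cabs_ge0.
  by apply: ler_wpM2l; [lra|rewrite gerBl invr_ge0].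
elim: n => [|n IH]; first by rewrite leqNgt N0.
rewrite leq_eqVlt => /orP [/eqP <-|].
  by rewrite !subrr cabs0 !mulr0.
rewrite ltnS => Nn; have {}IH := IH Nn.
have n0 : 0 < n%:R :> R by rewrite ltr0n (leq_trans N0).
have nN : N%:R <= n%:R :> R by rewrite ler_nat.
have -> : u n.+1 - u N = (u n - u N) + (u n.+1 - u n) by ring.
apply: le_trans (cabsD _ _) _.
have S1 : 4 * K * (N%:R^-1 - n%:R^-1) <= 1.
  have h : 4 * K * (N%:R^-1 - n%:R^-1) <= N%:R * (N%:R^-1 - n%:R^-1).
    by apply: ler_wpM2r => //; rewrite subr_ge0 lef_pV2.
  apply: le_trans h _; rewrite mulrBr mulfV ?gt_eqF // gerBl.
have un : cabs (u n) <= 2 * cabs (u N).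
  have -> : u n = u N + (u n - u N) by ring.
  apply: le_trans (cabsD _ _) _.
  have : cabs (u n - u N) <= cabs (u N) * 1.
    by apply: le_trans IH _; rewrite ler_wpM2l // cabs_ge0.
  by rewrite mulr1; lra.
have h2 := hu _ Nn.
have nS : n.+1%:R = 1 + n%:R :> R by rewrite nat1r.
have n1 : 0 < 1 + n%:R :> R by rewrite -nS.
have h3 : cabs (u n) * (K / n%:R ^+ 2) <=
          2 * cabs (u N) * (2 * K * (n%:R^-1 - n.+1%:R^-1)).
  apply: ler_pM => //; rewrite ?cabs_ge0 ?divr_ge0 ?sqr_ge0 //.
  rewrite -subr_ge0 nS [X in 0 <= X](_ : _ =
     K * (n%:R - 1) / (n%:R ^+ 2 * (1 + n%:R))); last first.
    by field; rewrite !gt_eqF.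
  rewrite !mulr_ge0 ?invr_ge0 ?mulr_ge0 ?sqr_ge0 ?subr_ge0 ?ler1n // ?ltW //.
  exact: leq_trans N0 Nn.
apply: le_trans (lerD IH (le_trans h2 h3)) _.
rewrite nS -subr_ge0 [X in 0 <= X](_ : _ = 0) //.
by field; rewrite !gt_eqF.
Qed.

End ComplexSequences.

(** * Explicit estimates for the complex exponential near 0 *)

Section ExpEstimates.
Variable R : realType.
Local Notation C := R[i].
Implicit Types (a b x : R).

Lemma mvt_bound (f df : R -> R) (a b M : R) : a <= b ->
  (forall x, a <= x <= b -> is_derive x 1 f (df x)) ->
  (forall x, a <= x <= b -> `|df x| <= M) -> `|f b - f a| <= M * (b - a).
Proof.
move=> ab fd fM.
have [||c cab ->] := @MVT_segment _ f df _ _ ab.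
- by move=> x xI; apply: fd; move: xI; rewrite in_itv /= => /andP [/ltW -> /ltW ->].
- apply: derivable_within_continuous => x; rewrite in_itv /= => h.
  exact: (@ex_derive _ _ _ _ _ _ _ (fd x h)).
- rewrite normrM [`|b - a|]ger0_norm ?subr_ge0 // ler_wpM2r ?subr_ge0 //.
  by apply: fM; move: cab; rewrite in_itv.
Qed.

Lemma abs_sin_le b : `|sin b| <= `|b|.
Proof.
wlog b0 : b / 0 <= b.
  move=> h; have [/h //|/ltW bn] := leP 0 b.
  by rewrite -normrN -sinN -[`|b|]normrN h // oppr_ge0.
have := @mvt_bound sin cos 0 b 1 b0 (fun x _ => is_derive_sin x).
by rewrite sin0 !subr0 mul1r (ger0_norm b0); apply => x _; exact: cos_max.
Qed.

Lemma abs_cos_sub1 b : `|cos b - 1| <= b ^+ 2.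
Proof.
wlog b0 : b / 0 <= b.
  move=> h; have [/h //|/ltW bn] := leP 0 b.
  by rewrite -cosN -sqrrN h // oppr_ge0.
have := @mvt_bound cos (fun x => - sin x) 0 b b b0 (fun x _ => is_derive_cos x).
rewrite cos0 subr0 expr2; apply => x /andP [x0 xb].
by rewrite normrN (le_trans (abs_sin_le x)) // ger0_norm.
Qed.

Lemma abs_sin_sub b : `|b| <= 1 -> `|sin b - b| <= b ^+ 2.
Proof.
wlog b0 : b / 0 <= b.
  move=> h; have [/h //|/ltW bn] := leP 0 b; move=> b1.
  have := h (- b); rewrite oppr_ge0 bn normrN b1 sqrrN sinN => /(_ isT isT).
  by rewrite -opprD normrN.
rewrite ger0_norm // => b1.
have d x : is_derive x 1 (fun x : R => sin x - x) (cos x - 1) by apply: is_deriveB.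
have := @mvt_bound _ _ 0 b b b0 (fun x _ => d x).
rewrite sin0 !subr0 expr2; apply => x /andP [x0 xb].
apply: le_trans (abs_cos_sub1 x) _; rewrite expr2.
by apply: le_trans (ler_wpM2r x0 xb) _; rewrite ler_piMr // (le_trans xb).
Qed.

Lemma abs_exp_sub a : `|a| <= 2^-1 -> `|expR a - 1 - a| <= 2 * a ^+ 2.
Proof.
rewrite ler_norml => /andP [al ar].
have h1 := expR_ge1Dx a; have h2 := expR_ge1Dx (- a).
rewrite ger0_norm; last lra.
have e0 := expR_gt0 a.
have : (1 - a) * expR a <= 1.
  by have := ler_wpM2l (ltW e0) h2; rewrite expRxMexpNx_1 mulrC.
move=> h3; have a1 : 0 < 1 - a by lra.
rewrite -(ler_pM2l a1); nra.
Qed.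

Lemma cexp_sub1_id (w : C) : cabs w <= 2^-1 ->
  cabs (cexp w - 1 - w) <= 7 * cabs w ^+ 2.
Proof.
case: w => a b w1; have ha := le_trans (Re_le_cabs _) w1; have hb := le_trans (Im_le_cabs _) w1.
have ha' := Re_le_cabs (a +i* b)%C; have hb' := Im_le_cabs (a +i* b)%C.
rewrite /= in ha hb ha' hb'.
have hb1 : `|b| <= 1 by apply: le_trans hb _; lra.
pose rho := expR a - 1 - a; pose sigma : C := ((cos b - 1) +i* (sin b - b))%C.
pose eib : C := (cos b +i* sin b)%C.
(* A mixed term, the remainder of e^a and the remainder of e^(ib). They contribute 1, 2 and 4 times
   |w|^2, whence the constant 7. *)
have -> : cexp (a +i* b)%C - 1 - (a +i* b)%C =
    (a * b)%:C%C * 'i%C + rho%:C%C * eib + (1 + a)%:C%C * sigma.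
  by apply: cplx_ext; rewrite /cexp /rho /sigma /eib /=; ring.
have E : cabs eib = 1 by rewrite /cabs /eib /= cos2Dsin2 sqrtr1.
have I : cabs ('i%C : C) = 1 by rewrite /cabs /= expr0n expr1n add0r sqrtr1.
have S : cabs sigma <= 2 * b ^+ 2.
  apply: le_trans (cabs_le_ReIm _) _; rewrite /=.
  by have := abs_cos_sub1 b; have := abs_sin_sub hb1; lra.
have Rh := abs_exp_sub ha.
apply: le_trans (cabsD _ _) _; apply: le_trans (lerD (cabsD _ _) (lexx _)) _.
rewrite !cabsM E I !cabs_real !mulr1 normrM.
set W := cabs _ in w1 ha' hb' *.
have W0 : 0 <= W by exact: cabs_ge0.
have A2 : a ^+ 2 <= W ^+ 2 by rewrite -real_normK ?num_real // lerXn2r ?nnegrE.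
have B2 : b ^+ 2 <= W ^+ 2 by rewrite -real_normK ?num_real // lerXn2r ?nnegrE.
have AB : `|a| * `|b| <= W ^+ 2 by rewrite expr2 ler_pM.
have A1 : `|1 + a| <= 2 by apply: le_trans (ler_normD _ _) _; rewrite normr1; lra.
have : `|1 + a| * cabs sigma <= 2 * (2 * b ^+ 2).
  by apply: ler_pM => //; exact: cabs_ge0.
rewrite -/rho in Rh; lra.
Qed.

Lemma cexp_sub1 (w : C) : cabs w <= 2^-1 -> cabs (cexp w - 1) <= 5 * cabs w.
Proof.
move=> w1; have -> : cexp w - 1 = (cexp w - 1 - w) + w by ring.
apply: le_trans (cabsD _ _) _; have := cexp_sub1_id w1.
have := cabs_ge0 w; nra.
Qed.

Lemma contc_cexp (s : C) : contc (@cexp R) s.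
Proof.
apply/contcP => e e0; set E := expR (cRe s).
have E0 : 0 < E by exact: expR_gt0.
exists (Num.min 2^-1 (e / (6 * E))); first by rewrite lt_min divr_gt0 ?mulr_gt0 // andbT; lra.
move=> w; rewrite lt_min => /andP [/ltW w1 w2].
have -> : cexp w - cexp s = cexp s * (cexp (w - s) - 1).
  by rewrite mulrBr -cexpD mulr1 [s + _]addrC subrK.
rewrite cabsM cabs_cexp -/E; have h := cexp_sub1 w1.
apply: le_lt_trans (ler_wpM2l (ltW E0) h) _.
move: w2; rewrite ltr_pdivlMr ?mulr_gt0 // => w2.
have := cabs_ge0 (w - s); nra.
Qed.

Lemma contc_cpow (x : R) (s : C) : 0 < x -> contc (cpow x) s.
Proof.
move=> x0; rewrite (_ : cpow x = fun s => cexp (s * (ln x)%:C%C)); last first.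
  by apply/funext => z; rewrite cpowE.
apply: contc_comp; last exact: contc_cexp.
by apply: contcM; [exact: contc_id|exact: contc_cst].
Qed.

End ExpEstimates.

(** * The reciprocal Gamma function *)

Section Gamma.
Variable R : realType.
Local Notation C := R[i].
Implicit Types (s z w : C).

(** Reciprocals of Gauss's approximants: for n > 0 the denominator never vanishes, so these are
    continuous everywhere, also at the poles of Gamma. *)
Definition rgauss s (n : nat) : C :=
  (\prod_(k < n.+1) (s + k%:R)) / (n`!%:R * cpow n%:R s).

(* At a pole, division by 0 makes the approximants of [Gamma] eventually 0; hence
   [Gamma] takes the value 0 there and [rGamma] is the entire function 1/Gamma. *)
Definition rGamma s : C := (Gamma s)^-1.

Lemma natr_neq0C (n : nat) : (0 < n)%N -> (n%:R : C) != 0.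
Proof. by move=> n0; rewrite pnatr_eq0 -lt0n. Qed.

Lemma fact_neq0C (n : nat) : (n`!%:R : C) != 0.
Proof. by rewrite natr_neq0C // fact_gt0. Qed.

Lemma realnat (n : nat) : ((n%:R : R)%:C%C : C) = n%:R.
Proof. exact: rmorph_nat. Qed.

Lemma rgaussS s n : (0 < n)%N -> rgauss s n.+1 =
  rgauss s n * ((1 + s * (n.+1%:R^-1)) *
    cexp (- (s * (ln n.+1%:R - ln n%:R : R)%:C%C))).
Proof.
move=> n0; have nR : 0 < n%:R :> R by rewrite ltr0n.
have nR1 : 0 < n.+1%:R :> R by rewrite ltr0n.
rewrite /rgauss big_ord_recr /= factS natrM rmorphB mulrBr opprB cexpD cexpN.
rewrite -!cpowE //.
have h1 := cpow_neq0 s nR; have h2 := cpow_neq0 s nR1.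
have h3 := fact_neq0C n; have h4 := natr_neq0C (ltn0Sn n).

by field; rewrite nat1r h1 h2 h3 h4.
Qed.

Lemma ln_step (n : nat) : (0 < n)%N ->
  (n.+1%:R^-1 : R) <= ln n.+1%:R - ln (n%:R : R) <= n%:R^-1.
Proof.
move=> n0; have nR : 0 < n%:R :> R by rewrite ltr0n.
have nR1 : 0 < n.+1%:R :> R by rewrite ltr0n.
have e1 : n.+1%:R / n%:R = 1 + n%:R^-1 :> R.
  by rewrite -nat1r; field; rewrite gt_eqF.
have e2 : n%:R / n.+1%:R = 1 + - n.+1%:R^-1 :> R.
  rewrite -nat1r; field; rewrite nat1r gt_eqF //.
apply/andP; split.
  rewrite -lerN2 opprB -ln_div ?posrE // e2; apply: le_ln1Dx.
  by rewrite ltrN2 invf_lt1 // ltr1n.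
by rewrite -ln_div ?posrE // e1; apply: le_ln1Dx; rewrite (lt_trans _ (_ : 0 < _)) // ?invr_gt0 // ltrN10.
Qed.

(** The consecutive quotient is (1 + s/(n+1)) exp(-s L) with L = ln(n+1) - ln n. Since L and 1/(n+1)
    differ by at most 1/n^2, the terms of first order cancel, uniformly for |s| <= B. *)
Lemma rgauss_step (B : R) : 0 <= B -> exists2 K : R, 0 <= K &
  forall s n, cabs s <= B -> (0 < n)%N -> 2 * B <= n%:R ->
   cabs (rgauss s n.+1 - rgauss s n) <= cabs (rgauss s n) * (K / n%:R ^+ 2).
Proof.
(* With x = 1/(n+1), the three summands bound s (x - L), s^2 x L and (1 + s x) times the quadratic
   remainder of the exponential. *)
move=> B0; exists (B + B ^+ 2 + 7 * (1 + B) * B ^+ 2).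
  by rewrite !addr_ge0 ?mulr_ge0 ?addr_ge0 ?exprn_ge0.
move=> s n sB n0 nB; rewrite rgaussS // -{2}(mulr1 (rgauss s n)) -mulrBr cabsM.
apply: ler_wpM2l; first exact: cabs_ge0.
have nR : 0 < n%:R :> R by rewrite ltr0n.
have nR1 : 0 < n.+1%:R :> R by rewrite ltr0n.
have /andP [L1 L2] := ln_step n0.
set L := ln _ - ln _ in L1 L2 *.
pose x : R := n.+1%:R^-1.
have x0 : 0 < x by rewrite invr_gt0.
have xn : x <= n%:R^-1 by rewrite lef_pV2 // ler_nat.
have xL : `|x - L| <= n%:R^-2.
  rewrite distrC ger0_norm ?subr_ge0 //.
  apply: (@le_trans _ _ (n%:R^-1 - x)); first by rewrite lerD2r.
  rewrite -subr_ge0 (_ : _ - _ = n%:R^-2 / n.+1%:R); last first.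
    by rewrite /x -nat1r; field; rewrite nat1r !gt_eqF.
  by rewrite mulr_ge0 // ?invr_ge0 ?exprn_ge0 // ltW.
have y0 : 0 < n%:R^-1 :> R by rewrite invr_gt0.
have L0 : 0 <= L by apply: le_trans L1; rewrite ltW.
clearbody L.
have y1 : n%:R^-1 <= 1 :> R by rewrite invf_le1 // ler1n.
pose w := - (s * L%:C%C).
have cw : cabs w <= B * n%:R^-1.
  by rewrite cabsN cabsM cabs_real ger0_norm // ler_pM // cabs_ge0.
have w1 : cabs w <= 2^-1.
  apply: le_trans cw _; rewrite ler_pdivrMr //; lra.
have rh := cexp_sub1_id w1.
set r := cexp w - 1 - w in rh.
have xE : (n.+1%:R^-1 : C) = x%:C%C by rewrite /x fmorphV /= realnat.
have -> : (1 + s * n.+1%:R^-1) * cexp w - 1 =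
   s * (x - L)%:C%C + (- (s ^+ 2 * (x * L)%:C%C)) + (1 + s * x%:C%C) * r.
  by rewrite xE /r /w rmorphB rmorphM /=; ring.
apply: le_trans (cabsD _ _) _; apply: le_trans (lerD (cabsD _ _) (lexx _)) _.
rewrite cabsN (cabsM (s ^+ 2)) cabsX !cabsM !cabs_real.
have s0 := cabs_ge0 s.
rewrite !mulrDl; apply: lerD; first apply: lerD.
- by apply: ler_pM.
- apply: ler_pM => //; first by rewrite exprn_ge0.
    by rewrite lerXn2r ?nnegrE.
  rewrite ger0_norm; last by rewrite mulr_ge0 // ltW.
  by rewrite -exprVn expr2; apply: ler_pM => //; rewrite ltW.
have h1 : cabs (1 + s * x%:C%C) <= 1 + B.
  apply: le_trans (cabsD _ _) _; rewrite cabs1 lerD2l cabsM cabs_real (ger0_norm (ltW x0)).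
  by rewrite -[B]mulr1; apply: ler_pM => //; [exact: ltW|exact: le_trans xn y1].
have h2 : cabs r <= 7 * (B ^+ 2 / n%:R ^+ 2).
  apply: le_trans rh _; rewrite ler_pM2l // -exprVn -exprMn lerXn2r ?nnegrE ?cabs_ge0 //.
  by rewrite mulr_ge0 // ltW.
apply: le_trans (ler_pM (cabs_ge0 _) (cabs_ge0 _) h1 h2) _.
by rewrite le_eqVlt; apply/orP; left; apply/eqP; ring.
Qed.

(** The error is relative and uniform on the disc: uniformity gives continuity of the limit, and a
    relative error of at most 1/2, ensured by [2 * K <= N0], keeps the limit away from 0. *)
Lemma rgauss_close (B : R) : 0 <= B -> exists2 K : R, 0 <= K & exists2 N0 : nat,
  (0 < N0)%N /\ 2 * K <= N0%:R & forall s N n, cabs s <= B -> (N0 <= N)%N -> (N <= n)%N ->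
  cabs (rgauss s n - rgauss s N) <= cabs (rgauss s N) * (K / N%:R).
Proof.
move=> B0; have [K K0 hK] := rgauss_step B0.
exists (4 * K); first by rewrite mulr_ge0.
pose N0 := (Num.bound (2 * (4 * K) + 2 * B)).+1.
have hN0 : 2 * (4 * K) + 2 * B <= N0%:R.
  apply: le_trans (ltW (archi_boundP _)) _; first by rewrite addr_ge0 ?mulr_ge0.
  by rewrite ler_nat.
exists N0; first by split=> //; apply: le_trans hN0; rewrite lerDl mulr_ge0.
move=> s N n sB NN Nn; have N0' : (0 < N)%N by apply: leq_trans NN.
have hN : 2 * (4 * K) + 2 * B <= N%:R by apply: le_trans hN0 _; rewrite ler_nat.
apply: quadratic_product_close => // [|k Nk]; first by nra.
apply: hK => //; first exact: leq_trans Nk.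
by apply: (@le_trans _ _ N%:R); [nra|rewrite ler_nat].
Qed.

Lemma rgauss_cvg s : exists l, clim (rgauss s) l.
Proof.
have [K K0 [N0 [N00 KN0] h]] := rgauss_close (cabs_ge0 s).
apply: ccauchy_cvg => e e0.
pose A := cabs (rgauss s N0).
have A0 : 0 <= A by exact: cabs_ge0.
pose N := (N0 + (Num.bound (2 * A * K / e)))%N.+1.
have NR : 0 < N%:R :> R by rewrite ltr0n.
exists N => n Nn.
have N0N : (N0 <= N)%N by rewrite /N -addnS leq_addr.
have NA : cabs (rgauss s N) <= 2 * A.
  have -> : rgauss s N = rgauss s N0 + (rgauss s N - rgauss s N0) by ring.
  apply: le_trans (cabsD _ _) _; rewrite mulr2n mulrDl mul1r lerD2l.
  apply: le_trans (h s N0 N (lexx _) (leqnn _) N0N) _.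
  rewrite -[A]mulr1 ler_wpM2l // ler_pdivrMr ?ltr0n // mul1r.
  by apply: le_trans KN0; rewrite ler_peMl // ler1n.
apply: le_lt_trans (h s N n (lexx _) N0N Nn) _.
apply: (@le_lt_trans _ _ (2 * A * K / N%:R)).
  by rewrite -[leRHS]mulrA; apply: ler_wpM2r NA; rewrite divr_ge0 // ltW.
rewrite ltr_pdivrMr // [ltRHS]mulrC -ltr_pdivrMr //.
apply: lt_le_trans (archi_boundP _) _; first by rewrite divr_ge0 ?mulr_ge0 // ltW.
by rewrite ler_nat /N -addSn leq_addl.
Qed.

Lemma prod_shift_eq0 s : (exists k : nat, s = - k%:R) ->
  exists N, forall n, (N <= n)%N -> \prod_(k < n.+1) (s + k%:R) = 0.
Proof.
move=> [k ->]; exists k => n kn; apply/eqP; rewrite prodf_seq_eq0.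
apply/hasP; exists (Ordinal (kn : (k < n.+1)%N)); first by rewrite mem_index_enum.
by rewrite /= addNr.
Qed.

Lemma prod_shift_neq0 s : ~ (exists k : nat, s = - k%:R) ->
  forall n, \prod_(k < n.+1) (s + k%:R) != 0.
Proof.
move=> h n; apply/prodf_neq0 => k _; rewrite addr_eq0; apply/eqP => e.
by apply: h; exists k.
Qed.

Lemma rgauss_neq0 s n : ~ (exists k : nat, s = - k%:R) -> (0 < n)%N ->
  rgauss s n != 0.
Proof.
move=> /prod_shift_neq0 h n0; apply: mulf_neq0; first exact: h.
by rewrite invr_neq0 // mulf_neq0 ?fact_neq0C // cpow_neq0 // ltr0n.
Qed.

(** The limit is within half the modulus of the nonzero approximant [rgauss s N0]. *)
Lemma rgauss_lim_neq0 s l : ~ (exists k : nat, s = - k%:R) ->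
  clim (rgauss s) l -> l != 0.
Proof.
move=> np hl; have [K K0 [N0 [N00 KN0] h]] := rgauss_close (cabs_ge0 s).
have g0 := rgauss_neq0 np N00.
have N0R : 0 < N0%:R :> R by rewrite ltr0n.
apply: contraTneq isT => l0.
have : clim (fun n => rgauss s n - rgauss s N0) (l - rgauss s N0).
  exact: (climD hl (@clim_cst _ _)).
move/(@clim_le _ _ _ N0 (cabs (rgauss s N0) / 2)).
rewrite l0 sub0r cabsN; have := g0; rewrite -cabs_gt0 => g1 h1.
have : cabs (rgauss s N0) <= cabs (rgauss s N0) / 2.
  apply: h1 => n Nn; apply: le_trans (h s N0 n (lexx _) (leqnn _) Nn) _.
  rewrite ler_wpM2l ?cabs_ge0 // ler_pdivrMr // ; lra.
lra.
Qed.

(** Off the poles the limit is nonzero and can be inverted; at a pole both [rgauss s] and the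
    approximants of [Gamma] are eventually 0. *)
Lemma rGamma_lim s : clim (rgauss s) (rGamma s).
Proof.
have eqi n : (n`!%:R * cpow n%:R s / \prod_(k < n.+1) (s + k%:R)) = (rgauss s n)^-1.
  by rewrite /rgauss invf_div.
have [p|np] := pselect (exists k : nat, s = - k%:R); last first.
  have [l hl] := rgauss_cvg s; have l0 := rgauss_lim_neq0 np hl.
  have := climV l0 hl; rewrite (_ : (fun n => _) = fun n : nat =>
     (n`!%:R * cpow n%:R s / \prod_(k < n.+1) (s + k%:R))); last exact/funext.
  by move=> h; rewrite /rGamma /Gamma (clim_lim h) invrK.
have [N hN] := prod_shift_eq0 p.
have h0 : clim (fun n : nat => (n`!%:R * cpow n%:R s / \prod_(k < n.+1) (s + k%:R))) 0.
  apply: (@clim_near _ (fun=> 0)); last exact: clim_cst.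
  by exists N => n /hN ->; rewrite invr0 mulr0.
rewrite /rGamma /Gamma (clim_lim h0) invr0.
apply: (@clim_near _ (fun=> 0)); last exact: clim_cst.
by exists N => n /hN e; rewrite /rgauss e mul0r.
Qed.

Arguments rGamma_lim s : clear implicits.

Lemma rGamma_eq0 s : rGamma s = 0 <-> exists k : nat, s = - k%:R.
Proof.
split=> [e|p].
  apply: contrapT => /rgauss_lim_neq0 h; have := h _ (rGamma_lim s).
  by rewrite e eqxx.
have [N hN] := prod_shift_eq0 p; apply: (clim_unique (rGamma_lim s)).
apply: (@clim_near _ (fun=> 0)); last exact: clim_cst.
by exists N => n /hN e; rewrite /rgauss e mul0r.
Qed.

Lemma clim_invn : clim (fun n => n%:R^-1 : C) 0.
Proof.
apply/climP => e e0; exists (Num.bound e^-1).+1 => n hn; rewrite subr0 cabsV cabs_nat.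
have n0 : 0 < n%:R :> R by rewrite ltr0n (leq_trans _ hn).
rewrite invf_plt ?posrE //; apply: lt_le_trans (archi_boundP _) _; first by rewrite invr_ge0 ltW.
by rewrite ler_nat ltnW.
Qed.

(** The approximants satisfy this up to the factor 1 + (s+1)/n, which tends to 1; poles need no
    separate treatment. *)
Lemma rGammaS s : rGamma s = s * rGamma (s + 1).
Proof.
have h1 : clim (fun n => s * rgauss (s + 1) n) (s * rGamma (s + 1)).
  by apply: climM; [exact: clim_cst|exact: rGamma_lim].
have h2 : clim (fun n => rgauss s n * (1 + (s + 1) * n%:R^-1)) (rGamma s * (1 + (s + 1) * 0)).
  apply: climM; first exact: rGamma_lim.
  apply: climD; first exact: clim_cst.
  by apply: climM; [exact: clim_cst|exact: clim_invn].
move: h2; rewrite mulr0 addr0 mulr1 => h2.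
apply: clim_unique h2 _; apply: clim_near h1; exists 1%N => n n0.
have nR : 0 < n%:R :> R by rewrite ltr0n.
rewrite /rgauss cpowD //.
have -> : cpow n%:R 1 = n%:R :> C.
  by have := @cpow_real R _ 1 nR; rewrite powRr1 ?(ltW nR) // realnat.
have e : s * \prod_(k < n.+1) (s + 1 + k%:R) = (\prod_(k < n.+1) (s + k%:R)) * (s + n.+1%:R).
  transitivity (\prod_(k < n.+2) (s + k%:R)); last by rewrite big_ord_recr.
  rewrite [RHS]big_ord_recl /= addr0; congr (_ * _).
  by apply: eq_bigr => i _; rewrite /bump /= natrD addrA.
have h4 := natr_neq0C n0; have h3 := fact_neq0C n; have h5 := cpow_neq0 s nR.
move: e h4 h3 h5; rewrite -nat1r.
move: (\prod_(k < n.+1) (s + 1 + k%:R)) (\prod_(k < n.+1) (s + k%:R)) (cpow n%:R s) (n%:R : C) (n`!%:R : C).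
move=> P1 P0 c m f e m0 f0 c0; rewrite mulrA e; field.
by rewrite m0 f0 c0.
Qed.

Lemma contc_rgauss s n : (0 < n)%N -> contc (fun z => rgauss z n) s.
Proof.
move=> n0; have nR : 0 < n%:R :> R by rewrite ltr0n.
apply: contcM.
  by apply: contc_prod => i; apply: contcD; [exact: contc_id|exact: contc_cst].
apply: contcV; first by rewrite mulf_neq0 ?fact_neq0C ?cpow_neq0.
by apply: contcM; [exact: contc_cst|exact: contc_cpow].
Qed.

(** A locally uniform limit of continuous functions: [rgauss_close] is applied on the disc of radius
    |s| + 1. *)
Lemma contc_rGamma s : contc rGamma s.
Proof.
have B0 : 0 <= cabs s + 1 by rewrite addr_ge0 ?cabs_ge0.
have [K K0 [N0 [N00 KN0] h]] := rgauss_close B0.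
have hl w N : cabs w <= cabs s + 1 -> (N0 <= N)%N ->
    cabs (rGamma w - rgauss w N) <= cabs (rgauss w N) * (K / N%:R).
  move=> wB NN; have : clim (fun n => rgauss w n - rgauss w N) (rGamma w - rgauss w N).
    by apply: climD; [exact: rGamma_lim|exact: clim_cst].
  by apply: (@clim_le _ _ _ N) => n Nn; apply: h.
apply/contcP => e e0.
pose A := cabs (rgauss s N0) + 1.
have A0 : 0 < A by rewrite ltr_wpDl // cabs_ge0.
have [d1 d10 hd1] := (contcP _ _).1 (@contc_rgauss s _ N00) 1 ltr01.
have bnd w N : cabs w <= cabs s + 1 -> cabs (w - s) < d1 -> (N0 <= N)%N ->
    cabs (rgauss w N) <= 2 * A.
  move=> wB ws NN; have -> : rgauss w N = rgauss w N0 + (rgauss w N - rgauss w N0) by ring.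
  have wA : cabs (rgauss w N0) <= A.
    have -> : rgauss w N0 = rgauss s N0 + (rgauss w N0 - rgauss s N0) by ring.
    by apply: le_trans (cabsD _ _) _; rewrite lerD2l ltW // hd1.
  apply: le_trans (cabsD _ _) _; rewrite mulr2n mulrDl mul1r lerD //.
  apply: le_trans (h w N0 N wB (leqnn _) NN) _; rewrite -[A]mulr1 ler_pM ?cabs_ge0 //.
    by rewrite divr_ge0.
  by rewrite ler_pdivrMr ?ltr0n // mul1r; lra.
pose N := (N0 + (Num.bound (6 * A * K / e)))%N.+1.
have NR : 0 < N%:R :> R by rewrite ltr0n.
have N0N : (N0 <= N)%N by rewrite /N -addnS leq_addr.
have AN : 2 * A * (K / N%:R) < e / 3.
  have bb : 6 * A * K / e < N%:R.
    apply: lt_le_trans (archi_boundP _) _; first by rewrite divr_ge0 ?mulr_ge0 // ltW.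
    by rewrite ler_nat /N -addSn leq_addl.
  by move: bb; rewrite mulrA !ltr_pdivrMr //; lra.
have e3 : 0 < e / 3 by rewrite divr_gt0.
have [d2 d20 hd2] := (contcP _ _).1 (@contc_rgauss s _ (leq_trans N00 N0N)) _ e3.
have cl w : cabs (w - s) < d1 -> cabs (w - s) < 1 -> cabs (rGamma w - rgauss w N) < e / 3.
  move=> ws1 ws; have wB : cabs w <= cabs s + 1.
    have -> : w = s + (w - s) by ring.
    by apply: le_trans (cabsD _ _) _; rewrite lerD2l ltW.
  apply: le_lt_trans (hl w N wB N0N) _; apply: le_lt_trans AN.
  by apply: ler_wpM2r; [rewrite divr_ge0|exact: bnd].
exists (Num.min 1 (Num.min d1 d2)); first by rewrite !lt_min ltr01 d10 d20.
move=> w; rewrite !lt_min => /and3P [w1 w2 w3].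
have -> : rGamma w - rGamma s = (rGamma w - rgauss w N) + (rgauss w N - rgauss s N)
    + - (rGamma s - rgauss s N) by ring.
apply: le_lt_trans (cabsD _ _) _; rewrite cabsN.
have := cabsD (rGamma w - rgauss w N) (rgauss w N - rgauss s N).
have := cl _ w2 w1; have := hd2 _ w3.
have : cabs (rGamma s - rgauss s N) < e / 3 by apply: cl; rewrite subrr cabs0.
lra.
Qed.

End Gamma.

Arguments rGamma_lim {R} s _ _.
Arguments contc_rGamma {R} s _ _.

(** * The multiplication formula for 1/Gamma, up to a positive constant *)

Section GammaMultiplication.
Variable R : realType.
Local Notation C := R[i].
Implicit Types (s z w : C).

(** The approximants at x are positive reals, so the limit is real and nonnegative; it is nonzero
    because x is not a pole. *)
Lemma rGamma_pos (x : R) : 0 < x -> exists2 r : R, 0 < r & rGamma x%:C%C = r%:C%C.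
Proof.
move=> x0; have np : ~ exists k : nat, (x%:C%C : C) = - k%:R.
  move=> [k]; rewrite -realnat -rmorphN => /complexI e.
  by move: x0; rewrite e ltNge oppr_le0 ler0n.
have g n : (0 < n)%N -> exists2 r : R, 0 < r & rgauss x%:C%C n = r%:C%C.
  move=> n0; have nR : 0 < n%:R :> R by rewrite ltr0n.
  exists (\prod_(k < n.+1) (x + k%:R) / (n`!%:R * (n%:R `^ x))).
    rewrite divr_gt0 ?mulr_gt0 ?powR_gt0 ?ltr0n ?fact_gt0 // prodr_gt0 // => k _.
    by rewrite ltr_wpDr.
  rewrite /rgauss cpow_real // fmorph_div /= rmorphM /= realnat rmorph_prod /=.
  by congr (_ / _); apply: eq_bigr => k _; rewrite rmorphD /= realnat.
have h := (climP _ _).1 (rGamma_lim x%:C%C).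
have Im0 : cIm (rGamma (x%:C%C : C)) = 0.
  apply/eqP; rewrite -normr_eq0; apply/eqP/le_anti; rewrite normr_ge0 andbT.
  apply/ler_addgt0Pl => e e0; rewrite addr0.
  have [N hN] := h _ e0; have [r r0 er] := g _ (ltn0Sn N).
  have /ltW := hN N.+1 (leqnSn N); apply: le_trans; apply: le_trans (Im_le_cabs _).
  by rewrite cImB er /= sub0r normrN.
have Re0 : 0 <= cRe (rGamma (x%:C%C : C)).
  apply/ler_addgt0Pl => e e0; rewrite addrC.
  have [N hN] := h _ e0; have [r r0 er] := g _ (ltn0Sn N).
  have := le_lt_trans (Re_le_cabs _) (hN N.+1 (leqnSn N)).
  rewrite cReB er /= ltr_norml => /andP [_]; lra.
have e : rGamma (x%:C%C : C) = (cRe (rGamma (x%:C%C : C)))%:C%C.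
  by apply: cplx_ext.
exists (cRe (rGamma (x%:C%C : C))) => //.
rewrite lt0r Re0 andbT; apply/eqP => e0; apply: np; apply/rGamma_eq0.
by rewrite e e0.
Qed.

Lemma prod_mulS (m p : nat) (f : nat -> C) :
  \prod_(i < m * p) f i = \prod_(j < p) \prod_(k < m) f (k + m * j)%N.
Proof.
elim: p => [|p IH]; first by rewrite muln0 !big_ord0.
rewrite mulnS addnC big_split_ord /= IH big_ord_recr /=; congr (_ * _).
by apply: eq_bigr => k _; rewrite addnC.
Qed.

Lemma prod_cpow (I : Type) (l : seq I) (x : R) (f : I -> C) : 0 < x ->
  \prod_(i <- l) cpow x (f i) = cpow x (\sum_(i <- l) f i).
Proof.
move=> x0; elim: l => [|i l IH]; first by rewrite !big_nil cpow0.
by rewrite !big_cons cpowD // IH.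
Qed.

Lemma rgauss_mult (m : nat) : (0 < m)%N -> exists a : nat -> R,
  forall n, (0 < n)%N -> 0 < a n /\ forall z,
    \prod_(k < m) rgauss ((z + k%:R) / m%:R) n =
    (a n)%:C%C * (rgauss z (m * n.+1).-1 *
      (cpow (m * n.+1).-1%:R z / cpow n%:R z)).
Proof.
move=> m0; have mR : 0 < m%:R :> R by rewrite ltr0n.
pose b n : R := n%:R `^ (\sum_(k < m) k%:R / m%:R).
exists (fun n => (m * n.+1).-1`!%:R / (m%:R ^+ (m * n.+1) * n`!%:R ^+ m * b n)) => n n0.
have nR : 0 < n%:R :> R by rewrite ltr0n.
have N1 : (m * n.+1).-1.+1 = (m * n.+1)%N by rewrite prednK // muln_gt0 m0.
have N0 : (0 < (m * n.+1).-1)%N.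
  by rewrite -ltnS N1; apply: leq_trans (leq_pmull _ m0).
move: N1 N0; set N := (m * n.+1).-1 => N1 N0.
have NR : 0 < N%:R :> R by rewrite ltr0n.
have b0 : 0 < b n by rewrite powR_gt0.
split; first by rewrite divr_gt0 ?mulr_gt0 ?exprn_gt0 ?ltr0n ?fact_gt0.
move=> z; rewrite /rgauss N1 prodf_div.
have mC := natr_neq0C R m0.
have -> : \prod_(k < m) \prod_(j < n.+1) ((z + k%:R) / m%:R + j%:R) =
    (\prod_(i < m * n.+1) (z + i%:R)) / m%:R ^+ (m * n.+1).
  rewrite (prod_mulS m n.+1 (fun i => z + i%:R)) exchange_big /=.
  rewrite exprM -[n.+1 in X in _ / X]card_ord -prodr_const -prodf_div; apply: eq_bigr => j _.
  rewrite -[X in _ ^+ X]card_ord -prodr_const -prodf_div; apply: eq_bigr => k _.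
  by rewrite natrD natrM; field.
have -> : \prod_(k < m) (n`!%:R * cpow n%:R ((z + k%:R) / m%:R)) =
   n`!%:R ^+ m * (cpow n%:R z * (b n)%:C%C).
  rewrite big_split /= prodr_const card_ord; congr (_ * _).
  rewrite prod_cpow // -cpow_real // -cpowD //; congr (cpow _ _).
  rewrite rmorph_sum /= (eq_bigr (fun k : 'I_m => z / m%:R + k%:R / m%:R)); last first.
    by move=> k _; rewrite mulrDl.
  rewrite big_split /= sumr_const card_ord -[_ *+ m]mulr_natr mulfVK //.
  by congr (_ + _); apply: eq_bigr => k _; rewrite fmorph_div /= !realnat.
rewrite fmorph_div /= !rmorphM /= !rmorphXn /= !realnat.
have b0' : ((b n)%:C%C : C) != 0 by rewrite (_ : 0 = 0%:C%C) // (inj_eq (@complexI _)) gt_eqF.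
have c1 := cpow_neq0 z nR; have c2 := cpow_neq0 z NR.
have f1 := fact_neq0C R n; have f2 := fact_neq0C R N.
have mm : (m%:R : C) ^+ (m * n.+1) != 0 by rewrite expf_neq0.
have ff : (n`!%:R : C) ^+ m != 0 by rewrite expf_neq0.
move: mm ff; move: (_ ^+ (m * n.+1)) (n`!%:R ^+ m) => u v u0 v0.
move: (\prod_(i < _) _) c1 c2 f2 => P; move: (cpow n%:R z) (cpow N%:R z) (N`!%:R).
move=> d e f d0 e0 f0; field.
by rewrite b0' d0 e0 f0 u0 v0.
Qed.

(** The large base is mn + (m-1), so its logarithm exceeds ln n + ln m by at most 1/n. *)
Lemma cpow_ratio_lim (m : nat) z : (0 < m)%N ->
  clim (fun n => cpow (m * n.+1).-1%:R z / cpow n%:R z) (cpow m%:R z).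
Proof.
move=> m0; have mR : 0 < m%:R :> R by rewrite ltr0n.
pose d n : R := ln (m * n.+1).-1%:R - ln n%:R - ln m%:R.
have hd n : (0 < n)%N -> `|d n| <= n%:R^-1.
  move=> n0; have nR : 0 < n%:R :> R by rewrite ltr0n.
  have e : (m * n.+1).-1%:R = (m%:R * n%:R) * (1 + (m.-1)%:R / (m%:R * n%:R)) :> R.
    rewrite mulrDr mulr1 [X in _ + X]mulrC divfK ?gt_eqF ?mulr_gt0 //.
    rewrite -natrM -natrD; congr _%:R.
    by rewrite mulnS -(prednK m0) /= addnC.
  have q0 : 0 <= (m.-1)%:R / (m%:R * n%:R) :> R by rewrite divr_ge0 ?mulr_ge0.
  have -> : d n = ln (1 + (m.-1)%:R / (m%:R * n%:R)).
    by rewrite /d e !lnM ?posrE ?mulr_gt0 // ?ltr_pwDl //; ring.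
  rewrite ger0_norm ?ln_ge0 ?lerDl //.
  apply: le_trans (le_ln1Dx _) _; first by rewrite (lt_le_trans _ q0) // ltrN10.
  rewrite ler_pdivrMr ?mulr_gt0 // mulrCA mulVf ?gt_eqF // mulr1 ler_nat.
  exact: leq_pred.
have h : clim (fun n => cpow m%:R z * cexp (z * (d n)%:C%C)) (cpow m%:R z * 1).
  apply: climM; first exact: clim_cst.
  apply/climP => e e0.
  pose A := cabs z; have A0 : 0 <= A by exact: cabs_ge0.
  exists (Num.bound (2 * A + 5 * A / e)).+1 => n hn.
  have n0 : (0 < n)%N by apply: leq_trans hn.
  have nR : 0 < n%:R :> R by rewrite ltr0n.
  have bA : 2 * A + 5 * A / e < n%:R.
    apply: lt_le_trans (archi_boundP _) _.
      by rewrite addr_ge0 ?divr_ge0 ?mulr_ge0 // ltW.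
    by rewrite ler_nat ltnW.
  have q0 : 0 <= 5 * A / e by rewrite divr_ge0 ?mulr_ge0 // ltW.
  have w1 : cabs (z * (d n)%:C%C) <= A * n%:R^-1.
    by rewrite cabsM cabs_real ler_wpM2l // hd.
  have w2 : cabs (z * (d n)%:C%C) <= 2^-1.
    by apply: le_trans w1 _; rewrite ler_pdivrMr //; lra.
  apply: le_lt_trans (cexp_sub1 w2) _.
  apply: (@le_lt_trans _ _ (5 * (A / n%:R))); first by rewrite ler_wpM2l.
  have : 5 * A / e < n%:R by lra.
  by rewrite ltr_pdivrMr // mulrA [_ * e]mulrC -ltr_pdivrMr.
move: h; rewrite mulr1; apply: clim_near; exists 1%N => n n0.
have nR : 0 < n%:R :> R by rewrite ltr0n.
have NR : 0 < (m * n.+1).-1%:R :> R.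
  rewrite ltr0n -ltnS prednK ?muln_gt0 ?m0 //.
  by apply: leq_trans (leq_pmull _ m0).
rewrite !cpowE // -cexpN -!cexpD; congr cexp.
by rewrite /d !rmorphB /=; ring.
Qed.

(* The constant is evaluated at z = 1; only its positivity matters below. *)
Lemma rGamma_mult (m : nat) : (0 < m)%N -> exists2 A : R, 0 < A & forall z,
  \prod_(k < m) rGamma ((z + k%:R) / m%:R) = A%:C%C * (cpow m%:R z * rGamma z).
Proof.
move=> m0; have mR : 0 < m%:R :> R by rewrite ltr0n.
have [a ha] := rgauss_mult m0.
have hsub n : (n <= (m * n.+1).-1)%N.
  by rewrite -ltnS prednK ?muln_gt0 ?m0 // leq_pmull.
have h1 z : clim (fun n => \prod_(k < m) rgauss ((z + k%:R) / m%:R) n)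
    (\prod_(k < m) rGamma ((z + k%:R) / m%:R)).
  by apply: clim_prod => k; exact: rGamma_lim.
have h2 z : clim (fun n => rgauss z (m * n.+1).-1 *
      (cpow (m * n.+1).-1%:R z / cpow n%:R z)) (rGamma z * cpow m%:R z).
  apply: climM; last exact: cpow_ratio_lim.
  exact: (@clim_subseq _ (rgauss z) _ (fun n => (m * n.+1).-1) hsub (rGamma_lim z)).
have [r1 r10 er1] := rGamma_pos (ltr01 : 0 < 1 :> R).
have p1 : rGamma 1 * cpow m%:R 1 = (r1 * m%:R `^ 1)%:C%C.
  by rewrite rmorphM /= -cpow_real // -er1.
have [r2 r20 er2] : exists2 r2 : R, 0 < r2 & \prod_(k < m) rGamma ((1 + k%:R) / m%:R) = r2%:C%C.
  elim/big_ind : _ => [|x y [r r0 ->] [t t0 ->]|k _].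
  - by exists 1.
  - by exists (r * t); rewrite ?mulr_gt0 // rmorphM.
  have p : 0 < (1 + k%:R) / m%:R :> R by rewrite divr_gt0 // ltr_pwDl.
  have [r r0 e] := rGamma_pos p; exists r => //.
  by rewrite -e fmorph_div rmorphD /= !realnat.
have q0 : 0 < r1 * m%:R `^ 1 by rewrite mulr_gt0 ?powR_gt0.
have q0' : ((r1 * m%:R `^ 1)%:C%C : C) != 0.
  by rewrite (_ : 0 = 0%:C%C) // (inj_eq (@complexI _)) gt_eqF.
exists (r2 / (r1 * m%:R `^ 1)); first by rewrite divr_gt0.
(* At z = 1 the limit of the other factor is nonzero, so dividing by it shows that the constants
   [a n] converge. *)
have ha1 : clim (fun n => (a n)%:C%C) (r2 / (r1 * m%:R `^ 1))%:C%C.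
  rewrite fmorph_div /= -er2 -p1.
  have p10 : rGamma 1 * cpow m%:R 1 != 0 :> C by rewrite p1.
  have := climM (h1 1) (climV p10 (h2 1)).
  apply: clim_near; exists 1%N => n n0.
  have [_ ->] := ha _ n0; rewrite mulfK //.
  have nR : 0 < n%:R :> R by rewrite ltr0n.
  have NN : (0 < (m * n.+1).-1)%N by apply: leq_trans (hsub n).
  apply: mulf_neq0; last by rewrite mulf_neq0 ?invr_neq0 ?cpow_neq0 ?ltr0n.
  apply: rgauss_neq0 => // -[k] /(congr1 (@complex.Re R)).
  rewrite cReN cRe_nat /= => e; have := ler0n R k; have := (ltr01 : 0 < 1 :> R); lra.
move=> z; apply: clim_unique (h1 z) _.
have := climM ha1 (h2 z); rewrite (mulrC (rGamma z)).
by apply: clim_near; exists 1%N => n n0; have [_ ->] := ha _ n0.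
Qed.

End GammaMultiplication.

(** * Unique continuation of entire functions *)

Section Integral.
Variable R : realType.
Local Notation C := R[i].
Variable K : R.

Lemma antiderivative (u : R -> R) : continuous u ->
  exists P : R -> R, forall x : R, `|x| < K -> is_derive x 1 P (u x).
Proof.
move=> uc; exists (fun x0 : R => \int[lebesgue_measure]_(t in `[(- K), x0]) u t)%R.
move=> x; rewrite ltr_norml => /andP [x1 x2].
have ui : lebesgue_measure.-integrable `[- K, K] (EFin \o u).
  apply: continuous_compact_integrable; first exact: segment_compact.
  exact: continuous_subspaceT.
have [d1 d2] := continuous_FTC1_closed x2 ui x1 (uc x).
by apply: (DeriveDef d1); rewrite -derive1E; exact: d2.
Qed.

(** The default is taken only if no primitive exists on |x| < K, which never happens for continuous
    u. *)
Definition primitive (u : R -> R) : R -> R :=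
  xget (fun=> 0) [set P : R -> R | forall x : R, `|x| < K -> is_derive x 1 P (u x)].

Lemma is_derive_primitive u (x : R) : continuous u -> `|x| < K ->
  is_derive x 1 (primitive u) (u x).
Proof. by move=> /antiderivative h; move: x; exact: (xgetPex _ h). Qed.

(** The integral as a difference of values of one fixed primitive: additivity becomes algebra, and
    estimates follow from the mean value theorem. *)
Definition rint (u : R -> R) a b := primitive u b - primitive u a.

Lemma rint_approx (u F v : R -> R) (a b M : R) : continuous u -> a <= b -> `|a| < K -> `|b| < K ->
  (forall x : R, is_derive x 1 F (v x)) ->
  (forall x, a <= x <= b -> `|u x - v x| <= M) ->
  `|rint u a b - (F b - F a)| <= M * (b - a).
Proof.
move=> uc ab aK bK dF uv.
have -> : rint u a b - (F b - F a) = (primitive u \- F) b - (primitive u \- F) a.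
  by rewrite /rint /=; ring.
apply: (mvt_bound (df := fun x => u x - v x)) => // x /andP [ax xb].
apply: is_deriveB; apply: is_derive_primitive => //.
by move: aK bK; rewrite !ltr_norml; move=> /andP [? ?] /andP [? ?]; apply/andP; split; lra.
Qed.

Definition lcont (u : R -> C) := forall x e, 0 < e -> exists2 d, 0 < d &
  forall t, `|t - x| < d -> cabs (u t - u x) < e.

Lemma lcont_Re u : lcont u -> continuous (fun t => cRe (u t)).
Proof.
move=> h x; apply/cvgrPdist_lt => e e0; have [d d0 hd] := h x e e0.
apply/nbhs_ballP; exists d => //= t; rewrite /ball /= distrC => /hd.
by rewrite -cReB -normrN -cReN opprB; apply: le_lt_trans (Re_le_cabs _).
Qed.

Lemma lcont_Im u : lcont u -> continuous (fun t => cIm (u t)).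
Proof.
move=> h x; apply/cvgrPdist_lt => e e0; have [d d0 hd] := h x e e0.
apply/nbhs_ballP; exists d => //= t; rewrite /ball /= distrC => /hd.
by rewrite -cImB -normrN -cImN opprB; apply: le_lt_trans (Im_le_cabs _).
Qed.

Definition cint (u : R -> C) a b : C :=
  (rint (fun t => cRe (u t)) a b +i* rint (fun t => cIm (u t)) a b)%C.

Lemma cint_chasles u a b c : cint u a c = cint u a b + cint u b c.
Proof. by apply: cplx_ext; rewrite /cint /rint ?cReD ?cImD /=; ring. Qed.

Lemma is_derive_quadratic (p q r x : R) :
  is_derive x 1 (fun t : R => p + q * t + r * t ^+ 2) (q + 2 * r * x).
Proof.
have d : is_derive x 1 (cst p + q \*: id + r \*: (id ^+ 2)) _ :=
  is_deriveD (is_deriveD (is_derive_cst p x 1) (is_deriveZ q (is_derive_id x (1 : R))))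
    (is_deriveZ r (is_deriveX 2 (is_derive_id x (1 : R)))).
by apply: (is_derive_eq d); rewrite /GRing.scale /= expr1; ring.
Qed.

(** The affine function c1 + 2 c2 x has the primitive c1 x + c2 x^2. The factor 2 comes from
    bounding real and imaginary parts separately. *)
Lemma cint_approx u (c1 c2 : C) (a b M : R) : lcont u -> a <= b -> `|a| < K -> `|b| < K ->
  (forall x, a <= x <= b -> cabs (u x - (c1 + 2 * c2 * x%:C%C)) <= M) ->
  cabs (cint u a b - (c1 * (b - a)%:C%C + c2 * (b ^+ 2 - a ^+ 2)%:C%C)) <= 2 * M * (b - a).
Proof.
move=> uc ab aK bK h.
have hR := @rint_approx _ _ _ a b M (lcont_Re uc) ab aK bK
  (is_derive_quadratic 0 (cRe c1) (cRe c2)).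
have hI := @rint_approx _ _ _ a b M (lcont_Im uc) ab aK bK
  (is_derive_quadratic 0 (cIm c1) (cIm c2)).
have two : (2 : C) = 2%:C%C by rewrite (rmorph_nat (real_complex R)).
apply: le_trans (cabs_le_ReIm _) _.
have -> : cRe (cint u a b - (c1 * (b - a)%:C%C + c2 * (b ^+ 2 - a ^+ 2)%:C%C)) =
  rint (fun t => cRe (u t)) a b - (0 + cRe c1 * b + cRe c2 * b ^+ 2 -
     (0 + cRe c1 * a + cRe c2 * a ^+ 2)).
  by rewrite cReB cReD !cReM /=; ring.
have -> : cIm (cint u a b - (c1 * (b - a)%:C%C + c2 * (b ^+ 2 - a ^+ 2)%:C%C)) =
  rint (fun t => cIm (u t)) a b - (0 + cIm c1 * b + cIm c2 * b ^+ 2 -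
     (0 + cIm c1 * a + cIm c2 * a ^+ 2)).
  by rewrite cImB cImD !cImM /=; ring.
rewrite -mulrA mulr2n mulrDl mul1r; apply: lerD; [apply: hR|apply: hI] => x xab.
  apply: le_trans (h x xab); apply: le_trans (Re_le_cabs _).
  rewrite two cReB cReD !(cReM, cImM) /=.
  by rewrite le_eqVlt; apply/orP; left; apply/eqP; congr `|_|; ring.
apply: le_trans (h x xab); apply: le_trans (Im_le_cabs _).
rewrite two cImB cImD !(cReM, cImM) /=.
by rewrite le_eqVlt; apply/orP; left; apply/eqP; congr `|_|; ring.
Qed.

Lemma cint_bound u (a b M : R) : lcont u -> a <= b -> `|a| < K -> `|b| < K ->
  (forall x, a <= x <= b -> cabs (u x) <= M) -> cabs (cint u a b) <= 2 * M * (b - a).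
Proof.
move=> uc ab aK bK h; have := @cint_approx u 0 0 a b M uc ab aK bK.
by rewrite !mul0r addr0 subr0; apply => x xab; rewrite mulr0 mul0r addr0 subr0 h.
Qed.

Lemma rint_ge (u : R -> R) (a b m : R) : continuous u -> a <= b -> `|a| < K -> `|b| < K ->
  (forall x, a <= x <= b -> m <= u x) -> m * (b - a) <= rint u a b.
Proof.
move=> uc ab aK bK h.
have d (x : R) : `|x| < K -> is_derive x 1 (primitive u) (u x) by exact: is_derive_primitive.
have inK x : a <= x <= b -> `|x| < K.
  move=> /andP [ax xb]; move: aK bK; rewrite !ltr_norml.
  by move=> /andP [? ?] /andP [? ?]; apply/andP; split; lra.
have [|| c cab e] := @MVT_segment _ (primitive u) u _ _ ab.
- move=> x; rewrite in_itv /= => /andP [/ltW ax /ltW xb]; apply: d; apply: inK.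
  by rewrite ax xb.
- apply: derivable_within_continuous => x; rewrite in_itv /= => /inK hx.
  exact: (@ex_derive _ _ _ _ _ _ _ (d x hx)).
- rewrite /rint e ler_wpM2r ?subr_ge0 //; apply: h.
  by move: cab; rewrite in_itv.
Qed.

End Integral.

(** * Goursat's theorem for rectangles *)

Section Goursat.
Variable R : realType.
Local Notation C := R[i].
Local Notation Co := (R[i]^o).

Lemma derivable_approx (f : C -> C) s : derivable (f : Co -> Co) s 1 ->
  exists L : C, forall e, 0 < e -> exists2 d, 0 < d & forall w, cabs (w - s) < d ->
    cabs (f w - f s - L * (w - s)) <= e * cabs (w - s).
Proof.
move=> /cvg_ex [L hL]; exists L => e e0.
move/cvgrPdist_lt: hL => /(_ (e%:C%C)); rewrite ltcR => /(_ e0).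
move=> /nbhs_ballP [d]; rewrite /= ltcE /= => /andP [/eqP d1 d0] hd.
exists (cRe d) => // w wd; have [->|ws] := eqVneq w s.
  by rewrite !subrr mulr0 subrr cabs0 mulr0.
have w0 : w - s != 0 by rewrite subr_eq0.
have := hd (w - s); rewrite /ball /= sub0r normrN cabsE ltcE /= d1 eqxx /= => /(_ wd w0).
rewrite cabsE ltcR => h.
have -> : f w - f s - L * (w - s) = - ((L - (w - s)^-1 * (f w - f s)) * (w - s)).
  by field.
rewrite cabsN cabsM ler_wpM2r ?cabs_ge0 //; apply/ltW; move: h.
by rewrite /GRing.scale /= mulr1 subrK.
Qed.

Lemma entire_cont (f : C -> C) : entire f -> forall s, contc f s.
Proof.
move=> fe s; have [L hL] := derivable_approx (fe s).
apply/contcP => e e0; have [d d0 hd] := hL 1 ltr01.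
pose A := cabs L + 1; have A0 : 0 < A by rewrite ltr_wpDl // cabs_ge0.
exists (Num.min d (e / A)); first by rewrite lt_min d0 divr_gt0.
move=> w; rewrite lt_min => /andP [/hd h1]; rewrite ltr_pdivlMr // => h2.
have -> : f w - f s = (f w - f s - L * (w - s)) + L * (w - s) by ring.
apply: le_lt_trans (cabsD _ _) _; apply: le_lt_trans (lerD h1 (lexx _)) _.
by rewrite cabsM; apply: le_lt_trans h2; rewrite /A; lra.
Qed.

Definition horiz (f : C -> C) (y t : R) : C := f (t +i* y)%C.
Definition vert (f : C -> C) (x t : R) : C := f (x +i* t)%C.

Lemma lcont_horiz f y : (forall s, contc f s) -> lcont (horiz f y).
Proof.
move=> fc x e e0; have [d d0 hd] := (contcP _ _).1 (fc (x +i* y)%C) e e0.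
exists d => // t tx; apply: hd; apply: le_lt_trans (cabs_le_ReIm _) _.
by rewrite cReB cImB /= subrr normr0 addr0.
Qed.
Lemma lcont_vert f x : (forall s, contc f s) -> lcont (vert f x).
Proof.
move=> fc y e e0; have [d d0 hd] := (contcP _ _).1 (fc (x +i* y)%C) e e0.
exists d => // t tx; apply: hd; apply: le_lt_trans (cabs_le_ReIm _) _.
by rewrite cReB cImB /= subrr normr0 add0r.
Qed.

Variable K : R.

(** Counterclockwise boundary integral of the rectangle with lower left corner x + iy, width w and
    height h; the factors i come from dz = i dt on the vertical sides. *)
Definition contour (f : C -> C) (x y w h : R) : C :=
  cint K (horiz f y) x (x + w) + 'i%C * cint K (vert f (x + w)) y (y + h)
  - cint K (horiz f (y + h)) x (x + w) - 'i%C * cint K (vert f x) y (y + h).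

Lemma contour_split f x y w h : contour f x y w h =
  contour f x y (w / 2) (h / 2) + contour f (x + w / 2) y (w / 2) (h / 2) +
  (contour f x (y + h / 2) (w / 2) (h / 2) +
   contour f (x + w / 2) (y + h / 2) (w / 2) (h / 2)).
Proof.
rewrite /contour -!addrA -!splitr.
rewrite (cint_chasles K (horiz f y) x (x + w / 2)).
rewrite (cint_chasles K (horiz f (y + h)) x (x + w / 2)).
rewrite (cint_chasles K (vert f (x + w)) y (y + h / 2)).
rewrite (cint_chasles K (vert f x) y (y + h / 2)).
by ring.
Qed.

Lemma nested_point (u w : nat -> R) :
  (forall N n, (N <= n)%N -> u N <= u n <= u N + w N) ->
  exists p, forall N, u N <= p <= u N + w N.
Proof.
move=> h; pose S := [set u n | n in [set: nat]].
have ub N : ubound S (u N + w N).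
  move=> _ [n _ <-]; have /andP [h1 h2] := h _ _ (leq_maxl N n).
  by have /andP [h3 h4] := h _ _ (leq_maxr N n); apply: le_trans h3 h2.
have S0 : S !=set0 by exists (u 0); exists 0.
exists (sup S) => N; apply/andP; split.
  by apply: sup_upper_bound; [split => //; exists (u 0 + w 0)|exists N].
exact: ge_sup.
Qed.

(** If P fails, it fails on one of the four quarters, and so on; the nested failing rectangles
    shrink to a point, where the local hypothesis is violated. *)
Lemma rectangle_induction (P : R -> R -> R -> R -> Prop) (x0 y0 w0 h0 : R) :
  0 <= w0 -> 0 <= h0 ->
  (forall x y w h, 0 <= w -> 0 <= h -> P x y (w / 2) (h / 2) -> P (x + w / 2) y (w / 2) (h / 2) ->
    P x (y + h / 2) (w / 2) (h / 2) -> P (x + w / 2) (y + h / 2) (w / 2) (h / 2) ->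
    P x y w h) ->
  (forall p q, x0 <= p <= x0 + w0 -> y0 <= q <= y0 + h0 -> exists n, forall x y,
    x <= p <= x + w0 / 2 ^+ n -> y <= q <= y + h0 / 2 ^+ n ->
    P x y (w0 / 2 ^+ n) (h0 / 2 ^+ n)) ->
  P x0 y0 w0 h0.
Proof.
move=> w00 h00 split_ loc; apply: contrapT => nP.
pose W n := w0 / 2 ^+ n; pose H n := h0 / 2 ^+ n.
have W0 n : 0 <= W n by rewrite divr_ge0.
have H0 n : 0 <= H n by rewrite divr_ge0.
have WS n : W n.+1 = W n / 2 by rewrite /W exprSr invfM mulrA.
have HS n : H n.+1 = H n / 2 by rewrite /H exprSr invfM mulrA.
have step n (z : R * R) : exists z' : R * R,
   [/\ ~ P z.1 z.2 (W n) (H n) -> ~ P z'.1 z'.2 (W n.+1) (H n.+1),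
    z.1 <= z'.1 <= z.1 + W n.+1 & z.2 <= z'.2 <= z.2 + H n.+1].
  have hW := W0 n.+1; have hH := H0 n.+1; rewrite WS HS in hW hH *.
  have [h1|h1] := pselect (P z.1 z.2 (W n / 2) (H n / 2)); last first.
    by exists z; split => //; rewrite lexx lerDl.
  have [h2|h2] := pselect (P (z.1 + W n / 2) z.2 (W n / 2) (H n / 2)); last first.
    by exists (z.1 + W n / 2, z.2); split => //; rewrite /= !lexx lerDl ?andbT.
  have [h3|h3] := pselect (P z.1 (z.2 + H n / 2) (W n / 2) (H n / 2)); last first.
    by exists (z.1, z.2 + H n / 2); split => //; rewrite /= !lexx lerDl ?andbT.
  exists (z.1 + W n / 2, z.2 + H n / 2); split; rewrite /= ?lexx ?lerDl ?andbT //.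
  by move=> h4 h5; apply: h4; apply: split_.
pose nx n z := sval (cid (step n z)).
pose s := fix s n := if n is n'.+1 then nx n' (s n') else (x0, y0).
have sP n : ~ P (s n).1 (s n).2 (W n) (H n).
  elim: n => [|n IH]; first by rewrite /W /H expr0 !divr1.
  by rewrite /= /nx; case: cid => z' /= [h _ _]; exact: h.
have s1 n : (s n).1 <= (s n.+1).1 <= (s n).1 + W n.+1.
  by rewrite /= /nx; case: cid => z' /= [].
have s2 n : (s n).2 <= (s n.+1).2 <= (s n).2 + H n.+1.
  by rewrite /= /nx; case: cid => z' /= [].
have nest (u V : nat -> R) : (forall n, 0 <= V n) -> (forall n, V n.+1 = V n / 2) ->
    (forall n, u n <= u n.+1 <= u n + V n.+1) ->
    forall N n, (N <= n)%N -> u N <= u n <= u N + V N.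
  move=> V0 VS hu N n /subnK <-; elim: (n - N)%N => [|k IH].
    by rewrite add0n lexx lerDl V0.
  (* The induction needs this sharper bound: the moves made from N on add up to at most
     [V N - V (k + N)]. *)
  have {IH} : u N <= u (k + N)%N <= u N + V N - V (k + N)%N.
    elim: k {IH} => [|k IH]; first by rewrite add0n addrK lexx.
    have := hu (k + N)%N; rewrite addSn VS.
    by move: IH => /andP [? ?] /andP [? ?]; apply/andP; split; lra.
  have := hu (k + N)%N; rewrite addSn VS; have := V0 (k + N)%N.
  by move=> ? /andP [? ?] /andP [? ?]; apply/andP; split; lra.
have [p hp] := nested_point (nest _ _ W0 WS s1).
have [q hq] := nested_point (nest _ _ H0 HS s2).
have [||n hn] := loc p q.
- by have := hp 0; rewrite /= /W expr0 divr1.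
- by have := hq 0; rewrite /= /H expr0 divr1.
by apply: (sP n); apply: hn.
Qed.

Lemma half_pow_small (c d : R) : 0 <= c -> 0 < d -> exists n : nat, c / 2 ^+ n < d.
Proof.
move=> c0 d0; exists (Num.bound (c / d)).
rewrite ltr_pdivrMr ?exprn_gt0 // mulrC -ltr_pdivrMr //.
apply: lt_le_trans (archi_boundP _) _; first by rewrite divr_ge0 // ltW.
by rewrite -natrX ler_nat ltnW // ltn_expl.
Qed.

(* Near a point f is its tangent line up to o(|z - p|), and the contour integral
   of an affine function vanishes. *)
Lemma contour_local f p e : (forall s, contc f s) -> derivable (f : Co -> Co) p 1 -> 0 < e ->
  `|cRe p| < K -> `|cIm p| < K ->
  exists2 d, 0 < d & forall x y w h, 0 <= w -> 0 <= h -> w + h < d ->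
    x <= cRe p <= x + w -> y <= cIm p <= y + h ->
    cabs (contour f x y w h) <= e * (w + h) ^+ 2.
Proof.
move=> fc /derivable_approx [L hL] e0 Kx Ky.
(* [cint_approx] loses a factor 2 and the perimeter is 2(w + h), so e/4 yields e in the end. *)
have e4 : 0 < e / 4 by rewrite divr_gt0.
have [d d0 hd] := hL _ e4.
exists (Num.min d (Num.min (K - `|cRe p|) (K - `|cIm p|))).
  by rewrite !lt_min d0 !subr_gt0 Kx Ky.
move=> x y w h w0 h0; rewrite !lt_min => /and3P [whd whx why] /andP [px1 px2] /andP [py1 py2].
have hK t : x <= t <= x + w -> `|t| < K.
  move=> /andP [t1 t2]; have := ler_norm (cRe p); have := ler_norm (- cRe p).
  by rewrite normrN ltr_norml => ? ?; apply/andP; split; lra.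
have hK' t : y <= t <= y + h -> `|t| < K.
  move=> /andP [t1 t2]; have := ler_norm (cIm p); have := ler_norm (- cIm p).
  by rewrite normrN ltr_norml => ? ?; apply/andP; split; lra.
pose A := f p - L * p.
have key s t : x <= s <= x + w -> y <= t <= y + h ->
    cabs (f (s +i* t)%C - (A + L * (s +i* t)%C)) <= e / 4 * (w + h).
  move=> /andP [s1 s2] /andP [t1 t2].
  have dist : cabs ((s +i* t)%C - p) <= w + h.
    apply: le_trans (cabs_le_ReIm _) _; rewrite cReB cImB /=.
    by apply: lerD; rewrite ler_norml; apply/andP; split; lra.
  have := hd _ (le_lt_trans dist whd).
  rewrite [X in cabs X](_ : _ = f (s +i* t)%C - (A + L * (s +i* t)%C)); last by rewrite /A; ring.
  by move=> /le_trans; apply; rewrite ler_wpM2l // ltW.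
have xm : x <= x <= x + w by rewrite lexx lerDl.
have xM : x <= x + w <= x + w by rewrite lexx lerDl w0.
have ym : y <= y <= y + h by rewrite lexx lerDl.
have yM : y <= y + h <= y + h by rewrite lexx lerDl h0.
have cE (s t : R) : (s +i* t)%C = s%:C%C + 'i%C * t%:C%C :> C.
  by apply: cplx_ext; rewrite ?(cReD, cImD, cReM, cImM) /=; ring.
have two : (2 : C) != 0 by rewrite pnatr_eq0.
have B t : y <= t <= y + h -> cabs (cint K (horiz f t) x (x + w) -
    ((A + L * ('i%C * t%:C%C)) * (x + w - x)%:C%C + L / 2 * ((x + w) ^+ 2 - x ^+ 2)%:C%C))
     <= 2 * (e / 4 * (w + h)) * w.
  move=> tI; have ew : w = x + w - x by ring.
  rewrite [X in _ <= _ * X]ew.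
  apply: cint_approx => //; [exact: lcont_horiz|by rewrite lerDl|exact: hK|exact: hK|].
  move=> s sI; have := key s t sI tI; rewrite /horiz [L * (_ +i* _)%C](_ : _ =
    L * ('i%C * t%:C%C) + 2 * (L / 2) * s%:C%C); first by rewrite addrA.
  by rewrite cE; field.
have D s : x <= s <= x + w -> cabs (cint K (vert f s) y (y + h) -
    ((A + L * s%:C%C) * (y + h - y)%:C%C + L * 'i%C / 2 * ((y + h) ^+ 2 - y ^+ 2)%:C%C))
     <= 2 * (e / 4 * (w + h)) * h.
  move=> sI; have ew : h = y + h - y by ring.
  rewrite [X in _ <= _ * X]ew.
  apply: cint_approx => //; [exact: lcont_vert|by rewrite lerDl|exact: hK'|exact: hK'|].
  move=> t tI; have := key s t sI tI; rewrite /vert [L * (_ +i* _)%C](_ : _ =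
    L * s%:C%C + 2 * (L * 'i%C / 2) * t%:C%C); first by rewrite addrA.
  by rewrite cE; field.
have i1 : cabs ('i%C : C) = 1 by rewrite /cabs /= expr0n expr1n add0r sqrtr1.
have B1 := B _ ym; have B2 := B _ yM; have D1 := D _ xM; have D2 := D _ xm.
move: B1 B2 D1 D2; rewrite /contour.
set b1 := cint _ _ _ _; set b2 := cint _ _ _ _; set d1 := cint _ _ _ _; set d2 := cint _ _ _ _.
set m1 := (X in b1 - X); set m2 := (X in b2 - X); set n1 := (X in d1 - X); set n2 := (X in d2 - X).
move=> B1 B2 D1 D2.
have -> : b1 + 'i%C * d1 - b2 - 'i%C * d2 = (b1 - m1) + 'i%C * (d1 - n1) - (b2 - m2) - 'i%C * (d2 - n2).
  by rewrite /m1 /m2 /n1 /n2 !(rmorphB, rmorphD) /=; field.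
apply: le_trans (cabsB _ _) _; apply: le_trans (lerD (cabsB _ _) (lexx _)) _.
apply: le_trans (lerD (lerD (cabsD _ _) (lexx _)) (lexx _)) _.
rewrite !cabsM i1 !mul1r; apply: le_trans (lerD (lerD (lerD B1 D1) B2) D2) _.
by rewrite le_eqVlt; apply/orP; left; apply/eqP; field.
Qed.

Theorem goursat f x0 y0 w0 h0 : entire f -> 0 < w0 -> 0 < h0 ->
  `|x0| < K -> `|x0 + w0| < K -> `|y0| < K -> `|y0 + h0| < K ->
  contour f x0 y0 w0 h0 = 0.
Proof.
move=> fe w00 h00 K1 K2 K3 K4; have fc := entire_cont fe.
apply/eqP; rewrite -cabs_eq0; apply/eqP/le_anti; rewrite cabs_ge0 andbT.
apply/ler_addgt0Pl => e e0; rewrite addr0.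
have wh : 0 < w0 * h0 by rewrite mulr_gt0.
(* As a multiple of the area, the bound is additive under division into quarters. *)
suff : cabs (contour f x0 y0 w0 h0) <= e / (w0 * h0) * (w0 * h0) by rewrite divfK // gt_eqF.
set k := e / (w0 * h0); have k0 : 0 < k by rewrite divr_gt0.
apply: (@rectangle_induction (fun x y w h => cabs (contour f x y w h) <= k * (w * h))).
- exact: ltW.
- exact: ltW.
- move=> x y w h w1 h1 p1 p2 p3 p4; rewrite contour_split.
  apply: le_trans (cabsD _ _) _; apply: le_trans (lerD (cabsD _ _) (cabsD _ _)) _.
  apply: le_trans (lerD (lerD p1 p2) (lerD p3 p4)) _.
  by rewrite le_eqVlt; apply/orP; left; apply/eqP; field.
move=> p q /andP [p1 p2] /andP [q1 q2].
have Kp : `|p| < K.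
  by move: K1 K2; rewrite !ltr_norml => /andP [? ?] /andP [? ?]; apply/andP; split; lra.
have Kq : `|q| < K.
  by move: K3 K4; rewrite !ltr_norml => /andP [? ?] /andP [? ?]; apply/andP; split; lra.
(* The subrectangles are similar to the original one, so the ratio of (w + h)^2 to the area is
   constant and the local bound can be converted. *)
pose S := (w0 + h0) ^+ 2; have S0 : 0 < S by rewrite exprn_gt0 // addr_gt0.
have e0' : 0 < k * (w0 * h0) / S by rewrite divr_gt0 // mulr_gt0.
have [d d0 hd] := @contour_local f (p +i* q)%C _ fc (fe _) e0' Kp Kq.
have [n hn] := half_pow_small (ltW (addr_gt0 w00 h00)) d0.
exists n => x y px qy; have n0 : 0 < 2 ^+ n :> R by rewrite exprn_gt0.
apply: le_trans (hd x y _ _ _ _ _ px qy) _.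
- by rewrite divr_ge0 // ltW.
- by rewrite divr_ge0 // ltW.
- by rewrite -mulrDl.
rewrite le_eqVlt; apply/orP; left; apply/eqP; rewrite /S; field.
by rewrite !gt_eqF // addr_gt0.
Qed.

End Goursat.

(** * Zeros of an entire function spread from a half-plane *)

Section UniqueContinuation.
Variable R : realType.
Local Notation C := R[i].
Local Notation Co := (R[i]^o).

Lemma entire_cst (c : C) : entire (fun=> c).
Proof. by move=> s; exact: (@derivable_cst Co Co Co c s 1). Qed.

Lemma entire_id : entire (fun z : C => z).
Proof. by move=> s; exact: (@derivable_id Co Co s 1). Qed.

Lemma entireM (f g : C -> C) : entire f -> entire g -> entire (fun z => f z * g z).
Proof. by move=> hf hg s; exact: (@derivableM Co Co f g s 1 (hf s) (hg s)). Qed.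

Lemma entireD (f g : C -> C) : entire f -> entire g -> entire (fun z => f z + g z).
Proof. by move=> hf hg s; exact: (@derivableD Co Co Co f g s 1 (hf s) (hg s)). Qed.

Lemma entire_poly (p : {poly C}) : entire (fun z => p.[z]).
Proof.
elim/poly_ind: p => [|p c IH].
  rewrite (_ : (fun z => _) = fun=> 0); first exact: entire_cst.
  by apply/funext => z; rewrite horner0.
rewrite (_ : (fun z => _) = fun z => p.[z] * z + c); last first.
  by apply/funext => z; rewrite hornerMXaddC.
apply: entireD; last exact: entire_cst.
exact: (@entireM (fun z => p.[z]) (fun z => z) IH entire_id).
Qed.

Lemma entire_shift (f : C -> C) (a : C) : entire f -> entire (fun z => f (z + a)).
Proof.
move=> fe s; have := fe (s + a); rewrite /derivable.
rewrite (_ : (fun h : Co => h^-1 *: (((f : Co -> Co) \o shift (s + a : Co)) (h *: 1) - f (s + a))) =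
  (fun h : Co => h^-1 *: (((fun z : Co => f (z + a)) \o shift (s : Co)) (h *: 1) - f (s + a)))) //.
by apply/funext => h /=; rewrite addrA.
Qed.

Lemma lcont_bounded (u : R -> C) a b : lcont u -> a <= b ->
  exists M, forall x, a <= x <= b -> cabs (u x) <= M.
Proof.
move=> uc ab; have cc : continuous (fun t => cabs (u t)).
  move=> x; apply/cvgrPdist_lt => e e0; have [d d0 hd] := uc x e e0.
  apply/nbhs_ballP; exists d => //= t; rewrite /ball /= distrC => /hd h.
  rewrite distrC ltr_norml ltrBlDr ltrNl opprB ltrBlDr; apply/andP; split.
    apply: le_lt_trans (_ : _ <= cabs (u t - u x) + cabs (u t)) _; last by rewrite ltrD2r.
    by have := cabsB (u t) (u t - u x); rewrite opprB addrC subrK addrC.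
  apply: le_lt_trans (_ : _ <= cabs (u t - u x) + cabs (u x)) _; last by rewrite ltrD2r.
  by have := cabsD (u t - u x) (u x); rewrite subrK.
have [c cab hc] := EVT_max ab (continuous_subspaceT cc).
by exists (cabs (u c)) => x xab; apply: hc; rewrite in_itv.
Qed.

Lemma geometric_dominated (D A c M : R) : 0 <= D -> D < A -> 0 < c -> 0 <= M ->
  exists N : nat, M * D ^+ N < c * A ^+ N.
Proof.
move=> D0 DA c0 M0; have A0 : 0 < A by apply: le_lt_trans DA.
have q1 : `|D / A| < 1 by rewrite ger0_norm ?divr_ge0 ?(ltW A0) // ltr_pdivrMr // mul1r.
have e0 : 0 < c / (M + 1) by rewrite divr_gt0 // ltr_wpDl.
have := cvg_expr q1 => /cvgrPdist_lt /(_ _ e0) [N _ hN]; exists N.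
have := hN N (leqnn N); rewrite /= sub0r normrN ger0_norm ?exprn_ge0 ?divr_ge0 ?(ltW A0) //.
rewrite ltr_pdivlMr ?ltr_wpDl // expr_div_n mulrAC ltr_pdivrMr ?exprn_gt0 //.
by apply: le_lt_trans; rewrite mulrC ler_wpM2l ?exprn_ge0 // lerDl.
Qed.

Definition kern (N : nat) : {poly C} := (1 + 'X^2) ^+ N.

Lemma kernE N z : (kern N).[z] = (1 + z ^+ 2) ^+ N.
Proof. by rewrite /kern horner_exp hornerD hornerXn hornerC. Qed.

Lemma cabs_i : cabs ('i%C : C) = 1.
Proof. by rewrite /cabs /= expr0n expr1n add0r sqrtr1. Qed.

(** Since s^2 = -1, the base is t (t + 2s), of modulus at most (1/4)(1/4 + 2) = 9/16. *)
Lemma kern_edge (N : nat) (t a : R) (s : C) : a <= 4^-1 -> 0 <= t <= a ->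
  s = 'i%C \/ s = - 'i%C -> cabs ((kern N).[t%:C%C + s]) <= (9 / 16) ^+ N.
Proof.
move=> a4 /andP [t0 ta] hs; have r0 : 0 <= 9 / 16 :> R by rewrite divr_ge0.
rewrite kernE cabsX lerXn2r ?nnegrE ?cabs_ge0 //.
have -> : 1 + (t%:C%C + s) ^+ 2 = t%:C%C * (t%:C%C + 2 * s).
  have s2 : s ^+ 2 = -1 by case: hs => ->; rewrite ?sqrrN sqr_i.
  by rewrite sqrrD s2; ring.
have cs : cabs s = 1 by case: hs => ->; rewrite ?cabsN cabs_i.
rewrite cabsM cabs_real (ger0_norm t0).
have := cabsD (t%:C%C) (2 * s); rewrite cabsM cs cabs_nat cabs_real (ger0_norm t0).
nra.
Qed.

(** The segment |t| <= d/2, of length d, yields the main term; for d/2 <= |t| <= d the integrand is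
    nonnegative; beyond that it is at least -M (1 - d^2)^N on a total length below 2. *)
Lemma kernel_integral_ge (phi u : R -> R) (d e M : R) (N : nat) :
  0 < d -> d <= 1 -> 0 <= e -> 0 <= M -> continuous u ->
  (forall t, u t = phi t * (1 - t ^+ 2) ^+ N) ->
  (forall t, -1 <= t <= 1 -> `|phi t| <= M) ->
  (forall t, - d <= t <= d -> e <= phi t) ->
  e * d * (1 - (d / 2) ^+ 2) ^+ N - 2 * (M * (1 - d ^+ 2) ^+ N) <= rint 2 u (-1) 1.
Proof.
move=> d0 d1 e0 M0 uc uE phiM phie.
set A := 1 - (d / 2) ^+ 2; set B := 1 - d ^+ 2.
have d2 : d ^+ 2 <= 1 by rewrite expr_le1 // ltW.
have dd : (d / 2) ^+ 2 <= d ^+ 2.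
  by rewrite lerXn2r ?nnegrE ?divr_ge0 ?(ltW d0) //; lra.
have B0 : 0 <= B by rewrite subr_ge0.
have A0 : 0 <= A by rewrite subr_ge0 (le_trans dd).
have t2 (t x : R) : 0 <= x -> (- x <= t <= x) = (t ^+ 2 <= x ^+ 2).
  by move=> x0; rewrite -ler_norml -[RHS]ler_sqrt ?exprn_ge0 // !sqrtr_sqr (ger0_norm x0).
have pN (t : R) : -1 <= t <= 1 -> 0 <= 1 - t ^+ 2.
  by have := t2 t 1 ler01; rewrite expr1n => ->; rewrite subr_ge0.
have Kt (t : R) : -1 <= t <= 1 -> `|t| < 2.
  by move=> /andP [? ?]; rewrite ltr_norml; apply/andP; split; lra.
have out t : -1 <= t <= 1 -> d ^+ 2 <= t ^+ 2 -> - (M * B ^+ N) <= u t.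
  move=> tI dt; have p0 := pN t tI.
  have pB : (1 - t ^+ 2) ^+ N <= B ^+ N by rewrite lerXn2r ?nnegrE // lerD2l lerN2.
  rewrite uE; have := phiM t tI; rewrite ler_norml => /andP [h _].
  apply: le_trans (_ : - M * (1 - t ^+ 2) ^+ N <= _); last by rewrite ler_wpM2r ?exprn_ge0.
  by rewrite mulNr lerN2 ler_wpM2l.
have mid t : - d <= t <= d -> 0 <= u t.
  move=> td; rewrite uE mulr_ge0 //; first by apply: le_trans (phie t td).
  by apply/exprn_ge0/pN; move: td => /andP [? ?]; apply/andP; split; lra.
have inn t : - (d / 2) <= t <= d / 2 -> e * A ^+ N <= u t.
  move=> td; have dt : - d <= t <= d by move: td => /andP [? ?]; apply/andP; split; lra.
  rewrite uE; apply: ler_pM => //; [by rewrite exprn_ge0|exact: phie|].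
  have td' : t ^+ 2 <= (d / 2) ^+ 2 by rewrite -t2 // divr_ge0 // ltW.
  by rewrite lerXn2r ?nnegrE // ?subr_ge0 ?(le_trans td') ?(le_trans dd) // lerD2l lerN2.
have chas p q s : rint 2 u p s = rint 2 u p q + rint 2 u q s by rewrite /rint; ring.
have dh : 0 < d / 2 by rewrite divr_gt0.
have dhd : d / 2 < d by lra.
have K1 : `|1| < 2 :> R by apply: Kt; apply/andP; split; lra.
have KN1 : `|-1| < 2 :> R by rewrite normrN.
have Kd : `|d| < 2 by apply: Kt; apply/andP; split; lra.
have KNd : `|- d| < 2 by rewrite normrN.
have Kdh : `|d / 2| < 2 by apply: Kt; apply/andP; split; lra.
have KNdh : `|- (d / 2)| < 2 by rewrite normrN.
have o1 : -1 <= - d by lra.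
have o2 : - d <= - (d / 2) by lra.
have o3 : - (d / 2) <= d / 2 by lra.
have g1 : - (M * B ^+ N) * (- d - (-1)) <= rint 2 u (-1) (- d).
  apply: (rint_ge uc o1 KN1 KNd) => t /andP [? ?].
  apply: out; first by apply/andP; split; lra.
  by rewrite -[t ^+ 2]sqrrN lerXn2r ?nnegrE ?(ltW d0) //; lra.
have g2 : 0 * (- (d / 2) - (- d)) <= rint 2 u (- d) (- (d / 2)).
  apply: (rint_ge uc o2 KNd KNdh) => t /andP [? ?].
  by apply: mid; apply/andP; split; lra.
have g3 : e * A ^+ N * (d / 2 - (- (d / 2))) <= rint 2 u (- (d / 2)) (d / 2).
  exact: (rint_ge uc o3 KNdh Kdh).
have g4 : 0 * (d - d / 2) <= rint 2 u (d / 2) d.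
  apply: (rint_ge uc (ltW dhd) Kdh Kd) => t /andP [? ?].
  by apply: mid; apply/andP; split; lra.
have g5 : - (M * B ^+ N) * (1 - d) <= rint 2 u d 1.
  apply: (rint_ge uc d1 Kd K1) => t /andP [? ?].
  apply: out; first by apply/andP; split; lra.
  by rewrite lerXn2r ?nnegrE ?(ltW d0) //; lra.
rewrite (chas (-1) (- d)) (chas (- d) (- (d / 2))) (chas (- (d / 2)) (d / 2)) (chas (d / 2) d).
have MB0 : 0 <= M * B ^+ N by rewrite mulr_ge0 ?exprn_ge0.
have MBd : M * B ^+ N * d >= 0 by rewrite mulr_ge0 // ltW.
have e3 : e * A ^+ N * (d / 2 - (- (d / 2))) = e * d * A ^+ N by field.
rewrite e3 in g3; lra.
Qed.

(* The kernel (1 + z^2)^N concentrates at 0 on the imaginary segment, while it is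
   exponentially small on the horizontal edges. *)
Lemma entire_zero_center (g : C -> C) (a : R) : entire g -> 0 < a -> a <= 4^-1 ->
  (forall z, a <= cRe z -> g z = 0) -> g 0 = 0.
Proof.
move=> ge a0 a4 gz; apply/eqP; apply/contraT => g0.
(* Multiplying by the conjugate of g(0) makes the value at 0 positive, so that real parts can be
   compared. *)
pose f z := (g 0)^* * g z.
have fe : entire f by exact: (entireM (@entire_cst (g 0)^*) ge).
have fc := entire_cont fe.
have fz z : a <= cRe z -> f z = 0 by move=> /gz e; rewrite /f e mulr0.
have f0 : 0 < cRe (f 0).
  rewrite /f mulrC; have -> : g 0 * (g 0)^* = ((cabs (g 0)) ^+ 2)%:C%C.
    by rewrite rmorphXn /= -cabsE normCK.
  by rewrite /= exprn_gt0 // cabs_gt0.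
have N11 : -1 <= 1 :> R by lra.
have [M1 hM1] := lcont_bounded (lcont_vert 0 fc) N11.
have [M2 hM2] := lcont_bounded (lcont_horiz (-1) fc) (ltW a0).
have [M3 hM3] := lcont_bounded (lcont_horiz 1 fc) (ltW a0).
pose M := `|M1| + `|M2| + `|M3|.
have M0 : 0 <= M by rewrite !addr_ge0.
have [n1 n2] := (ler_norm M1, ler_norm M2); have n3 := ler_norm M3.
have [n1' n2'] := (normr_ge0 M1, normr_ge0 M2); have n3' := normr_ge0 M3.
have L1 t : -1 <= t <= 1 -> cabs (f (0 +i* t)%C) <= M.
  by move=> /hM1; rewrite /vert => h; apply: le_trans h _; rewrite /M; lra.
have L2 t : 0 <= t <= a -> cabs (f (t +i* (-1))%C) <= M.
  by move=> /hM2; rewrite /horiz => h; apply: le_trans h _; rewrite /M; lra.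
have L3 t : 0 <= t <= a -> cabs (f (t +i* 1)%C) <= M.
  by move=> /hM3; rewrite /horiz => h; apply: le_trans h _; rewrite /M; lra.
have [d [d0 d1 hd]] : exists d, [/\ 0 < d, d <= 1 &
    forall t, -d <= t <= d -> cRe (f 0) / 2 <= cRe (f (0 +i* t)%C)].
  have e0 : 0 < cRe (f 0) / 2 by rewrite divr_gt0.
  have [d d0 hd] := lcont_vert 0 fc 0 e0.
  exists (Num.min 1 (d / 2)); split; first by rewrite lt_min ltr01 divr_gt0.
    by rewrite ge_min lexx.
  move=> t /andP [t1 t2]; have td : `|t - 0| < d.
    have : Num.min 1 (d / 2) <= d / 2 by rewrite ge_min lexx orbT.
    by move: t1 t2; set m := Num.min _ _; move=> *; rewrite subr0 ltr_norml; apply/andP; split; lra.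
  have := le_lt_trans (Re_le_cabs _) (hd t td); rewrite /vert cReB ltr_norml => /andP [h _].
  by have -> : f 0 = f (0 +i* 0)%C by []; lra.
set e := cRe (f 0) / 2 in hd; have e0 : 0 < e by rewrite divr_gt0.
pose A := 1 - (d / 2) ^+ 2; pose B := 1 - d ^+ 2; pose r : R := 9 / 16.
(* The worse of the two error rates, that of the outer part of the segment and that of the
   horizontal edges. Both are below A, as d <= 1 gives A >= 3/4 > 9/16. *)
pose D := Num.max B r.
have d2 : d ^+ 2 <= 1 by rewrite expr_le1 // ltW.
have d2' : 0 < d ^+ 2 by rewrite exprn_gt0.
have B0 : 0 <= B by rewrite subr_ge0.
have D0 : 0 <= D by rewrite le_max B0.
have DA : D < A.
  by rewrite gt_max /A /B /r expr_div_n; apply/andP; split; lra.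
(* Twice M D^N for the outer parts of the segment and once for the edges make the factor 3. *)
have [N hN] := geometric_dominated D0 DA (mulr_gt0 e0 d0) (mulr_ge0 (ler0n R 3) M0).
pose F z := f z * (kern N).[z].
have Fe : entire F by exact: (entireM fe (@entire_poly (kern N))).
have Fc := entire_cont Fe.
have K0 : 0 < 2 :> R by [].
have K00 : `|0 : R| < 2 by rewrite normr0.
have K1 : `|1 : R| < 2 by rewrite normr1; lra.
have KN1 : `|-1 : R| < 2 by rewrite normrN.
have Ka : `|a| < 2 by rewrite gtr0_norm //; lra.
have E1 : -1 + 2 = 1 :> R by lra.
(* On the rectangle [0, a] x [-1, 1] the function F vanishes on the right edge, so the integral over
   the left edge equals, up to a factor i, the difference of the two horizontal ones. *)
have : contour 2 F 0 (-1) a 2 = 0 by apply: goursat => //; rewrite ?add0r ?E1.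
rewrite /contour add0r E1.
set b1 := cint _ _ _ _; set c1 := cint _ _ _ _; set b2 := cint _ _ _ _; set c2 := cint _ _ _ _ => G.
have r0 : 0 <= r by rewrite /r; lra.
have hb1 : cabs b1 <= 2 * (M * r ^+ N) * a.
  rewrite -[X in _ * X]subr0; apply: (cint_bound (lcont_horiz _ Fc) (ltW a0) K00 Ka) => t ta.
  rewrite /horiz /F cabsM ler_pM ?cabs_ge0 //; first exact: L2.
  have -> : (t +i* (-1))%C = t%:C%C + (- 'i%C) :> C by apply: cplx_ext; rewrite ?(cReD, cImD) /=; ring.
  by apply: (kern_edge _ a4) => //; right.
have hb2 : cabs b2 <= 2 * (M * r ^+ N) * a.
  rewrite -[X in _ * X]subr0; apply: (cint_bound (lcont_horiz _ Fc) (ltW a0) K00 Ka) => t ta.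
  rewrite /horiz /F cabsM ler_pM ?cabs_ge0 //; first exact: L3.
  have -> : (t +i* 1)%C = t%:C%C + 'i%C :> C by apply: cplx_ext; rewrite ?(cReD, cImD) /=; ring.
  by apply: (kern_edge _ a4) => //; left.
have hc1 : c1 = 0.
  apply/eqP; rewrite -cabs_eq0; apply/eqP/le_anti; rewrite cabs_ge0 andbT.
  have -> : 0 = 2 * 0 * (1 - (-1)) :> R by rewrite mulr0 mul0r.
  apply: (cint_bound (lcont_vert _ Fc) N11 KN1 K1) => t _.
  by rewrite /vert /F fz ?mul0r ?cabs0 //=.
have hc2 : cabs c2 <= M * r ^+ N.
  have -> : cabs c2 = cabs (b1 - b2).
    move: G; rewrite hc1 mulr0 addr0 => /eqP; rewrite subr_eq0 => /eqP ->.
    by rewrite cabsM cabs_i mul1r.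
  apply: le_trans (cabsB _ _) _; apply: le_trans (lerD hb1 hb2) _.
  have := mulr_ge0 M0 (exprn_ge0 N r0); nra.
have rr : 0 <= r ^+ N by rewrite exprn_ge0.
pose u t := cRe (vert F 0 t).
have uc : continuous u by apply: lcont_Re; exact: lcont_vert.
have uE t : u t = cRe (f (0 +i* t)%C) * (1 - t ^+ 2) ^+ N.
  rewrite /u /vert /F kernE; have -> : 1 + (0 +i* t)%C ^+ 2 = (1 - t ^+ 2)%:C%C :> C.
    by apply: cplx_ext; rewrite /= ; ring.
  by rewrite -rmorphXn mulrC cReMr mulrC.
have up : rint 2 u (-1) 1 <= M * r ^+ N.
  apply: le_trans hc2; apply: le_trans (Re_le_cabs _); exact: ler_norm.
have low := @kernel_integral_ge (fun t => cRe (f (0 +i* t)%C)) u d e M N d0 d1 (ltW e0) M0 uc uE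
  (fun t tI => le_trans (Re_le_cabs _) (L1 t tI)) hd.
have BD : M * B ^+ N <= M * D ^+ N.
  by rewrite ler_wpM2l // lerXn2r ?nnegrE // le_max lexx.
have rD : M * r ^+ N <= M * D ^+ N.
  by rewrite ler_wpM2l // lerXn2r ?nnegrE // le_max lexx orbT.
rewrite -/A -/B in low; lra.
Qed.

(** The gain of 1/4 per step does not depend on the function or on the abscissa, so finitely many
    steps reach any point. *)
Theorem entire_zero (f : C -> C) : entire f -> (forall z, 1 < cRe z -> f z = 0) ->
  forall z, f z = 0.
Proof.
move=> fe f1.
have step (c : R) : (forall z, c <= cRe z -> f z = 0) ->
    forall z, c - 4^-1 <= cRe z -> f z = 0.
  move=> fz z zc; have [/fz //|lt] := leP c (cRe z).
  have := @entire_zero_center (fun w => f (w + z)) (c - cRe z) (@entire_shift f z fe).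
  rewrite add0r; apply; rewrite ?subr_gt0 //; first by lra.
  by move=> w wc; apply: fz; rewrite cReD; lra.
have all (n : nat) : forall z, 2 - n%:R / 4 <= cRe z -> f z = 0.
  elim: n => [|n IH]; first by move=> z zc; apply: f1; lra.
  by move=> z zc; apply: (step _ IH); move: zc; rewrite -natr1; lra.
move=> z; apply: (all (Num.bound (4 * (2 + `|cRe z|)))).
have := @archi_boundP _ (4 * (2 + `|cRe z|)).
rewrite mulr_ge0 ?addr_ge0 // => /(_ isT); have := ler_norm (- cRe z); rewrite normrN.
lra.
Qed.

End UniqueContinuation.

(** * Absence of zeros far to the right *)

Section DirichletNonvanishing.
Variable R : realType.
Local Notation C := R[i].
Local Notation Co := (R[i]^o).

Lemma powR_add (x r t : R) : 0 < x -> x `^ (r + t) = x `^ r * x `^ t.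
Proof. by move=> x0; apply: powRD; apply/implyP => _; rewrite gt_eqF. Qed.

(** Otherwise the entire function (s - 1)^m F(s) would vanish for Re s > 1, hence everywhere,
    contrary to F(s) != 0 at some s != 1. *)
Lemma dirichlet_coef_neq0 (F : C -> C) (a : nat -> C) :
  (exists2 s, s != 1 & F s != 0) -> continuation F ->
  (forall s : C, 1 < cRe s ->
    clim (fun n => series (fun k => a k * cpow k.+1%:R (- s) : Co) n) (F s)) ->
  exists n, a n != 0.
Proof.
move=> [s s1 Fs] [m [G [Ge _ GF]]] aF; apply: contrapT => na.
have a0 n : a n = 0 by apply: contrapT => /eqP h; apply: na; exists n.
have F0 z : 1 < cRe z -> F z = 0.
  move=> z1; apply: (clim_unique (aF z z1)).
  apply: (@clim_near _ (fun=> 0)); last exact: clim_cst.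
  by exists 0 => n _; rewrite /series /= big1 // => k _; rewrite a0 mul0r.
have G0 z : 1 < cRe z -> G z = 0.
  move=> z1; rewrite -GF ?F0 ?mulr0 //.
  by apply: contraTneq z1 => ->; rewrite ltxx.
have := GF s s1; rewrite (entire_zero Ge G0) => /eqP.
rewrite mulf_eq0 (negbTE Fs) orbF expf_eq0 subr_eq0 (negbTE s1) andbF.
by [].
Qed.

(* The first nonzero coefficient dominates far to the right. *)
Lemma dirichlet_neq0 (F : C -> C) : extended_selberg F ->
  exists2 T : R, 1 <= T & forall s, T < cRe s -> F s != 0.
Proof.
move=> [F0 [a aF] Fc _].
have aF' (s : C) : 1 < cRe s ->
    clim (fun n => series (fun k => a k * cpow k.+1%:R (- s) : Co) n) (F s).
  by move=> /aF [].
have ex := dirichlet_coef_neq0 F0 Fc aF'.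
have [n0 an0 n0min] := ex_minnP ex.
have az k : (k < n0)%N -> a k = 0.
  by move=> kn; apply: contraTeq kn => /n0min; rewrite -leqNgt.
(* The absolutely convergent series at s = 2 serves as the majorant for all larger abscissas. *)
have two1 : 1 < cRe (2 : C) by rewrite cRe_nat ltr1n.
have [vc _] := aF _ two1.
set v := fun n : nat => cabs (a n * cpow n.+1%:R (- 2)) in vc.
pose B := limn (series v).
have vB n : series v n <= B.
  apply: nondecreasing_cvgn_le => // ; apply/nondecreasing_seqP => k.
  by rewrite /series /= big_nat_recr //= lerDl cabs_ge0.
have B0 : 0 <= B by have := vB 0; rewrite /series /= big_geq.
pose rho : R := n0.+2%:R / n0.+1%:R.
have p0 n : 0 < n.+1%:R :> R by rewrite ltr0n.
have rho1 : 1 < rho by rewrite ltr_pdivlMr // mul1r ltr_nat.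
have lr : 0 < ln rho by rewrite ln_gt0.
have A0 : 0 < cabs (a n0) by rewrite cabs_gt0.
pose D := B * n0.+2%:R `^ 2 / cabs (a n0).
have D0 : 0 <= D by rewrite divr_ge0 ?mulr_ge0 ?powR_ge0 // ltW.
have q0 : 0 <= D / ln rho by rewrite divr_ge0 // ltW.
(* The leading term wins as soon as rho^sg > D, and rho^sg >= 1 + sg ln rho. *)
exists (2 + D / ln rho); first by lra.
move=> s sT; set sg := cRe s in sT.
have s2 : 2 < sg by lra.
have s1 : 1 < cRe s by rewrite -/sg; lra.
pose u k := a k * cpow k.+1%:R (- s) : C.
have uE k : cabs (u k) = cabs (a k) * k.+1%:R `^ (- sg).
  by rewrite /u cabsM cabs_cpow // cReN.
have vE k : v k = cabs (a k) * k.+1%:R `^ (- 2).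
  by rewrite /v cabsM cabs_cpow // cReN cRe_nat.
pose c := n0.+2%:R `^ (2 - sg).
have c0 : 0 <= c by rewrite powR_ge0.
(* For k > n0 and sg > 2 one has (k+1)^(-sg) <= (n0+2)^(2-sg) (k+1)^(-2); the shift by one is that
   of the coefficients. *)
have tail N : (n0 < N)%N -> cabs (series u N - u n0) <= c * series v N.
  elim: N => // N IH; rewrite ltnS leq_eqVlt => /orP [/eqP <-|nN].
    rewrite {1}/series /= big_nat_recr //= big_nat big1.
      rewrite add0r subrr cabs0 mulr_ge0 // /series /= sumr_ge0 // => k _.
      exact: cabs_ge0.
    by move=> k /andP [_ /az e]; rewrite /u e mul0r.
  rewrite /series /= !big_nat_recr //= mulrDr.
  have -> : \sum_(0 <= i < N) u i + u N - u n0 = (\sum_(0 <= i < N) u i - u n0) + u N by ring.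
  apply: le_trans (cabsD _ _) _; have := IH nN; rewrite /series /= => h; apply: lerD => //.
  rewrite uE vE mulrCA ler_wpM2l ?cabs_ge0 //.
  have -> : - sg = (2 - sg) + (- 2) by ring.
  rewrite powR_add //.
  rewrite ler_wpM2r ?powR_ge0 // /c.
  have -> : 2 - sg = - (sg - 2) by ring.
  rewrite !powRN lef_pV2 ?posrE ?powR_gt0 //.
  by apply: ge0_ler_powR; rewrite ?nnegrE ?ler_nat //; lra.
have lim : cabs (F s - u n0) <= c * B.
  have : clim (fun n => series u n - u n0) (F s - u n0).
    by apply: climD; [exact: aF'|exact: clim_cst].
  apply: (@clim_le _ _ _ n0.+1) => n /tail h; apply: le_trans h _.
  by rewrite ler_wpM2l.
have key : c * B < cabs (u n0).
  rewrite uE.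
  have eD : B * n0.+2%:R `^ 2 = D * cabs (a n0) by rewrite /D divfK // gt_eqF.
  have -> : c * B = (D * cabs (a n0)) * n0.+2%:R `^ (- sg).
    by rewrite -eD /c powR_add //; ring.
  have -> : n0.+1%:R `^ (- sg) = rho `^ sg * n0.+2%:R `^ (- sg) :> R.
    have e : n0.+2%:R = rho * n0.+1%:R :> R by rewrite /rho divfK // gt_eqF.
    rewrite e powRM ?(ltW (p0 _)) ?(ltW (lt_trans _ rho1)) // mulrA -powR_add.
      by rewrite addrN powRr0 mul1r.
    exact: lt_trans rho1.
  rewrite mulrA [cabs _ * _]mulrC ltr_pM2r ?powR_gt0 // ltr_pM2r //.
  rewrite /powR gt_eqF ?(lt_trans _ rho1) //.
  apply: lt_le_trans (expR_ge1Dx _).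
  have : D / ln rho < sg by lra.
  by rewrite ltr_pdivrMr //; lra.
apply: contraTneq key => e; rewrite e sub0r cabsN in lim.
by rewrite -leNgt.
Qed.

End DirichletNonvanishing.

(** * Gamma-factors and the two formulae *)

Section ReciprocalGammaFactor.
Variable R : realType.
Local Notation C := R[i].
Implicit Types (g : gamma_data R) (s c : C).

Definition rgam g s : C := (gamma_fun g s)^-1.

Lemma rgamE g s : rgam g s =
  (cpow (gamma_Q g) s)^-1 * \prod_(p <- factors g) rGamma (p.1%:C%C * s + p.2).
Proof. by rewrite /rgam /gamma_fun invfM -prodfV. Qed.

Lemma rgam_eq0 g s : 0 < gamma_Q g -> rgam g s = 0 <-> gamma_pole g s.
Proof.
move=> Q0; rewrite rgamE; split.
  move/eqP; rewrite mulf_eq0 invr_eq0 (negbTE (cpow_neq0 _ Q0)) /= prodf_seq_eq0.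
  by move=> /hasP [p pg] /= /eqP /rGamma_eq0 h; exists p.
move=> [p pg /rGamma_eq0 h]; apply/eqP; rewrite mulf_eq0 prodf_seq_eq0 orbC.
by apply/orP; left; apply/hasP; exists p => //; rewrite h eqxx.
Qed.

Lemma contc_rgam g s : 0 < gamma_Q g -> contc (rgam g) s.
Proof.
move=> Q0; rewrite (_ : rgam g = fun s => (cpow (gamma_Q g) s)^-1 *
   \prod_(p <- factors g) rGamma (p.1%:C%C * s + p.2)); last by apply/funext => z; rewrite rgamE.
apply: contcM; first by apply: contcV; [exact: cpow_neq0|exact: contc_cpow].
apply: contc_prod => p; apply: (@contc_comp _ (@rGamma R) (fun z => p.1%:C%C * z + p.2)).
  by apply: contcD; [apply: contcM; [exact: contc_cst|exact: contc_id]|exact: contc_cst].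
exact: contc_rGamma.
Qed.

Lemma real_neq0 (x : R) : x != 0 -> (x%:C%C : C) != 0.
Proof. by move=> x0; rewrite (_ : 0 = 0%:C%C) // (inj_eq (@complexI _)). Qed.

Lemma mult_formula_ok g c g' : gamma_data_ok g -> mult_formula g c g' -> gamma_data_ok g'.
Proof.
move=> [Q0 gok] [m [lam [mu [rest [m0 pg pg' eQ _]]]]].
have mR : 0 < m%:R :> R by rewrite ltr0n.
have [lam0 mu0] : 0 < lam /\ 0 <= complex.Re mu.
  by apply: (gok (lam, mu)); rewrite (perm_mem pg) mem_head.
split; first by rewrite eQ mulr_gt0 ?powR_gt0.
move=> p; rewrite (perm_mem pg') mem_cat => /orP [/mapP [k _ ->] /=|pr].
  split; first by rewrite divr_gt0.
  have -> : (mu + k%:R) / m%:R = (m%:R^-1)%:C%C * (mu + k%:R) :> C.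
    by rewrite mulrC fmorphV /= realnat.
  by rewrite cReMr cReD cRe_nat mulr_ge0 ?invr_ge0 ?addr_ge0 // ltW.
by apply: gok; rewrite (perm_mem pg) inE pr orbT.
Qed.

Lemma mult_formula_rgam g c g' : gamma_data_ok g -> mult_formula g c g' ->
  c != 0 /\ exists2 A : R, 0 < A & forall s, rgam g' s = (A%:C%C * c) * rgam g s.
Proof.
move=> [Q0 gok] [m [lam [mu [rest [m0 pg pg' eQ ->]]]]].
have mR : 0 < m%:R :> R by rewrite ltr0n.
set b : R := _ `^ _.
have b0 : 0 < b by rewrite powR_gt0 // mulr_gt0 // pi_gt0.
split; first by rewrite mulf_neq0 ?cpow_neq0 // real_neq0 // gt_eqF.
(* The limit formula gives m^(lam s + mu), while [c] is m^(mu - 1/2) times b; the positive factor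
   makes up for m^(1/2) / b, and m^(lam s) goes into the new Q. *)
have [A A0 hA] := rGamma_mult R m0.
exists (A * (m%:R `^ 2^-1 / b)); first by rewrite mulr_gt0 // divr_gt0 // powR_gt0.
move=> s; rewrite !rgamE (perm_big _ pg) (perm_big _ pg') /= big_cat big_cons big_map /=.
have -> : iota 0 m = index_iota 0 m by rewrite /index_iota subn0.
rewrite big_mkord eQ cpowM ?powR_gt0 // cpow_powR //.
have -> : \prod_(k < m) rGamma ((lam / m%:R)%:C%C * s + (mu + k%:R) / m%:R) =
    A%:C%C * (cpow m%:R (lam%:C%C * s + mu) * rGamma (lam%:C%C * s + mu)).
  rewrite -hA; apply: eq_bigr => k _; congr rGamma.
  by rewrite fmorph_div /= realnat; field; exact: natr_neq0C.
have half : (2^-1 : C) = (2^-1 : R)%:C%C by rewrite fmorphV /= realnat.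
have -> : cpow m%:R (lam%:C%C * s + mu) =
    cpow m%:R (lam%:C%C * s) * (cpow m%:R (mu - 2^-1) * (m%:R `^ 2^-1)%:C%C).
  by rewrite -cpow_real // -half -!cpowD // subrK.
rewrite !rmorphM /= fmorphV /=.
have b1 : (b%:C%C : C) != 0 by rewrite real_neq0 // gt_eqF.
have c1 := cpow_neq0 (lam%:C%C * s) mR.
have c2 := cpow_neq0 s Q0.
move: (\prod_(_ <- _) _) (rGamma _) b1 c1 c2 => P G.
move: (cpow m%:R (_ * _)) (cpow (gamma_Q g) s) (cpow m%:R (mu - _)) => x y z.
move: (b%:C%C) (m%:R `^ 2^-1)%:C%C => bb mm b1 x1 y1; field.
by rewrite b1 x1 y1.
Qed.

Lemma fact_formula_ok Rf g Rf' g' : gamma_data_ok g -> fact_formula Rf g Rf' g' ->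
  gamma_data_ok g'.
Proof.
move=> [Q0 gok] [lam [mu [rest [pg pg' eQ _]]]].
split; first by rewrite eQ.
have [lam0 mu0] : 0 < lam /\ 0 <= complex.Re mu.
  by apply: (gok (lam, mu)); rewrite (perm_mem pg) mem_head.
move=> p; rewrite (perm_mem pg') inE => /orP [/eqP -> /=|pr].
  by rewrite cReD addr_ge0.
by apply: gok; rewrite (perm_mem pg) inE pr orbT.
Qed.

Definition lin_poly (lam : R) (mu : C) : {poly C} := lam%:C%C *: 'X + mu%:P.

Lemma horner_lin lam mu s : (lin_poly lam mu).[s] = lam%:C%C * s + mu.
Proof. by rewrite /lin_poly hornerD hornerZ hornerX hornerC. Qed.

Lemma lead_coef_lin lam mu : lam != 0 -> lead_coef (lin_poly lam mu) = lam%:C%C.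
Proof.
move=> l0; rewrite /lin_poly lead_coefDl ?lead_coefZ ?lead_coefX ?mulr1 //.
rewrite size_scale ?real_neq0 // size_polyX.
by apply: leq_ltn_trans (size_polyC_leq1 _) _.
Qed.

Lemma lin_poly_neq0 lam mu : lam != 0 -> lin_poly lam mu != 0.
Proof. by move=> l0; rewrite -lead_coef_eq0 lead_coef_lin // real_neq0. Qed.

Lemma fact_formula_rgam Rf g Rf' g' : gamma_data_ok g -> fact_formula Rf g Rf' g' ->
  exists lam mu, [/\ 0 < lam, 0 <= complex.Re mu, Rf' = Rf / tofrac (lin_poly lam mu) &
    forall s, rgam g s = (lin_poly lam mu).[s] * rgam g' s].
Proof.
move=> [Q0 gok] [lam [mu [rest [pg pg' eQ ->]]]].
have [lam0 mu0] : 0 < lam /\ 0 <= complex.Re mu.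
  by apply: (gok (lam, mu)); rewrite (perm_mem pg) mem_head.
exists lam, mu; split => // s.
rewrite !rgamE (perm_big _ pg) (perm_big _ pg') /= !big_cons /= eQ horner_lin.
by rewrite rGammaS addrA; ring.
Qed.

Lemma poly_nonroot (B : {poly C}) (f : nat -> C) : B != 0 -> injective f ->
  exists k, B.[f k] != 0.
Proof.
move=> B0 fi; apply: contrapT => h.
have := @max_poly_roots _ B [seq f k | k <- iota 0 (size B)] B0.
rewrite size_map size_iota ltnn map_inj_uniq ?iota_uniq // => /(_ _ isT) H.
suff : false by [].
apply: H; apply/allP => _ /mapP [k _ ->]; rewrite rootE.
by apply: contrapT => /negP hk; apply: h; exists k.
Qed.

Lemma inv_seq_inj (s : C) (d : R) : 0 < d -> injective (fun k : nat => s + (d / k.+2%:R)%:C%C).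
Proof.
move=> d0 k l /addrI /complexI /(mulfI (lt0r_neq0 d0)) /invr_inj /eqP.
by rewrite eqr_nat => /eqP [].
Qed.

Lemma inv_seq_near (s : C) (d : R) k : 0 < d -> cabs (s + (d / k.+2%:R)%:C%C - s) < d.
Proof.
move=> d0; rewrite addrC addKr cabs_real ger0_norm ?divr_ge0 ?(ltW d0) //.
by rewrite ltr_pdivrMr // ltr_pMr // ltr1n.
Qed.

(** B has finitely many roots, so f - h vanishes at points arbitrarily close to any s, and
    continuity settles the roots of B. *)
Lemma poly_cancel (B : {poly C}) (f h : C -> C) : B != 0 ->
  (forall s, contc f s) -> (forall s, contc h s) ->
  (forall s, B.[s] * f s = B.[s] * h s) -> forall s, f s = h s.
Proof.
move=> B0 fc hc e s; apply/eqP; rewrite -subr_eq0; apply/eqP.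
apply: (@contc_eq0 _ (fun z => f z + - h z)).
  by apply: contcD => //; exact: contcN.
move=> d d0; have [k hk] := poly_nonroot B0 (@inv_seq_inj s d d0).
exists (s + (d / k.+2%:R)%:C%C); first exact: inv_seq_near.
by apply/eqP; rewrite subr_eq0; apply/eqP/(mulfI hk).
Qed.

(* How R gamma and the root number are related along a chain of applications of the
   two formulae starting from a gamma_0: up to the polynomials A, B, the quotient
   of the gamma-factors is the constant c.  The leading coefficients stay real, so
   that cancelling A against B does not affect the quotient of c^* by c. *)
Definition linked (a : C) (d0 : fe_data R) (Rf : ratfun R) (d : fe_data R) :=
  exists (c : C) (A B : {poly C}),
    [/\ c != 0, B != 0 /\ A != 0,
        (lead_coef A)^* = lead_coef A /\ (lead_coef B)^* = lead_coef B,
        Rf * tofrac B = tofrac a%:P * tofrac A /\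
        root_number d = root_number d0 * c^* / c &
        forall s, c * A.[s] * rgam (gfactor d0) s = B.[s] * rgam (gfactor d) s].

Lemma conj_neq0 c : c != 0 -> c^* != 0.
Proof. by move=> c0; rewrite conjC_eq0. Qed.

Lemma linked_refl a d : linked a d (tofrac a%:P) d.
Proof.
exists 1, 1, 1; split.
- exact: oner_neq0.
- by rewrite oner_neq0.
- by rewrite lead_coef1 rmorph1.
- by rewrite tofrac1 !mulr1 rmorph1 divr1 mulr1.
- by move=> s; rewrite hornerC !mul1r.
Qed.

(** An equivalence, since the sets of candidate values of the extension have to coincide on both
    sides of a formula. *)
Lemma linked_mult a d0 Rf omega c g g' : gamma_data_ok g -> mult_formula g c g' ->
  linked a d0 Rf (FeData omega g) <-> linked a d0 Rf (FeData (omega * c^* / c) g').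
Proof.
move=> gok /(mult_formula_rgam gok) [c0 [r r0 hr]].
have rC : (r%:C%C : C) != 0 by rewrite real_neq0 // gt_eqF.
have cb := conj_neq0 c0.
split=> -[e [A [B [e0 AB lAB [eR ew] h]]]] /=; have eb := conj_neq0 e0.
  exists (r%:C%C * c * e), A, B; split => //; first by rewrite !mulf_neq0.
    split => //=; rewrite /= in ew; rewrite ew !rmorphM /= conj_real; field.
    by rewrite rC c0 e0.
  by move=> s; rewrite /= hr -!mulrA [RHS]mulrCA [B.[s] * (c * _)]mulrCA -h /=; ring.
exists (e / (r%:C%C * c)), A, B; split => //; first by rewrite !mulf_neq0 ?invr_neq0 ?mulf_neq0.
  split => //=; rewrite /= in ew; rewrite fmorph_div rmorphM /= conj_real.
  have -> : omega = (omega * c^* / c) * c / c^* by field; rewrite c0 cb.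
  by rewrite ew; field; rewrite rC c0 e0 cb.
move=> s /=; have := h s; rewrite /= hr => hs.
have rc0 : r%:C%C * c != 0 by rewrite mulf_neq0.
by apply: (mulfI rc0); rewrite [RHS]mulrCA -hs; field; rewrite rC c0.
Qed.

Lemma linked_fact a d0 Rf Rf' omega g g' : gamma_data_ok g -> fact_formula Rf g Rf' g' ->
  linked a d0 Rf (FeData omega g) <-> linked a d0 Rf' (FeData omega g').
Proof.
move=> gok /(fact_formula_rgam gok) [lam [mu [lam0 mu0 -> hr]]].
set l := lin_poly lam mu in hr *.
have l0 : l != 0 by rewrite lin_poly_neq0 // gt_eqF.
have lr : (lead_coef l)^* = lead_coef l by rewrite lead_coef_lin ?gt_eqF // conj_real.
have tl : tofrac l != 0 by rewrite tofrac_eq0.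
split=> -[e [A [B [e0 [B0 A0] [lA lB] [eR ew] h]]]].
  exists e, A, (B * l); split => //.
  - by rewrite mulf_neq0.
  - by rewrite lead_coefM rmorphM /= lB lr.
  - split; last exact: ew.
    by rewrite tofracM [tofrac B * _]mulrC mulrA divfK.
  by move=> s; rewrite h /= hr hornerM mulrA.
exists e, (A * l), B; split => //.
- by rewrite mulf_neq0.
- by rewrite lead_coefM rmorphM /= lA lr.
- split; last exact: ew.
  by rewrite tofracM mulrA -eR mulrAC divfK.
move=> s; rewrite /= hr hornerM; have /= := h s => hs.
by rewrite [RHS]mulrCA -hs; ring.
Qed.

(** For constant R the polynomials satisfy bB = aA. Their leading coefficients being real, b/a is
    real, so absorbing it into c leaves conj c / c unchanged. *)
Lemma linked_const a b d0 d : a != 0 -> b != 0 ->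
  gamma_data_ok (gfactor d0) -> gamma_data_ok (gfactor d) ->
  linked a d0 (tofrac b%:P) d ->
  exists c : C, [/\ c != 0, root_number d = root_number d0 * c^* / c &
    forall s, rgam (gfactor d) s = c * rgam (gfactor d0) s].
Proof.
move=> a0 b0 [Q0 _] [Q1 _] [c [A [B [c0 [B0 A0] [lA lB] [eR ew] h]]]].
have {}eR : b%:P * B = a%:P * A.
  by apply/eqP; rewrite -(tofrac_eq) !tofracM eR.
have eA : A = (b / a) *: B.
  by rewrite mulrC -scalerA -(mul_polyC b) eR mul_polyC scalerA mulVf // scale1r.
have r0 : b / a != 0 by rewrite mulf_neq0 ?invr_neq0.
have lB0 : lead_coef B != 0 by rewrite lead_coef_eq0.
have rr : (b / a)^* = b / a.
  move: lA; rewrite eA lead_coefZ rmorphM /= lB; exact: (mulIf lB0).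
move: r0 rr eA; set r := b / a => r0 rr eA.
exists (c * r); split; first by rewrite mulf_neq0.
  rewrite ew rmorphM /= rr; field.
  by rewrite c0 r0.
apply: (@poly_cancel B) => // [s|s|s]; first exact: contc_rgam.
  by apply: contcM; [exact: contc_cst|exact: contc_rgam].
by rewrite -h eA hornerZ; ring.
Qed.

(** Dividing gamma by c divides its conjugate reflection by conj c, which the new root number
    compensates; the excluded poles stay the same. *)
Lemma satisfies_fe_scaled F d0 d c : c != 0 -> fe_data_ok d ->
  root_number d = root_number d0 * c^* / c ->
  (forall s, rgam (gfactor d) s = c * rgam (gfactor d0) s) ->
  satisfies_fe F d0 -> satisfies_fe F d.
Proof.
move=> c0 dok ew h [[_ [Q0 _]] fe]; split => // s s0 s1 p1 p2.
have [_ [Q1 _]] := dok.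
have pole z : gamma_pole (gfactor d) z <-> gamma_pole (gfactor d0) z.
  rewrite -!rgam_eq0 // h; split=> [/eqP|->]; last by rewrite mulr0.
  by rewrite mulf_eq0 (negbTE c0) => /eqP.
have gE z : gamma_fun (gfactor d) z = c^-1 * gamma_fun (gfactor d0) z.
  by rewrite -[LHS]invrK -/(rgam _ z) h invfM /rgam invrK.
have := fe s s0 s1; rewrite -!pole => /(_ p1 p2) e.
rewrite gE -[LHS]mulrA e ew /fbar gE.
have -> (z : C) : (c^-1 * z)^* = (c^*)^-1 * z^* by rewrite rmorphM /= fmorphV.
move: (gamma_fun _ _)^* (F _)^* => x y.
by field; rewrite c0 conj_neq0.
Qed.

Theorem invariant_extension (I : selberg_data R -> C) : is_invariant I ->
  exists Istar : ratfun R -> fe_data R -> C,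
    [/\ rational_extension I Istar, mult_stable Istar & fact_stable Istar].
Proof.
move=> Iinv.
(* Candidate values at (Rf, d), where d need not be the data of any functional equation. [xget]
   takes equal values on equal sets, which is all that stability asks; that the candidates agree is
   shown below for constant Rf and d in the domain of I. *)
pose V Rf d := [set v | exists a (d0 : selberg_data R),
  [/\ a != 0, linked a (sval d0) Rf d & v = I d0]].
have Veq Rf d Rf' d' : (forall a d0, linked a d0 Rf d <-> linked a d0 Rf' d') ->
    V Rf d = V Rf' d'.
  move=> h; apply/seteqP; split=> v [a [d0 [a0 l ->]]]; exists a, d0; split => //;
  exact/h.
exists (fun Rf d => xget 0 (V Rf d)); split.
- move=> a d a0; have VI : V (tofrac a%:P) (sval d) (I d).
    by exists a, d; split => //; exact: linked_refl.
  case: (xgetPex 0 (ex_intro _ _ VI)) => b [d0 [b0 l ->]].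
  (* A function F belonging to d0 also satisfies the equation with data d, so invariance applies to
     F. *)
  have [F FS fe0] := svalP d0; have [F' _ [dok' _]] := svalP d.
  have [[_ ok0] _] := fe0; have [_ ok1] := dok'.
  have [c [c0 ew hr]] := linked_const b0 a0 ok0 ok1 l.
  by apply: (Iinv F) => //; exact: satisfies_fe_scaled c0 dok' ew hr fe0.
- move=> Rf omega c g g' _ [_ ok] mf; congr xget; apply: Veq => a d0.
  exact: linked_mult.
- move=> Rf Rf' omega g g' _ [_ ok] ff; congr xget; apply: Veq => a d0.
  exact: linked_fact.
Qed.

End ReciprocalGammaFactor.

(** * Chains of applications of the two formulae *)

Section Transformations.
Variable R : realType.
Local Notation C := R[i].
Implicit Types (g : gamma_data R) (s c : C).

(* [reach g c P g'] : finitely many applications of the two formulae, read from left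
   to right, rewrite [R gamma_g] as [(R / P) c gamma_g']. *)
Inductive reach g : C -> {poly C} -> gamma_data R -> Prop :=
| reach_refl : reach g 1 1 g
| reach_mult c P g1 c1 g2 : reach g c P g1 -> mult_formula g1 c1 g2 ->
    reach g (c * c1) P g2
| reach_fact c P g1 lam mu rest g2 : reach g c P g1 ->
    perm_eq (factors g1) ((lam, mu) :: rest) ->
    perm_eq (factors g2) ((lam, mu + 1) :: rest) -> gamma_Q g2 = gamma_Q g1 ->
    reach g c (P * lin_poly lam mu) g2.

Lemma reach_trans g c P g1 c' P' g2 : reach g c P g1 -> reach g1 c' P' g2 ->
  reach g (c * c') (P * P') g2.
Proof.
move=> h; elim=> [|c2 P2 g3 c3 g4 _ IH m|c2 P2 g3 lam mu rest g4 _ IH p1 p2 q].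
- by rewrite !mulr1.
- by rewrite mulrA; apply: reach_mult IH m.
- by rewrite mulrA; apply: reach_fact IH p1 p2 q.
Qed.

Lemma fact_formulaI (Rf : ratfun R) g1 g2 lam mu rest :
  perm_eq (factors g1) ((lam, mu) :: rest) ->
  perm_eq (factors g2) ((lam, mu + 1) :: rest) -> gamma_Q g2 = gamma_Q g1 ->
  fact_formula Rf g1 (Rf / tofrac (lin_poly lam mu)) g2.
Proof. by move=> p1 p2 q; exists lam, mu, rest. Qed.

Lemma reach_ok g c P g' : gamma_data_ok g -> reach g c P g' -> gamma_data_ok g'.
Proof.
move=> gok; elim=> [//|c1 P1 g1 c2 g2 _ IH m|c1 P1 g1 lam mu rest g2 _ IH p1 p2 q].
  exact: mult_formula_ok IH m.
exact: fact_formula_ok IH (fact_formulaI 1 p1 p2 q).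
Qed.

Lemma reach_rgam g c P g' : gamma_data_ok g -> reach g c P g' ->
  c != 0 /\ exists2 A : R, 0 < A & forall s, P.[s] * rgam g' s = A%:C%C * c * rgam g s.
Proof.
move=> gok h; elim: h => [|c1 P1 g1 c2 g2 h [c10 [A A0 hA]] m|
    c1 P1 g1 lam mu rest g2 h [c10 [A A0 hA]] p1 p2 q].
- by split; [exact: oner_neq0|exists 1 => // s; rewrite hornerC !mul1r].
- have [c20 [B B0 hB]] := mult_formula_rgam (reach_ok gok h) m.
  split; first by rewrite mulf_neq0.
  exists (A * B); first by rewrite mulr_gt0.
  by move=> s; rewrite hB rmorphM /= mulrCA hA; ring.
split => //; exists A => // s.
have [_ gok1] := reach_ok gok h.
rewrite -hA hornerM -mulrA; congr (_ * _).
rewrite !rgamE (perm_big _ p1) (perm_big _ p2) /= !big_cons /= q horner_lin.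
by rewrite [in RHS]rGammaS addrA; ring.
Qed.

(** Every form lambda s + mu met along the chain has lambda > 0 and Re mu >= 0, so it has a positive
    leading coefficient and no zero with positive real part. *)
Lemma reach_poly g c P g' : gamma_data_ok g -> reach g c P g' ->
  (exists2 r : R, 0 < r & lead_coef P = r%:C%C) /\
  (forall z, root P z -> cRe z <= 0).
Proof.
move=> gok h; elim: h => [|c1 P1 g1 c2 g2 h IH m|
    c1 P1 g1 lam mu rest g2 h [[r r0 er] rt] p1 p2 q] //.
  split; first by exists 1; rewrite ?lead_coef1.
  by move=> z; rewrite rootE hornerC oner_eq0.
have [lam0 mu0] : 0 < lam /\ 0 <= complex.Re mu.
  by apply: ((reach_ok gok h).2 (lam, mu)); rewrite (perm_mem p1) mem_head.
split.
  exists (r * lam); first by rewrite mulr_gt0.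
  by rewrite lead_coefM er lead_coef_lin ?gt_eqF // rmorphM.
move=> z; rewrite rootM => /orP [/rt //|]; rewrite rootE horner_lin => /eqP e.
have : cRe (lam%:C%C * z + mu) = 0 by rewrite e.
rewrite cReD cReMr => h0; rewrite leNgt; apply/negP => z0.
by have := mulr_gt0 lam0 z0; lra.
Qed.

Lemma frac_neq0 (Rf : ratfun R) (P : {poly C}) : Rf != 0 -> P != 0 ->
  Rf / tofrac P != 0.
Proof.
by move=> Rf0 P0; apply: mulf_neq0; [exact: Rf0|rewrite invr_eq0 tofrac_eq0; exact: P0].
Qed.

Lemma unit_conj c : c != 0 -> cabs (c^* / c) = 1.
Proof. by move=> c0; rewrite cabsM cabsV cabs_conj mulfV // cabs_eq0. Qed.

Lemma reach_stable Istar (Rf : ratfun R) omega g c P g' :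
  mult_stable Istar -> fact_stable Istar -> Rf != 0 -> cabs omega = 1 ->
  gamma_data_ok g -> reach g c P g' ->
  Istar Rf (FeData omega g) = Istar (Rf / tofrac P) (FeData (omega * c^* / c) g').
Proof.
move=> ms fs Rf0 w1 gok h; elim: h => [|c1 P1 g1 c2 g2 h IH m|
    c1 P1 g1 lam mu rest g2 h IH p1 p2 q].
- by rewrite tofrac1 !divr1 rmorph1 mulr1.
- have [c10 _] := reach_rgam gok h.
  have [c20 _] := mult_formula_rgam (reach_ok gok h) m.
  have [[r r0 er] _] := reach_poly gok h.
  have P0 : P1 != 0 by rewrite -lead_coef_eq0 er real_neq0 // gt_eqF.
  have RP0 : Rf / tofrac P1 != 0 by exact: frac_neq0.
  rewrite IH (ms _ _ _ _ _ RP0 _ m).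
    by rewrite rmorphM; congr (Istar _ (FeData _ _)); field; rewrite c10 c20.
  split; last exact: reach_ok gok h.
  by rewrite /= -mulrA cabsM w1 unit_conj // mulr1.
have [c10 _] := reach_rgam gok h.
have [[r r0 er] _] := reach_poly gok h.
have P0 : P1 != 0 by rewrite -lead_coef_eq0 er real_neq0 // gt_eqF.
have RP0 : Rf / tofrac P1 != 0 by exact: frac_neq0.
rewrite IH (fs _ _ _ _ _ RP0 _ (fact_formulaI _ p1 p2 q)).
  by rewrite tofracM invfM mulrA.
split; last exact: reach_ok gok h.
by rewrite /= -mulrA cabsM w1 unit_conj // mulr1.
Qed.

(** Reordering the factors is an instance of the multiplication formula with m = 1, for which c = 1;
    an empty list leaves nothing to reorder. *)
Lemma perm_data_stable Istar (Rf : ratfun R) omega g g' :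
  mult_stable Istar -> Rf != 0 -> fe_data_ok (FeData omega g) ->
  perm_eq (factors g) (factors g') -> gamma_Q g = gamma_Q g' ->
  Istar Rf (FeData omega g) = Istar Rf (FeData omega g').
Proof.
move=> ms Rf0 dok pgg eQ.
case E : (factors g) => [|[lam mu] rest].
  have E' : factors g' = [::].
    by apply/eqP; rewrite -size_eq0 -(perm_size pgg) E.
  by move: E E' eQ; case: (g) (g') => Q l [Q' l'] /= -> -> ->.
have mf : mult_formula g 1 g'.
  exists 1%N, lam, mu, rest; split => //.
  - by rewrite E.
  - by rewrite /= addr0 !divr1 -E perm_sym.
  - by rewrite powR1 mulr1.
  - by rewrite cpow1 subrr mul0r powRr0 mulr1.
by rewrite (ms _ _ _ _ _ Rf0 dok mf) rmorph1 mulr1 divr1.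
Qed.

Lemma reach_shift g c P g1 lam mu rest (j : nat) : reach g c P g1 ->
  perm_eq (factors g1) ((lam, mu) :: rest) ->
  exists P' g2, reach g c P' g2 /\ perm_eq (factors g2) ((lam, mu + j%:R) :: rest).
Proof.
move=> h p1; elim: j => [|j [P' [g2 [h2 p2]]]].
  by exists P, g1; rewrite addr0.
exists (P' * lin_poly lam (mu + j%:R)), (GammaData (gamma_Q g2) ((lam, mu + j.+1%:R) :: rest)).
split => //=; apply: reach_fact h2 p2 _ _ => //=.
by rewrite -addrA natr1.
Qed.

End Transformations.

(** * Making commensurable lambdas equal *)

Section Refinement.
Variable R : realType.
Local Notation C := R[i].
Implicit Types (g : gamma_data R) (s c : C).

Definition commensurable (x y : R) : Prop :=
  exists a b : nat, [/\ (0 < a)%N, (0 < b)%N & a%:R * x = b%:R * y].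

Lemma comm_refl x : commensurable x x.
Proof. by exists 1%N, 1%N. Qed.
Lemma comm_sym x y : commensurable x y -> commensurable y x.
Proof. by move=> [a [b [a0 b0 e]]]; exists b, a. Qed.
Lemma comm_trans x y z : commensurable x y -> commensurable y z -> commensurable x z.
Proof.
move=> [a [b [a0 b0 e]]] [a' [b' [a0' b0' e']]]; exists (a * a')%N, (b * b')%N.
rewrite !muln_gt0 a0 a0' b0 b0'; split => //.
by rewrite !natrM mulrAC e mulrAC -mulrA e' mulrA.
Qed.

(** Every x in S is a rational multiple of the representative rho of its class. With a common
    denominator D, taking m(x) = x D / rho gives x / m(x) = rho / D, which depends on the class
    only. *)
Lemma common_refinement (S : seq R) : (forall x, x \in S -> 0 < x) ->
  exists m : R -> nat, (forall x, x \in S -> (0 < m x)%N) /\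
    (forall x y, x \in S -> y \in S -> commensurable x y -> x / (m x)%:R = y / (m y)%:R).
Proof.
move=> S0.
(* Commensurable numbers have the same class as a set, hence the same chosen representative; the
   class contains x, so the default 1 does not intervene. *)
pose rho x : R := xget 1 [set y | commensurable y x].
have rhoC x : commensurable (rho x) x.
  have h : exists y, [set y | commensurable y x] y by exists x; exact: comm_refl.
  exact: (xgetPex 1 h).
have rhoE x y : commensurable x y -> rho x = rho y.
  move=> xy; congr xget; apply/seteqP; split=> z /= h.
    exact: comm_trans xy.
  exact: comm_trans (comm_sym xy).
have [D [D0 hD]] : exists D : nat, (0 < D)%N /\ forall x, x \in S ->
    exists n : nat, (0 < n)%N /\ x * D%:R = n%:R * rho x.
  elim: S {S0} => [|y S [D [D0 IH]]]; first by exists 1%N.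
  have [a [b [a0 b0 e]]] := rhoC y.
  exists (D * b)%N; rewrite muln_gt0 D0 b0; split => // x.
  rewrite inE => /orP [/eqP ->|/IH [n [n0 en]]].
    exists (D * a)%N; rewrite muln_gt0 D0 a0; split => //.
    by rewrite !natrM -[RHS]mulrA e mulrCA [y * _]mulrC.
  exists (n * b)%N; rewrite muln_gt0 n0 b0; split => //.
  by rewrite !natrM mulrA en mulrAC.
pose m x : nat := xget 0%N [set n : nat | (0 < n)%N /\ x * D%:R = n%:R * rho x].
have mP x : x \in S -> (0 < m x)%N /\ x * D%:R = (m x)%:R * rho x.
  by move=> /hD h; exact: (xgetPex 0%N h).
exists m; split; first by move=> x /mP [].
have DR : (D%:R : R) != 0 by rewrite pnatr_eq0 -lt0n.
have key x : x \in S -> x / (m x)%:R = rho x / D%:R.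
  move=> /mP [m0 e]; have mR : ((m x)%:R : R) != 0 by rewrite pnatr_eq0 -lt0n.
  by apply: (mulIf DR); rewrite divfK // mulrAC e mulrAC mulfV // mul1r.
by move=> x y xS yS /rhoE e; rewrite !key // e.
Qed.

Definition refined (m : R -> nat) (p : R * C) : seq (R * C) :=
  [seq (p.1 / (m p.1)%:R, (p.2 + k%:R) / (m p.1)%:R) | k <- iota 0 (m p.1)].

Lemma reach_refined (m : R -> nat) g : (forall p, p \in factors g -> (0 < m p.1)%N) ->
  exists c g', reach g c 1 g' /\
    factors g' = flatten [seq refined m p | p <- factors g].
Proof.
move=> m0.
(* [don] holds the factors already refined. The equality required for empty [l] fixes their order,
   which [perm_eq] alone would lose. *)
suff H l : forall don g1 c1, {subset l <= factors g} -> reach g c1 1 g1 ->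
    perm_eq (factors g1) (don ++ l) -> (l = [::] -> factors g1 = don) ->
    exists c g', reach g c 1 g' /\ factors g' = don ++ flatten [seq refined m p | p <- l].
  case E : (factors g) => [|p l].
    by exists 1, g; rewrite E; split => //; exact: reach_refl.
  rewrite -E; apply: (H _ [::] g 1) => //; first exact: reach_refl.
elim: l => [|[lam mu] l IH] don g1 c1 sub h p e.
  by exists c1, g1; rewrite e // cats0.
have lm : (0 < m lam)%N by apply: (m0 (lam, mu)); apply: sub; rewrite mem_head.
pose g2 := GammaData (gamma_Q g1 * (m lam)%:R `^ lam) ((don ++ refined m (lam, mu)) ++ l).
have mf : mult_formula g1 (cpow (m lam)%:R (mu - 2^-1) *
              ((2 * pi) `^ ((1 - (m lam)%:R) / 2))%:C%C) g2.
  exists (m lam), lam, mu, (don ++ l); split => //.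
    by apply: perm_trans p _; rewrite -cat_cons -cat1s perm_catCA.
  by rewrite /= -catA perm_catCA.
have sub2 : {subset l <= factors g} by move=> q ql; apply: sub; rewrite inE ql orbT.
have e2 : l = [::] -> factors g2 = don ++ refined m (lam, mu).
  by move=> l0; rewrite /g2 /= l0 cats0.
have [c [g' [h' e']]] := IH _ g2 _ sub2 (reach_mult h mf) (perm_refl _) e2.
by exists c, g'; split => //; rewrite e' -catA.
Qed.

Lemma commensurable_div x y (a b : nat) : (0 < a)%N -> (0 < b)%N ->
  commensurable (x / a%:R) (y / b%:R) -> commensurable x y.
Proof.
move=> a0 b0 [p [q [p0 q0 e]]]; exists (p * b)%N, (q * a)%N.
rewrite !muln_gt0 a0 b0 p0 q0; split => //.
have aR : (a%:R : R) != 0 by rewrite pnatr_eq0 -lt0n.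
have bR : (b%:R : R) != 0 by rewrite pnatr_eq0 -lt0n.
have -> : (p * b)%:R * x = (p%:R * (x / a%:R)) * (a%:R * b%:R) by rewrite natrM; field.
by rewrite e natrM; field.
Qed.

End Refinement.

(** * Pairing off the progressions of poles *)

Section Matching.
Variable R : realType.
Local Notation C := R[i].
Implicit Types (g : gamma_data R) (s c w : C) (p q : R * C) (l : seq (R * C)).

Definition has_pole p w : bool := `[< exists k : nat, p.1%:C%C * w + p.2 = - k%:R >].

(** Each Gamma has simple poles, so this is the order of the pole of the gamma-factor at w;
    [rgam_local] proves it for the zero of E. *)
Definition pole_count l w : nat := count (has_pole ^~ w) l.

Lemma has_poleP p w : reflect (exists k : nat, p.1%:C%C * w + p.2 = - k%:R) (has_pole p w).
Proof. exact: asboolP. Qed.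

Definition pole_at p (k : nat) : C := - (p.2 + k%:R) / p.1%:C%C.

Lemma pole_atE p k : 0 < p.1 -> p.1%:C%C * pole_at p k + p.2 = - k%:R.
Proof.
move=> p0; rewrite /pole_at mulrCA mulfV ?mulr1 ?real_neq0 ?gt_eqF //.
by rewrite opprD addrAC addNr add0r.
Qed.

Lemma pole_at_far p (T : R) : 0 < p.1 -> exists K, forall k, (K <= k)%N ->
  cRe (pole_at p k) < - T.
Proof.
move=> p0; exists (Num.bound (`|T * p.1| + `|cRe p.2|)) => k hk.
have : `|T * p.1| + `|cRe p.2| < k%:R.
  by apply: lt_le_trans (archi_boundP _) _; rewrite ?addr_ge0 ?ler_nat.
have -> : pole_at p k = (p.1^-1)%:C%C * (- (p.2 + k%:R)).
  by rewrite /pole_at mulrC fmorphV.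
move=> hk1; rewrite cReMr cReN cReD cRe_nat [ltLHS]mulrC ltr_pdivrMr //.
have := ler_norm (T * p.1); have := ler_norm (- cRe p.2); rewrite normrN; lra.
Qed.

(** Equal steps and offsets differing by an integer: the two progressions coincide far to the
    left. *)
Definition same_class p q := p.1 = q.1 /\
  ((exists j : nat, q.2 = p.2 + j%:R) \/ (exists j : nat, p.2 = q.2 + j%:R)).

(* Progressions of poles with incommensurable steps have at most one common point. *)
Lemma pole_same_class p l : 0 < p.1 ->
  (forall q, q \in l -> 0 < q.1 /\ (p.1 = q.1 \/ ~ commensurable p.1 q.1)) ->
  exists K, forall k, (K <= k)%N -> forall q, q \in l -> has_pole q (pole_at p k) ->
    same_class p q.
Proof.
move=> p0; elim: l => [|q l IH] hl; first by exists 0%N.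
have [K hK] : exists K, forall k, (K <= k)%N -> forall q, q \in l ->
    has_pole q (pole_at p k) -> same_class p q.
  by apply: IH => r rl; apply: hl; rewrite inE rl orbT.
suff [K' hK'] : exists K', forall k, (K' <= k)%N -> has_pole q (pole_at p k) -> same_class p q.
  exists (maxn K K') => k; rewrite geq_max => /andP [k1 k2] r.
  by rewrite inE => /orP [/eqP ->|rl]; [exact: hK'|exact: hK].
have [q0 [e|nc]] := hl q (mem_head _ _).
  exists 0%N => k _ /has_poleP [j]; rewrite -e => ej; split => //.
  have := pole_atE k p0 => ek.
  have ed : q.2 = p.2 + k%:R - j%:R.
    have : q.2 - p.2 = - j%:R + k%:R by rewrite -ej -[k%:R]opprK -ek; ring.
    by move=> /eqP; rewrite subr_eq => /eqP ->; ring.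
  have [jk|/ltnW kj] := leqP j k.
    by left; exists (k - j)%N; rewrite ed natrB // addrA.
  by right; exists (j - k)%N; rewrite ed natrB //; ring.
(* Let d be the difference of two common poles. Then p.1 d and q.1 d are positive integers, which
   makes p.1 and q.1 commensurable. *)
have uniq_pole k k' : (k < k')%N -> has_pole q (pole_at p k) -> has_pole q (pole_at p k') -> False.
  move=> kk' /has_poleP [j ej] /has_poleP [j' ej']; apply: nc.
  have e1 := pole_atE k p0; have e2 := pole_atE k' p0.
  pose d := pole_at p k - pole_at p k'.
  have d1 : p.1%:C%C * d = (k' - k)%:R.
    by rewrite natrB ?(ltnW kk') // -[k'%:R]opprK -e2 -[k%:R in RHS]opprK -e1 /d; ring.
  have d2 : q.1%:C%C * d = j'%:R - j%:R.
    by rewrite -[j'%:R]opprK -ej' -[j%:R in RHS]opprK -ej /d; ring.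
  have r1 : p.1 * cRe d = (k' - k)%:R by rewrite -cReMr d1 cRe_nat.
  have r2 : q.1 * cRe d = j'%:R - j%:R by rewrite -cReMr d2 cReB !cRe_nat.
  have kk0 : 0 < (k' - k)%:R :> R by rewrite ltr0n subn_gt0.
  have dd0 : 0 < cRe d by rewrite -(pmulr_rgt0 _ p0) r1.
  have jj : (j < j')%N by rewrite -(ltr_nat R) -subr_gt0 -r2 mulr_gt0.
  exists (j' - j)%N, (k' - k)%N; rewrite !subn_gt0 jj kk'; split => //.
  by rewrite -r1 (natrB _ (ltnW jj)) -r2; ring.
have [[k0 h0]|h] := pselect (exists k, has_pole q (pole_at p k)).
  by exists k0.+1 => k kk h; case: (uniq_pole _ _ kk h0 h).
by exists 0%N => k _ hk; case: h; exists k.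
Qed.

(** Raising mu by j removes only the first j poles of the progression, all of which lie to the right
    of some abscissa. *)
Lemma has_pole_shift p (j : nat) : 0 < p.1 -> exists T : R, forall w, cRe w < - T ->
  has_pole (p.1, p.2 + j%:R) w = has_pole p w.
Proof.
move=> p0; exists ((j%:R + `|cRe p.2|) / p.1) => w wT.
apply/has_poleP/has_poleP => -[k] /= e.
  exists (k + j)%N; rewrite natrD opprD -e; ring.
have jk : (j <= k)%N.
  rewrite -(ler_nat R); have : cRe (p.1%:C%C * w + p.2) = - k%:R by rewrite e cReN cRe_nat.
  rewrite cReD cReMr => h.
  have : p.1 * cRe w < - (j%:R + `|cRe p.2|).
    by rewrite mulrC -ltr_pdivlMr // mulNr.
  have := ler_norm (cRe p.2); lra.
by exists (k - j)%N; rewrite natrB // opprB addrA e addrC.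
Qed.

Definition eventually_eq_poles l1 l2 := exists T : R, forall w, cRe w < - T ->
  pole_count l1 w = pole_count l2 w.

Lemma eventually_eq_poles_sym l1 l2 : eventually_eq_poles l1 l2 -> eventually_eq_poles l2 l1.
Proof. by move=> [T h]; exists T => w /h ->. Qed.

Lemma eventually_eq_poles_rem p q l1 l2 : 0 < p.1 -> q \in l2 -> same_class p q ->
  eventually_eq_poles (p :: l1) l2 -> eventually_eq_poles l1 (rem q l2).
Proof.
move=> p0 ql [epq cls] [T h].
have [T' h'] : exists T', forall w, cRe w < - T' -> has_pole q w = has_pole p w.
  case: q epq cls {ql} => q1 q2 /= <- [[j ->]|[j ej]].
    have [T' hT'] := has_pole_shift j p0; exists T' => w /hT'.
    by case: (p).
  have [T' hT'] := @has_pole_shift (p.1, q2) j p0; exists T' => w /hT' /= <-.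
  by rewrite -ej; case: (p).
exists (Num.max T T') => w wT.
have w1 : cRe w < - T.
  by apply: lt_le_trans wT _; rewrite lerN2 le_max lexx.
have w2 : cRe w < - T'.
  by apply: lt_le_trans wT _; rewrite lerN2 le_max lexx orbT.
have := h w w1; rewrite /pole_count /= (permP (perm_to_rem ql)) /= (h' w w2).
by move/addnI.
Qed.

Definition separated l1 l2 := (forall p, p \in l1 -> 0 < p.1) /\ (forall q, q \in l2 -> 0 < q.1) /\
  (forall p q, p \in l1 -> q \in l2 -> p.1 = q.1 \/ ~ commensurable p.1 q.1).

(** A pole of p far to the left must be a pole of some q in l2, and so far out in the progression
    this puts q in the class of p. *)
Lemma find_same_class p l1 l2 : separated (p :: l1) l2 ->
  eventually_eq_poles (p :: l1) l2 -> exists2 q, q \in l2 & same_class p q.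
Proof.
move=> [pos1 [pos2 sep]] [T hT].
have p0 := pos1 p (mem_head _ _).
have [K hK] : exists K, forall k, (K <= k)%N -> forall q, q \in l2 ->
    has_pole q (pole_at p k) -> same_class p q.
  apply: pole_same_class => // q ql; split; first exact: pos2.
  by apply: sep => //; rewrite mem_head.
have [K' hK'] := pole_at_far T p0.
have := hT _ (hK' _ (leq_maxr K K')); rewrite /pole_count /=.
have -> : has_pole p (pole_at p (maxn K K')).
  by apply/has_poleP; exists (maxn K K'); rewrite pole_atE.
move=> e; have : has (has_pole ^~ (pole_at p (maxn K K'))) l2 by rewrite has_count -e.
move=> /hasP [q ql hq]; exists q => //.
exact: (hK _ (leq_maxl K K')).
Qed.

(** [don] collects the factors already made equal. Since chains are read from left to right, mu can
    only be raised, so in each pair the factor with the smaller mu is moved, on whichever side it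
    stands. *)
Lemma match_factors l1 : forall l2 don g1 g2 c1 c2 P1 P2 h1 h2,
  separated l1 l2 -> eventually_eq_poles l1 l2 ->
  reach g1 c1 P1 h1 -> reach g2 c2 P2 h2 ->
  perm_eq (factors h1) (l1 ++ don) -> perm_eq (factors h2) (l2 ++ don) ->
  exists P1' P2' h1' h2', [/\ reach g1 c1 P1' h1', reach g2 c2 P2' h2' &
    perm_eq (factors h1') (factors h2')].
Proof.
elim: l1 => [|p l1 IH] l2 don g1 g2 c1 c2 P1 P2 h1 h2 sep ev r1 r2 p1 p2.
  case: l2 sep ev p2 => [|q l2] sep ev p2.
    exists P1, P2, h1, h2; split => //.
    by apply: perm_trans p1 _; rewrite perm_sym.
  have [pos1 [pos2 _]] := sep.
  (* With the roles exchanged, a leftover q would need a partner in the empty list. *)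
  have sep' : separated (q :: l2) [::] by split => //.
  by have [] := find_same_class sep' (eventually_eq_poles_sym ev).
have [q ql cl] := find_same_class sep ev.
have [pos1 [pos2 sp]] := sep.
have p0 := pos1 p (mem_head _ _).
have ev' := eventually_eq_poles_rem p0 ql cl ev.
have sep' : separated l1 (rem q l2).
  split; first by move=> r rl; apply: pos1; rewrite inE rl orbT.
  split; first by move=> r /mem_rem; exact: pos2.
  by move=> r t rl /mem_rem tl; apply: sp => //; rewrite inE rl orbT.
have p2' : perm_eq (factors h2) (q :: (rem q l2 ++ don)).
  by apply: perm_trans p2 _; rewrite -cat_cons perm_cat2r perm_to_rem.
have mid (r : R * C) (l : seq (R * C)) : perm_eq (r :: (l ++ don)) (l ++ r :: don).
  by rewrite -(cat1s r don) perm_sym perm_catCA.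
case: cl => e1 [[j e2]|[j e2]].
  case: p p1 {p0 ev sep pos1 sp} e1 e2 => lam mu p1 /= e1 e2.
  have [P1' [h1' [r1' p1']]] := reach_shift j r1 p1.
  have qE : (lam, mu + j%:R) = q by case: (q) e1 e2 => ? ? /= -> ->.
  rewrite qE in p1'.
  by apply: (IH (rem q l2) (q :: don) _ _ _ _ _ _ _ _ sep' ev' r1' r2);
    apply: perm_trans (mid _ _).
case: q p2' {ev ql} sep' ev' pos2 e1 e2 mid => lam mu p2' sep' ev' pos2 /= e1 e2 mid.
have [P2' [h2' [r2' p2'']]] := reach_shift j r2 p2'.
have pE : (lam, mu + j%:R) = p by case: (p) e1 e2 => ? ? /= -> ->.
rewrite pE in p2''.
by apply: (IH _ (p :: don) _ _ _ _ _ _ _ _ sep' ev' r1 r2');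
  apply: perm_trans (mid _ _).
Qed.

End Matching.

(** * Comparison of two functional equations *)

Section Multiplicities.
Variable R : realType.
Local Notation C := R[i].
Implicit Types (g : gamma_data R) (s c w : C) (p q : R * C) (l : seq (R * C)).

Lemma rGamma_iter s n : rGamma s = (\prod_(i < n) (s + i%:R)) * rGamma (s + n%:R).
Proof.
elim: n => [|n IH]; first by rewrite big_ord0 mul1r addr0.
by rewrite big_ord_recr /= IH rGammaS -addrA natr1 mulrA.
Qed.

(** If w0 is the pole with index k, applying the recurrence k + 1 times produces the factor lambda
    (w - w0) once; the cofactor is nonzero at w0 because 1/Gamma(1) is. The boolean in the exponent
    counts as 0 or 1. *)
Lemma rGamma_factor_local p w0 : 0 < p.1 -> exists U : C -> C,
  [/\ contc U w0, U w0 != 0 &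
   forall w, rGamma (p.1%:C%C * w + p.2) = (w - w0) ^+ has_pole p w0 * U w].
Proof.
move=> p0; have lc w : contc (fun w : C => p.1%:C%C * w + p.2) w.
  by apply: contcD; [apply: contcM; [exact: contc_cst|exact: contc_id]|exact: contc_cst].
have [/has_poleP [k ek]|np] := boolP (has_pole p w0); last first.
  exists (fun w => rGamma (p.1%:C%C * w + p.2)); split.
  - exact: (contc_comp (lc w0) (contc_rGamma _)).
  - by apply/eqP => /rGamma_eq0 h; move/has_poleP: np; apply.
  - by move=> w; rewrite expr0 mul1r.
exists (fun w => p.1%:C%C * \prod_(i < k) ((p.1%:C%C * w + p.2) + i%:R) *
  rGamma ((p.1%:C%C * w + p.2) + k.+1%:R)); split.
- apply: contcM; first apply: contcM; first exact: contc_cst.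
    by apply: contc_prod => i; apply: contcD; [exact: lc|exact: contc_cst].
  apply: (@contc_comp _ (@rGamma R) (fun w => (p.1%:C%C * w + p.2) + k.+1%:R)).
    by apply: contcD; [exact: lc|exact: contc_cst].
  exact: contc_rGamma.
- rewrite ek; apply: mulf_neq0; first apply: mulf_neq0; first by rewrite real_neq0 // gt_eqF.
    apply/prodf_neq0 => i _; rewrite addrC subr_eq0 eqr_nat.
    by rewrite neq_ltn ltn_ord.
  rewrite -natr1 addKr; have [r r0 er] := rGamma_pos (ltr01 : 0 < 1 :> R).
  by rewrite (_ : 1 = 1%:C%C) // er real_neq0 // gt_eqF.
move=> w; rewrite (rGamma_iter _ k.+1) big_ord_recr /= expr1.
have -> : p.1%:C%C * w + p.2 + k%:R = p.1%:C%C * (w - w0).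
  by rewrite -[k%:R]opprK -ek; ring.
by ring.
Qed.

Lemma rgam_local g w0 : gamma_data_ok g -> exists U : C -> C,
  [/\ contc U w0, U w0 != 0 &
   forall w, rgam g w = (w - w0) ^+ pole_count (factors g) w0 * U w].
Proof.
move=> [Q0 gok].
have [U [Uc U0 hU]] : exists U : C -> C, [/\ contc U w0, U w0 != 0 &
   forall w, \prod_(p <- factors g) rGamma (p.1%:C%C * w + p.2) =
     (w - w0) ^+ pole_count (factors g) w0 * U w].
  elim: (factors g) gok => [|p l IH] gok.
    exists (fun=> 1); split; [exact: contc_cst|exact: oner_neq0|].
    by move=> w; rewrite big_nil mulr1.
  have [|U [Uc U0 hU]] := IH; first by move=> q ql; apply: gok; rewrite inE ql orbT.
  have [p0 _] := gok p (mem_head _ _).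
  have [V [Vc V0 hV]] := rGamma_factor_local w0 p0.
  exists (fun w => V w * U w); split; [exact: contcM|exact: mulf_neq0|].
  by move=> w; rewrite big_cons hU hV /pole_count /= exprD; ring.
exists (fun w => (cpow (gamma_Q g) w)^-1 * U w); split.
- apply: contcM Uc; apply: contcV; [exact: cpow_neq0|exact: contc_cpow].
- by rewrite mulf_neq0 // invr_neq0 // cpow_neq0.
by move=> w; rewrite rgamE hU mulrCA.
Qed.

Lemma cabs_shift (w0 : C) (d : R) : 0 <= d -> cabs (w0 + d%:C%C - w0) = d.
Proof. by move=> d0; rewrite addrC addKr cabs_real ger0_norm. Qed.

(** If n1 < n2, cancelling |w - w0|^n1 leaves a left side bounded away from 0 and a right side
    tending to 0. Moduli suffice, and they accommodate the antiholomorphic factors B1 and B2. *)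
Lemma order_le (U1 U2 B1 B2 : C -> C) (w0 : C) (n1 n2 : nat) (d : R) :
  contc U1 w0 -> contc U2 w0 -> contc B1 w0 -> contc B2 w0 -> U1 w0 != 0 -> B1 w0 != 0 ->
  0 < d -> (forall w, w != w0 -> cabs (w - w0) < d ->
    cabs ((w - w0) ^+ n1 * U1 w * B1 w) = cabs ((w - w0) ^+ n2 * U2 w * B2 w)) ->
  (n2 <= n1)%N.
Proof.
move=> c1 c2 b1 b2 u10 b10 d0 h; rewrite leqNgt; apply/negP => n12.
pose f w := U1 w * B1 w; pose k w := (w - w0) ^+ (n2 - n1) * (U2 w * B2 w).
have fc : contc f w0 by exact: contcM.
have kc : contc k w0.
  apply: contcM; last exact: contcM.
  rewrite (_ : (fun z => _) = fun z => (('X - w0%:P) ^+ (n2 - n1)).[z]); first exact: contc_poly.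
  by apply/funext => z; rewrite horner_exp hornerXsubC.
have f0 : 0 < cabs (f w0) / 2 by rewrite divr_gt0 // cabs_gt0 mulf_neq0.
have k0 : k w0 = 0 by rewrite /k subrr expr0n subn_eq0 leqNgt n12 mul0r.
have [d1 d10 h1] := (contcP _ _).1 fc _ f0.
have [d2 d20 h2] := (contcP _ _).1 kc _ f0.
pose m := Num.min d (Num.min d1 d2).
have m0 : 0 < m by rewrite !lt_min d0 d10 d20.
have md : m <= d by rewrite /m ge_min lexx.
have md1 : m <= d1 by rewrite /m !ge_min lexx /= orbT.
have md2 : m <= d2 by rewrite /m !ge_min lexx !orbT.
have mm : m / 2 < m by lra.
pose w := w0 + (m / 2)%:C%C.
have m20 : 0 <= m / 2 by lra.
have cw : cabs (w - w0) = m / 2 by exact: cabs_shift.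
have ww : w != w0 by rewrite -subr_eq0 -cabs_eq0 cw; lra.
have wn : cabs ((w - w0) ^+ n1) != 0 by rewrite cabs_eq0 expf_neq0 // subr_eq0.
have e : cabs (f w) = cabs (k w).
  apply: (mulfI wn); rewrite -!cabsM /f /k mulrA [RHS](_ : _ =
    cabs ((w - w0) ^+ n2 * U2 w * B2 w)).
    by apply: h ww _; rewrite cw; exact: lt_le_trans md.
  by rewrite -[in RHS](subnK (ltnW n12)) exprD; congr cabs; ring.
have := h2 w; rewrite cw k0 subr0 => /(_ (lt_le_trans mm md2)).
have := h1 w; rewrite cw => /(_ (lt_le_trans mm md1)).
rewrite -e => a1 a2.
have := cabsD (f w) (f w0 - f w); rewrite addrC subrK cabsBC; lra.
Qed.

(** Both equations are taken at s = 1 - conj w, where F(s) != 0 and the gamma-factors have no pole;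
    then F(w) != 0 as well, and F can be eliminated. *)
Lemma fe_reflected (F : C -> C) (d1 d2 : fe_data R) (T : R) : 1 <= T ->
  (forall s, T < cRe s -> F s != 0) -> satisfies_fe F d1 -> satisfies_fe F d2 ->
  forall w, cRe w < 1 - T -> rgam (gfactor d1) w != 0 -> rgam (gfactor d2) w != 0 ->
  root_number d2 * (rgam (gfactor d1) w)^* * rgam (gfactor d2) (1 - w^*) =
  root_number d1 * (rgam (gfactor d2) w)^* * rgam (gfactor d1) (1 - w^*).
Proof.
move=> T1 FT fe1 fe2 w wT e1 e2.
pose s := 1 - w^*; have sw : (1 - s)^* = w by rewrite /s opprB addrC subrK conjCK.
have sT : T < cRe s by rewrite /s cReB cRe_conj /=; lra.
have s0 : s != 0 by apply: contraTneq sT => ->; rewrite -leNgt /=; lra.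
have s1 : s != 1 by apply: contraTneq sT => ->; rewrite -leNgt /=; lra.
have main d : satisfies_fe F d -> rgam (gfactor d) w != 0 ->
   rgam (gfactor d) s != 0 /\
   F s * (rgam (gfactor d) w)^* = root_number d * rgam (gfactor d) s * (F w)^*.
  move=> [[_ [Q0 ok]] fe] ew.
  have np : ~ gamma_pole (gfactor d) s.
    move=> [p /ok [p0 pr] [k /(congr1 (@complex.Re R))]].
    rewrite cReD cReMr cReN cRe_nat => e.
    have : 0 < p.1 * cRe s by rewrite mulr_gt0 //; lra.
    by have := ler0n R k; lra.
  have es : rgam (gfactor d) s != 0 by apply/eqP => /(rgam_eq0 _ Q0).
  have nw : ~ gamma_pole (gfactor d) (1 - s)^*.
    by rewrite sw => /(rgam_eq0 _ Q0) e; rewrite e eqxx in ew.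
  split => //; have := fe s s0 s1 np nw; rewrite /fbar sw.
  have -> : gamma_fun (gfactor d) s = (rgam (gfactor d) s)^-1 by rewrite /rgam invrK.
  have -> : gamma_fun (gfactor d) w = (rgam (gfactor d) w)^-1 by rewrite /rgam invrK.
  rewrite fmorphV /= => h.
  have ewc : (rgam (gfactor d) w)^* != 0 by rewrite conj_neq0.
  have -> : F s = rgam (gfactor d) s * ((rgam (gfactor d) s)^-1 * F s) by rewrite mulrA mulfV // mul1r.
  by rewrite h; field.
have [n1 h1] := main _ fe1 e1; have [n2 h2] := main _ fe2 e2.
have F0 := FT _ sT.
have Fw : (F w)^* != 0.
  apply: contra_neq F0 => Fw0; move: h1; rewrite Fw0 mulr0 => /eqP.
  by rewrite mulf_eq0 (negbTE (conj_neq0 e1)) orbF => /eqP.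
apply: (mulfI F0); apply: (mulfI Fw); rewrite -/s.
have -> : (F w)^* * (F s * (root_number d2 * (rgam (gfactor d1) w)^* * rgam (gfactor d2) s)) =
  (F s * (rgam (gfactor d1) w)^*) * (root_number d2 * rgam (gfactor d2) s * (F w)^*) by ring.
by rewrite h1 -h2; ring.
Qed.

Lemma contc_reflect (f : C -> C) w : contc f (1 - w^*) -> contc (fun w => f (1 - w^*)) w.
Proof.
move=> /contcP h; apply/contcP => e e0; have [d d0 hd] := h e e0; exists d => // z zw.
apply: hd; rewrite (_ : _ - _ = - (z - w)^*); first by rewrite cabsN cabs_conj.
by rewrite rmorphB /=; ring.
Qed.

Lemma rgam_right_neq0 g s : gamma_data_ok g -> 0 < cRe s -> rgam g s != 0.
Proof.
move=> [Q0 ok] s0; apply/eqP => /(rgam_eq0 _ Q0) [p /ok [p0 pr] [k /(congr1 (@complex.Re R))]].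
rewrite cReD cReMr cReN cRe_nat => e.
have : 0 < p.1 * cRe s by rewrite mulr_gt0.
by have := ler0n R k; lra.
Qed.

Lemma rgam_punctured g w0 : gamma_data_ok g -> exists2 d, 0 < d & forall w, w != w0 ->
  cabs (w - w0) < d -> rgam g w != 0.
Proof.
move=> /(@rgam_local _ w0) [U [Uc U0 hU]]; have [d d0 hd] := contc_nz Uc U0.
exists d => // w ww /hd Uw; rewrite hU mulf_neq0 // expf_neq0 //.
by rewrite subr_eq0.
Qed.

Lemma fe_eventually_eq_poles (F : C -> C) (d1 d2 : fe_data R) : extended_selberg F ->
  satisfies_fe F d1 -> satisfies_fe F d2 ->
  eventually_eq_poles (factors (gfactor d1)) (factors (gfactor d2)).
Proof.
move=> /dirichlet_neq0 [T T1 FT] fe1 fe2; exists (T - 1) => w0 w0T.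
have [[u1 ok1] _] := fe1; have [[u2 ok2] _] := fe2.
have w0T' : cRe w0 < 1 - T by lra.
have [U1 [U1c U10 hU1]] := rgam_local w0 ok1; have [U2 [U2c U20 hU2]] := rgam_local w0 ok2.
have [e1 e10 he1] := rgam_punctured w0 ok1; have [e2 e20 he2] := rgam_punctured w0 ok2.
have Re0 : 0 < cRe (1 - w0^*) by rewrite cReB cRe_conj /=; lra.
pose B1 w := rgam (gfactor d2) (1 - w^*); pose B2 w := rgam (gfactor d1) (1 - w^*).
have B10 : B1 w0 != 0 by exact: rgam_right_neq0.
have B20 : B2 w0 != 0 by exact: rgam_right_neq0.
have B1c : contc B1 w0 by apply: contc_reflect; exact: contc_rgam ok2.1.
have B2c : contc B2 w0 by apply: contc_reflect; exact: contc_rgam ok1.1.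
pose d := Num.min (1 - T - cRe w0) (Num.min e1 e2).
have d0 : 0 < d by rewrite !lt_min e10 e20 subr_gt0 w0T'.
(* In moduli the root numbers and the conjugations disappear. *)
have key w : w != w0 -> cabs (w - w0) < d ->
    cabs ((w - w0) ^+ pole_count (factors (gfactor d1)) w0 * U1 w * B1 w) =
    cabs ((w - w0) ^+ pole_count (factors (gfactor d2)) w0 * U2 w * B2 w).
  move=> ww; rewrite !lt_min => /and3P [w1 w2 w3].
  have wT : cRe w < 1 - T.
    have := le_lt_trans (Re_le_cabs _) w1; rewrite cReB ltr_norml => /andP [_]; lra.
  have := fe_reflected T1 FT fe1 fe2 wT (he1 _ ww w2) (he2 _ ww w3).
  move=> /(congr1 (@cabs R)); rewrite -hU1 -hU2.
  by rewrite !cabsM !cabs_conj u1 u2 !mul1r.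
apply/eqP; rewrite eqn_leq; apply/andP; split.
  apply: (order_le U2c U1c B2c B1c U20 B20 d0) => w ww wd; exact/esym/key.
exact: (order_le U1c U2c B1c B2c U10 B10 d0 key).
Qed.

End Multiplicities.

(** * The identity left over once the Gamma products agree *)

Section Comparison.
Variable R : realType.
Local Notation C := R[i].
Implicit Types (g h : gamma_data R) (s c w x : C) (P : {poly C}).

Definition reflect_poly P : {poly C} := map_poly (@Num.conj C) P \Po (1 - 'X).

Lemma horner_reflect P x : (reflect_poly P).[x] = (P.[1 - x^*])^*.
Proof.
rewrite /reflect_poly horner_comp hornerD hornerN hornerX hornerC.
by rewrite -horner_map /= rmorphB /= rmorph1 conjCK.
Qed.

Lemma reflect_poly_neq0 P : P != 0 -> reflect_poly P != 0.
Proof.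
move=> P0; have [k hk] := poly_nonroot P0 (@inv_seq_inj R 0 1 ltr01).
apply: contra_neq hk => e; set z := (X in P.[X]).
have := horner_reflect P (1 - z)^*; rewrite e horner0 conjCK opprB addrC subrK.
by move=> /esym/eqP; rewrite conjC_eq0 => /eqP.
Qed.

Lemma reflect_polyZ (r : R) P : reflect_poly (r%:C%C *: P) = r%:C%C *: reflect_poly P.
Proof. by rewrite /reflect_poly map_polyZ /= conj_real comp_polyZ. Qed.

(** The roots of P satisfy Re z <= 0, those of its reflection Re z >= 1. *)
Lemma reflect_coprime P : (forall z, root P z -> cRe z <= 0) -> coprimep P (reflect_poly P).
Proof.
move=> h; apply/Pdiv.ClosedField.coprimepP => z Pz; rewrite horner_reflect conjC_eq0.
apply/negP => /h; rewrite cReB cRe_conj /=; have := h _ Pz; lra.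
Qed.

(** At a pole the imaginary part lambda k th + Im mu must vanish, which is impossible once k exceeds
    |Im mu| / (lambda |th|). *)
Lemma vertical_nonpole g (sg th : R) : gamma_data_ok g -> th != 0 ->
  exists K, forall k, (K <= k)%N -> rgam g (sg +i* (k%:R * th))%C != 0.
Proof.
move=> [Q0 ok] th0; have ath : 0 < `|th| by rewrite normr_gt0.
have [K hK] : exists K, forall k, (K <= k)%N -> forall p, p \in factors g ->
    p.1 * (k%:R * th) + cIm p.2 != 0.
  elim: (factors g) ok => [|p l IH] ok; first by exists 0%N.
  have [|K hK] := IH; first by move=> q ql; apply: ok; rewrite inE ql orbT.
  have [p0 _] := ok p (mem_head _ _).
  pose b := `|cIm p.2| / (p.1 * `|th|).
  have pt : 0 < p.1 * `|th| by rewrite mulr_gt0.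
  exists (maxn K (Num.bound b)) => k; rewrite geq_max => /andP [k1 k2] q.
  rewrite inE => /orP [/eqP ->|]; last exact: hK.
  have : b < k%:R.
    by apply: lt_le_trans (archi_boundP _) _; rewrite ?ler_nat // divr_ge0 // ltW.
  rewrite ltr_pdivrMr // => bk; apply: contraTneq bk => /eqP.
  rewrite addrC addr_eq0 => /eqP ->.
  by rewrite -leNgt normrN !normrM normr_nat (gtr0_norm p0) mulrCA.
exists K => k /hK h; apply/eqP => /(rgam_eq0 _ Q0) [p /h hp [j /(congr1 (@complex.Im R))]].
rewrite cImD cImMr cImN cIm_nat oppr0 /= => /eqP.
exact/negP.
Qed.

Lemma cexp_2pi (k : nat) : cexp (0 +i* (k%:R * (2 * pi)))%C = 1 :> C.
Proof.
have e : k%:R * (2 * pi) = pi *+ 2 *+ k :> R by rewrite -[RHS]mulr_natl -[pi *+ 2]mulr_natl.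
rewrite /cexp /= expR0 mul1r e; apply: cplx_ext => /=.
  by have := periodicn (@cosD2pi R) k 0; rewrite add0r cos0.
by have := periodicn (@sinD2pi R) k 0; rewrite add0r sin0.
Qed.

Section Matched.
Variables (F : C -> C) (d1 d2 : fe_data R) (T : R).
Hypothesis T1 : 1 <= T.
Hypothesis FT : forall s, T < cRe s -> F s != 0.
Hypothesis fe1 : satisfies_fe F d1.
Hypothesis fe2 : satisfies_fe F d2.
Variables (c1 c2 : C) (P1 P2 : {poly C}) (h1 h2 : gamma_data R).
Hypothesis r1 : reach (gfactor d1) c1 P1 h1.
Hypothesis r2 : reach (gfactor d2) c2 P2 h2.
Hypothesis ph : perm_eq (factors h1) (factors h2).

Let ok1 : gamma_data_ok (gfactor d1) := fe1.1.2.
Let ok2 : gamma_data_ok (gfactor d2) := fe2.1.2.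
Let N := reflect_poly P1 * P2.
Let D := reflect_poly P2 * P1.
Let L := ln (gamma_Q h1) - ln (gamma_Q h2).

(* After the transformations the Gamma products agree and drop out of the two
   functional equations. *)
Lemma matched_identity : exists A1 A2 : R, [/\ 0 < A1, 0 < A2 & forall x, T < cRe x ->
  rgam (gfactor d1) (1 - x^*) != 0 -> rgam (gfactor d2) (1 - x^*) != 0 ->
  root_number d2 * (A2%:C%C * c2)^* * (A1%:C%C * c1) * cpow (gamma_Q h2) 1 *
    cexp (2 * x * L%:C%C) * N.[x] =
  root_number d1 * (A1%:C%C * c1)^* * (A2%:C%C * c2) * cpow (gamma_Q h1) 1 * D.[x]].
Proof.
have [c10 [A1 A10 hA1]] := reach_rgam ok1 r1.
have [c20 [A2 A20 hA2]] := reach_rgam ok2 r2.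
have [Q1 _] := reach_ok ok1 r1; have [Q2 _] := reach_ok ok2 r2.
exists A1, A2; split => // x xT e1 e2.
set w := 1 - x^* in e1 e2; have xw : 1 - w^* = x.
  by rewrite /w rmorphB /= rmorph1 conjCK opprB addrC subrK.
have wT : cRe w < 1 - T by rewrite /w cReB cRe_conj /=; lra.
have wc : w^* = 1 - x by rewrite -xw opprB addrC subrK.
have star := fe_reflected T1 FT fe1 fe2 wT e1 e2; rewrite xw in star.
have x0 : 0 < cRe x := lt_trans (lt_le_trans ltr01 T1) xT.
have ex1 := rgam_right_neq0 ok1 x0.
pose G s := \prod_(p <- factors h1) rGamma (p.1%:C%C * s + p.2).
have g1 s : rgam h1 s = (cpow (gamma_Q h1) s)^-1 * G s by rewrite rgamE.
have g2 s : rgam h2 s = (cpow (gamma_Q h2) s)^-1 * G s.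
  by rewrite rgamE; congr (_ * _); rewrite /G (perm_big _ ph).
have a10 : A1%:C%C * c1 != 0 by rewrite mulf_neq0 // real_neq0 // gt_eqF.
have a20 : A2%:C%C * c2 != 0 by rewrite mulf_neq0 // real_neq0 // gt_eqF.
move: hA1 hA2 a10 a20; set a1 := A1%:C%C * c1; set a2 := A2%:C%C * c2 => hA1 hA2 a10 a20.
clearbody a1 a2.
have Gx : G x != 0.
  have : a1 * rgam (gfactor d1) x != 0 by rewrite mulf_neq0.
  by rewrite -hA1 g1; apply: contra_neq => ->; rewrite !mulr0.
have Gw : (G w)^* != 0.
  have : a1 * rgam (gfactor d1) w != 0 by rewrite mulf_neq0.
  by rewrite -hA1 g1 conjC_eq0; apply: contra_neq => ->; rewrite !mulr0.
have E : root_number d2 * a2^* * a1 * ((a1 * rgam (gfactor d1) w)^* * (a2 * rgam (gfactor d2) x)) =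
    root_number d1 * a1^* * a2 * ((a2 * rgam (gfactor d2) w)^* * (a1 * rgam (gfactor d1) x)).
  rewrite !(rmorphM (@Num.conj C)) /=.
  have -> : root_number d2 * a2^* * a1 * (a1^* * (rgam (gfactor d1) w)^* * (a2 * rgam (gfactor d2) x)) =
    a2^* * a1 * a1^* * a2 * (root_number d2 * (rgam (gfactor d1) w)^* * rgam (gfactor d2) x) by ring.
  by rewrite star; ring.
move: E; rewrite -!hA1 -!hA2 !g1 !g2.
have cj h : 0 < gamma_Q h -> ((cpow (gamma_Q h) w)^-1)^* = cpow (gamma_Q h) x / cpow (gamma_Q h) 1.
  move=> Qh; rewrite fmorphV /= conj_cpow // wc cpowD // cpowN //.
  by rewrite invfM invrK mulrC.
have -> : (P1.[w] * ((cpow (gamma_Q h1) w)^-1 * G w))^* =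
   (reflect_poly P1).[x] * (cpow (gamma_Q h1) x / cpow (gamma_Q h1) 1) * (G w)^*.
  by rewrite horner_reflect -cj // !(rmorphM (@Num.conj C)) /= mulrA.
have -> : (P2.[w] * ((cpow (gamma_Q h2) w)^-1 * G w))^* =
   (reflect_poly P2).[x] * (cpow (gamma_Q h2) x / cpow (gamma_Q h2) 1) * (G w)^*.
  by rewrite horner_reflect -cj // !(rmorphM (@Num.conj C)) /= mulrA.
have eL : cexp (2 * x * L%:C%C) = (cpow (gamma_Q h1) x / cpow (gamma_Q h2) x) ^+ 2.
  rewrite !cpowE // -cexpN -cexpD expr2 -cexpD; congr cexp.
  by rewrite /L rmorphB /=; ring.
rewrite eL /N /D !hornerM.
have q1x := cpow_neq0 x Q1; have q2x := cpow_neq0 x Q2.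
have q11 := cpow_neq0 1 Q1; have q21 := cpow_neq0 1 Q2.
move: (cpow (gamma_Q h1) x) (cpow (gamma_Q h2) x) (cpow (gamma_Q h1) 1) (cpow (gamma_Q h2) 1) q1x q2x q11 q21.
move=> u1 u2 v1 v2 u10 u20 v10 v20.
move: (reflect_poly P1).[x] (reflect_poly P2).[x] (P1.[x]) (P2.[x]) => R1 R2 p1 p2.
move: (root_number d1 * a1^* * a2) (root_number d2 * a2^* * a1) => k1 k2.
move: (G x) ((G w)^*) Gx Gw => Gx Gw Gx0 Gw0 E.
have M0 : Gx * Gw * u2 / (u1 * v1 * v2) != 0.
  by rewrite !mulf_neq0 // invr_neq0 // !mulf_neq0.
apply: (mulfI M0); transitivity (k2 * (R1 * (u1 / v1) * Gw * (p2 * (u2^-1 * Gx)))).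
  by field; rewrite ?u10 ?u20 ?v10 ?v20.
by rewrite E; field; rewrite ?u10 ?u20 ?v10 ?v20.
Qed.

Lemma matched_compare : exists r : R, [/\ 0 < r, P1 = r%:C%C *: P2,
  gamma_Q h1 = gamma_Q h2 &
  root_number d1 * c1^* / c1 = root_number d2 * c2^* / c2].
Proof.
have [A1 [A2 [A10 A20 key]]] := matched_identity.
have [c10 _] := reach_rgam ok1 r1; have [c20 _] := reach_rgam ok2 r2.
have [Q1 _] := reach_ok ok1 r1; have [Q2 _] := reach_ok ok2 r2.
have [[l1 l10 el1] rt1] := reach_poly ok1 r1.
have [[l2 l20 el2] rt2] := reach_poly ok2 r2.
have P10 : P1 != 0 by rewrite -lead_coef_eq0 el1 real_neq0 // gt_eqF.
have P20 : P2 != 0 by rewrite -lead_coef_eq0 el2 real_neq0 // gt_eqF.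
have w10 : root_number d1 != 0 by rewrite -cabs_eq0 fe1.1.1 oner_eq0.
have w20 : root_number d2 != 0 by rewrite -cabs_eq0 fe2.1.1 oner_eq0.
have a10 : A1%:C%C * c1 != 0 by rewrite mulf_neq0 // real_neq0 // gt_eqF.
have a20 : A2%:C%C * c2 != 0 by rewrite mulf_neq0 // real_neq0 // gt_eqF.
have q10 := cpow_neq0 1 Q1; have q20 := cpow_neq0 1 Q2.
set k1 := root_number d1 * (A1%:C%C * c1)^* * (A2%:C%C * c2) in key.
set k2 := root_number d2 * (A2%:C%C * c2)^* * (A1%:C%C * c1) in key.
have k10 : k1 != 0 := mulf_neq0 (mulf_neq0 w10 (conj_neq0 a10)) a20.
have k20 : k2 != 0 := mulf_neq0 (mulf_neq0 w20 (conj_neq0 a20)) a10.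
have N0 : N != 0 by rewrite mulf_neq0 // reflect_poly_neq0.
(* On a vertical line with abscissa sg the factor cexp (2 x L) is constant along an
   arithmetic progression, so the identity becomes one between polynomials. *)
have polyid sg : T < sg -> (k2 * cpow (gamma_Q h2) 1 * (expR (2 * sg * L))%:C%C) *: N =
    (k1 * cpow (gamma_Q h1) 1) *: D.
  (* With th = pi / L, each step adds 2 pi i to the exponent 2 x L; for L = 0 any nonzero step
     serves. *)
  move=> sT; pose th : R := if L == 0 then 1 else pi / L.
  have th0 : th != 0.
    rewrite /th; case: ifPn => [_|L0]; first exact: oner_neq0.
    by rewrite mulf_neq0 ?invr_neq0 // gt_eqF // pi_gt0.
  have per (k : nat) : cexp (2 * (sg +i* (k%:R * th))%C * L%:C%C) = (expR (2 * sg * L))%:C%C.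
    have -> : 2 * (sg +i* (k%:R * th))%C * L%:C%C =
        (2 * sg * L)%:C%C + (0 +i* (k%:R * (2 * (th * L))))%C :> C.
      have -> : (2 : C) = 2%:C%C by rewrite (rmorph_nat (real_complex R)).
      by apply: cplx_ext => /=; ring.
    rewrite cexpD cexp_real /th; case: ifPn => [/eqP ->|L0].
      by rewrite !mulr0 (_ : (0 +i* 0)%C = 0) // cexp0 mulr1.
    by rewrite divfK // cexp_2pi mulr1.
  have [K1 hK1] := vertical_nonpole (1 - sg) ok1 th0.
  have [K2 hK2] := vertical_nonpole (1 - sg) ok2 th0.
  apply/eqP; rewrite -subr_eq0; apply/contraT => nz.
  pose f (j : nat) : C := (sg +i* ((maxn K1 K2 + j)%:R * th))%C.
  have fi : injective f.
    move=> i j [] /(mulIf th0) /eqP; rewrite eqr_nat eqn_add2l.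
    by move/eqP.
  have [j] := poly_nonroot nz fi.
  have fw : 1 - (f j)^* = ((1 - sg) +i* ((maxn K1 K2 + j)%:R * th))%C.
    by apply: cplx_ext; rewrite /f ?(cReB, cImB) ?(cRe_conj, cIm_conj) /=; ring.
  have n1 : (K1 <= maxn K1 K2 + j)%N by rewrite (leq_trans (leq_maxl _ K2)) ?leq_addr.
  have n2 : (K2 <= maxn K1 K2 + j)%N by rewrite (leq_trans (leq_maxr K1 _)) ?leq_addr.
  have := key (f j) sT; rewrite fw => /(_ (hK1 _ n1) (hK2 _ n2)); rewrite per => e.
  by rewrite hornerD hornerN !hornerZ e subrr eqxx.
(* The right side does not depend on the abscissa, so exp(2 sg L) takes the same value at two
   different sg. *)
have eL : L = 0.
  have t1 : T < T + 1 by rewrite ltrDl.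
  have t2 : T < T + 2 by rewrite ltrDl.
  have := polyid _ t1; rewrite -(polyid _ t2) => /eqP.
  rewrite -subr_eq0 -scalerBl scaler_eq0 (negbTE N0) orbF subr_eq0 => /eqP.
  have kq : k2 * cpow (gamma_Q h2) 1 != 0 by rewrite mulf_neq0.
  by move/(mulfI kq)/complexI/expR_inj; lra.
have eQ : gamma_Q h1 = gamma_Q h2.
  by apply: ln_inj; rewrite ?posrE //; apply/eqP; rewrite -subr_eq0; apply/eqP.
have ND : k2 *: N = k1 *: D.
  have t1 : T < T + 1 by rewrite ltrDl.
  have := polyid _ t1; rewrite eL mulr0 expR0 rmorph1 mulr1 -eQ.
  move: k1 k2 {polyid key k10 k20} => k1 k2 e; apply: (scalerI q10).
  by rewrite !scalerA ![cpow _ _ * _]mulrC.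
(* P1 divides D, hence N, the product of its own reflection and P2; being coprime to the reflection,
   it divides P2. *)
have d12 : P1 %| P2.
  rewrite -(Gauss_dvdpr _ (reflect_coprime rt1)) -/N -(dvdpZr _ _ k20) ND dvdpZr //.
  exact: dvdp_mull.
have d21 : P2 %| P1.
  rewrite -(Gauss_dvdpr _ (reflect_coprime rt2)) -/D -(dvdpZr _ _ k10) -ND dvdpZr //.
  exact: dvdp_mull.
have /eqpfP e12 : P1 %= P2 by rewrite /eqp d12 d21.
exists (l1 / l2); have r0 : 0 < l1 / l2 by rewrite divr_gt0.
have eP : P1 = (l1 / l2)%:C%C *: P2 by rewrite fmorph_div /= -el1 -el2.
(* Reflection commutes with the real factor l1 / l2, so N = D and the constants agree. *)
have kk : k2 = k1.
  have DN : N = D.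
    by rewrite /N /D eP reflect_polyZ -scalerAl -scalerAr.
  move: ND; rewrite -DN => /eqP; rewrite -subr_eq0 -scalerBl scaler_eq0 (negbTE N0) orbF.
  by rewrite subr_eq0 => /eqP.
split => //; move: kk; rewrite /k1 /k2 !(rmorphM (@Num.conj C)) /= !conj_real.
have A1C : (A1%:C%C : C) != 0 by rewrite real_neq0 // gt_eqF.
have A2C : (A2%:C%C : C) != 0 by rewrite real_neq0 // gt_eqF.
move=> kk; have AA : A1%:C%C * A2%:C%C * (c1 * c2) != 0 by rewrite !mulf_neq0.
apply: (mulfI AA).
transitivity (root_number d1 * (A1%:C%C * c1^*) * (A2%:C%C * c2)); first by field.
by rewrite -kk; field.
Qed.

End Matched.
End Comparison.

(** * From a stable extension to invariance *)

Section StableExtension.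
Variable R : realType.
Local Notation C := R[i].
Implicit Types (g h : gamma_data R) (F : C -> C).

Lemma divf_cancel (K : fieldType) (a b : K) : a != 0 -> a / (a * b) = 1 / b.
Proof. by move=> a0; rewrite invfM mulrA mulfV. Qed.

Lemma fe_data_eta (d : fe_data R) : d = FeData (root_number d) (gfactor d).
Proof. by case: d. Qed.

Lemma reach1_fe F (d : fe_data R) c g' : satisfies_fe F d -> reach (gfactor d) c 1 g' ->
  satisfies_fe F (FeData (root_number d * c^* / c) g').
Proof.
move=> fe r; have [[w1 ok] _] := fe.
have [c0 [A A0 hA]] := reach_rgam ok r.
have AC : (A%:C%C : C) != 0 by rewrite real_neq0 // gt_eqF.
apply: (@satisfies_fe_scaled _ F d _ (A%:C%C * c)) => //=.
- by rewrite mulf_neq0.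
- split; last exact: reach_ok ok r.
  by rewrite /= -mulrA cabsM w1 unit_conj // mulr1.
- by rewrite (rmorphM (@Num.conj C)) /= conj_real; field; rewrite AC c0.
by move=> s; rewrite -hA hornerC mul1r.
Qed.

Lemma refined_mem (m : R -> nat) (l : seq (R * C)) p :
  p \in flatten [seq refined m q | q <- l] ->
  exists2 q, q \in l & p.1 = q.1 / (m q.1)%:R.
Proof.
move=> /flattenP [_ /mapP [q ql ->]] /mapP [k _ ->]; exists q => //.
Qed.

(** Both gamma-factors are refined with the same function m, so commensurable lambdas from different
    sides become equal. *)
Lemma refined_separated g1 g2 : gamma_data_ok g1 -> gamma_data_ok g2 ->
  exists c1 c2 g1' g2', [/\ reach g1 c1 1 g1', reach g2 c2 1 g2' &
    separated (factors g1') (factors g2')].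
Proof.
move=> ok1 ok2; pose S := [seq p.1 | p <- factors g1 ++ factors g2].
have S1 p : p \in factors g1 -> p.1 \in S.
  by move=> pg; apply/map_f; rewrite mem_cat pg.
have S2 p : p \in factors g2 -> p.1 \in S.
  by move=> pg; apply/map_f; rewrite mem_cat pg orbT.
have S0 x : x \in S -> 0 < x.
  by move=> /mapP [p + ->]; rewrite mem_cat => /orP [/ok1.2|/ok2.2] [].
have [m [m0 mE]] := common_refinement S0.
have [c1 [g1' [r1 e1]]] := reach_refined (fun p pg => m0 _ (S1 p pg)).
have [c2 [g2' [r2 e2]]] := reach_refined (fun p pg => m0 _ (S2 p pg)).
exists c1, c2, g1', g2'; split => //.
split; first by move=> p /(reach_ok ok1 r1).2 [].
split; first by move=> p /(reach_ok ok2 r2).2 [].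
move=> p q; rewrite e1 e2 => /refined_mem [p' pp ->] /refined_mem [q' qq ->].
have [pS qS] := (S1 _ pp, S2 _ qq).
have [cm|nc] := pselect (commensurable p'.1 q'.1); [left|right].
  exact: mE.
by move/commensurable_div => h; apply: nc; apply: h; exact: m0.
Qed.

Lemma stable_extension_invariant (I : selberg_data R -> C) Istar :
  rational_extension I Istar -> mult_stable Istar -> fact_stable Istar -> is_invariant I.
Proof.
move=> ext ms fs F d1 d2 FS fe1 fe2.
have ok1 := fe1.1.2; have ok2 := fe2.1.2.
have [c1 [c2 [g1 [g2 [r1 r2 sep]]]]] := refined_separated ok1 ok2.
have fe1' := reach1_fe fe1 r1; have fe2' := reach1_fe fe2 r2.
set e1 := FeData _ g1 in fe1'; set e2 := FeData _ g2 in fe2'.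
have ev := fe_eventually_eq_poles FS fe1' fe2'.
have p1 : perm_eq (factors g1) (factors g1 ++ [::]) by rewrite cats0.
have p2 : perm_eq (factors g2) (factors g2 ++ [::]) by rewrite cats0.
have [P1 [P2 [h1 [h2 [s1 s2 ph]]]]] :=
  match_factors sep ev (reach_refl g1) (reach_refl g2) p1 p2.
have [T T1 FT] := dirichlet_neq0 FS.
(* The equations compared are the refined ones, which F still satisfies. The matching then uses the
   factorial formula alone, so both constants are 1. *)
have [r [r0 eP eQ eW]] := @matched_compare R F e1 e2 T T1 FT fe1' fe2' 1 1 P1 P2 h1 h2 s1 s2 ph.
have rC : (r%:C%C : C) != 0 by rewrite real_neq0 // gt_eqF.
have [l0 l00 el2] := (reach_poly (fe2'.1.2) s2).1.
have P20 : P2 != 0 by rewrite -lead_coef_eq0 el2 real_neq0 // gt_eqF.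
have f1 : (1 : ratfun R) != 0 by exact: oner_neq0.
have fr : tofrac (r%:C%C : C)%:P != 0 by rewrite tofrac_eq0 polyC_eq0.
have one : (1 : ratfun R) = tofrac (1 : C)%:P by rewrite tofrac1.
have cross Rf (d : fe_data R) c g P h : Rf != 0 -> fe_data_ok d ->
    reach (gfactor d) c 1 g -> reach g 1 P h ->
    Istar Rf d = Istar (Rf / tofrac P) (FeData (root_number d * c^* / c) h).
  move=> Rf0 [w1 ok] rr ss; have := reach_trans rr ss; rewrite mulr1 mul1r => rs.
  by rewrite [in LHS](fe_data_eta d); exact: (reach_stable ms fs Rf0 w1 ok rs).
(* Starting from the constant r on the side of d1 and from 1 on the side of d2, both chains end with
   the rational function 1 / P2, because P1 = r P2. *)
rewrite -(ext _ d1 rC) -(ext 1 d2 (oner_neq0 _)).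
rewrite (cross _ _ _ _ _ _ fr fe1.1 r1 s1) -one (cross _ _ _ _ _ _ f1 fe2.1 r2 s2).
have eR : tofrac (r%:C%C : C)%:P / tofrac P1 = 1 / tofrac P2 :> ratfun R.
  by rewrite eP -mul_polyC tofracM; exact: divf_cancel fr.
have eW' : root_number (sval d1) * c1^* / c1 = root_number (sval d2) * c2^* / c2.
  by move: eW; rewrite /e1 /e2 /= rmorph1 !mulr1 !divr1.
rewrite [X in Istar X _ = _]eR eW'.
apply: (perm_data_stable ms (frac_neq0 f1 P20)) ph eQ.
split; last by rewrite /=; exact: reach_ok fe1'.1.2 s1.
by rewrite /= -eW'; exact: fe1'.1.1.
Qed.

End StableExtension.

Theorem mainTheorem1 (R : realType) (I : selberg_data R -> R[i]) :
  is_invariant I <->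
  exists Istar : ratfun R -> fe_data R -> R[i],
    [/\ rational_extension I Istar, mult_stable Istar & fact_stable Istar].
Proof.
split; first exact: invariant_extension.
by move=> [Istar [ext ms fs]]; exact: stable_extension_invariant ext ms fs.
Qed.
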